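(* Let $\Sigma$ be a complete strongly unimodular fan of dimension $d$ in $N_{\mathbb R}$, and let $v\in N_{\mathbb R}$ be sufficiently generic. For any two $T$-equivariant Grothendieck weights $g_1,g_2$ on $\Sigma$ and every $\gamma\in\Sigma$, $$(g_1g_2)(\gamma)=\sum_{\substack{\sigma,\tau\in\Sigma,\ \sigma,\tau\supseteq\gamma\\ (\sigma+v)\cap\tau\ne\varnothing\\ \sigma\cap\tau=\gamma}}(-1)^{\dim\sigma+\dim\tau-d+\dim\gamma}\,g_1(\sigma)\,g_2(\tau).$$
   Context: Let $N$ be a lattice of rank $d$, $M=\mathrm{Hom}(N,\mathbb Z)$, $N_{\mathbb R}=N\otimes\mathbb R$; for a cone $\sigma$ put $N_\sigma=N\cap\mathrm{span}_{\mathbb R}(\sigma)$. A fan $\Sigma$ is strongly unimodular if it is unimodular and for all $\sigma,\tau\in\Sigma$ the index $[N:N_\sigma+N_\tau]$ is $1$ or infinite. Let $X=X_\Sigma$ be the smooth complete toric variety over a field, $T$ its dense torus, $R(T)=\mathbb Z[M]$, $\chi_T:K_T(X)\to R(T)$ the equivariant Euler characteristic, and $x_\sigma=[\mathcal O_{V(\sigma)}]\in K_T(X)$, where $V(\sigma)$ is the closure of the torus orbit of $\sigma$. An equivariant Grothendieck weight on $\Sigma$ is a function $g:\Sigma\to R(T)$ such that $\sum_\sigma a_\sigma g(\sigma)=0$ whenever $a_\sigma\in R(T)$ satisfy $\sum_\sigma a_\sigma x_\sigma=0$ in $K_T(X)$. The map $\alpha\mapsto g_\alpha$, $g_\alpha(\sigma)=\chi_T(\alpha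 x_\sigma)$, is an $R(T)$-module isomorphism from $K_T(X)$ to the module of equivariant Grothendieck weights; the product of weights is the one transported from $K_T(X)$, i.e. $g_\alpha g_\beta=g_{\alpha\beta}$. A vector $v\in N_{\mathbb R}$ is sufficiently generic if for all $\sigma,\tau\in\Sigma$, whenever $(\sigma+v)\cap\tau\ne\varnothing$, one has $(\sigma^\circ+v)\cap\tau^\circ\neq\varnothing$ (relative interiors) and $\dim((\sigma+v)\cap\tau)=\dim\sigma+\dim\tau-d$. *)

(* Defs.v *)
From HB Require Import structures.
From mathcomp Require Import all_boot all_order all_algebra finmap.
From mathcomp Require Import boolp classical_sets reals.
From mathcomp Require Export monalg.

Set Implicit Arguments.
Unset Strict Implicit.
Unset Printing Implicit Defensive.

Import Order.TTheory GRing.Theory Num.Theory.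

Local Open Scope fset_scope.
Local Open Scope classical_set_scope.
Local Open Scope ring_scope.

(******************************************************************************)
(* N = Z^d and M = Hom(N, Z) = Z^d are both 'rV[int]_d, paired by the dot     *)
(* product; N_R is 'rV[R]_d.  A cone is a set of vectors of N_R and a fan is  *)
(* a finite set of cones.                                                     *)
(*                                                                            *)
(* The toric variety X is accessed through its cover by the T-invariant       *)
(* affine opens U_kappa = Spec k[kappa^dual :&: M], kappa in the fan:         *)
(* - a T-equivariant quasi-coherent sheaf on U_kappa is an M-graded module    *)
(*   over k[kappa^dual :&: M];                                                *)
(* - U_kappa and U_tau intersect in U_(kappa :&: tau).                        *)
(* The character of T attached to m acts with weight m on sections, i.e. the  *)
(* function chi^m is a section of weight m.                                   *)
(******************************************************************************)

(******************************************************************************)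
(* R(T) = Z[M].  The library puts a ring structure on {malg G[K]} only when   *)
(* the monoid K has no non-trivial unit, so the group ring is built here.     *)
(******************************************************************************)
Definition RT (d : nat) : Type := {malg int['rV[int]_d]}.
HB.instance Definition _ d := GRing.Zmodule.on (RT d).

Section GroupRing.
Variable d : nat.
Implicit Types (f g h : RT d).

Definition RTone : RT d := << 1 *g 0 >>.
Definition RTmul f g : RT d :=
  \sum_(p <- msupp f) \sum_(q <- msupp g) << f@_p * g@_q *g p + q >>.

Lemma RTmulw (D1 D2 : {fset 'rV[int]_d}) f g :
  (msupp f `<=` D1)%fset -> (msupp g `<=` D2)%fset ->
  RTmul f g = \sum_(p <- D1) \sum_(q <- D2) << f@_p * g@_q *g p + q >>.
Proof.
move=> le1 le2; rewrite /RTmul (big_fset_incl _ le1) /=.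
  apply/eq_bigr=> p _; apply/big_fset_incl => // q _ /mcoeff_outdom ->.
  by rewrite mulr0 monalgU0.
move=> p _ /mcoeff_outdom fp.
by rewrite big1 // => q _; rewrite fp mul0r monalgU0.
Qed.

Lemma RTmulC : commutative RTmul.
Proof.
move=> f g; rewrite /RTmul exchange_big /=; apply/eq_bigr => p _.
by apply/eq_bigr => q _; rewrite mulrC addrC.
Qed.

Lemma RTmulDl : left_distributive RTmul +%R.
Proof.
move=> f g h.
rewrite (RTmulw (msuppD_le f g) (fsubset_refl _)).
rewrite (RTmulw (fsubsetUl _ (msupp g)) (fsubset_refl (msupp h))).
rewrite (RTmulw (fsubsetUr (msupp f) _) (fsubset_refl (msupp h))).
rewrite -big_split /=; apply/eq_bigr=> p _.
rewrite -big_split /=; apply/eq_bigr=> q _.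
by rewrite mcoeffD mulrDl monalgUD.
Qed.

Lemma RTmul0 : left_zero 0 RTmul.
Proof. by move=> g; rewrite /RTmul msupp0 big_seq_fset0. Qed.

Lemma RTmulDr : right_distributive RTmul +%R.
Proof. by move=> f g h; rewrite RTmulC RTmulDl !(RTmulC f). Qed.

Lemma RTmulr0 : right_zero 0 RTmul.
Proof. by move=> g; rewrite RTmulC RTmul0. Qed.

Lemma RTmulUU (a b : int) (p q : 'rV[int]_d) :
  RTmul << a *g p >> << b *g q >> = << a * b *g p + q >>.
Proof. by rewrite (RTmulw msuppU_le msuppU_le) !big_seq_fset1 !mcoeffUU. Qed.

Lemma RTmulsuml (I : Type) (r : seq I) (F : I -> RT d) g :
  RTmul (\sum_(i <- r) F i) g = \sum_(i <- r) RTmul (F i) g.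
Proof. exact: (big_morph (RTmul^~ g) (fun x y => RTmulDl x y g) (RTmul0 g)). Qed.

Lemma RTmulsumr (I : Type) (r : seq I) (F : I -> RT d) g :
  RTmul g (\sum_(i <- r) F i) = \sum_(i <- r) RTmul g (F i).
Proof. exact: (big_morph (RTmul g) (fun x y => RTmulDr g x y) (RTmulr0 g)). Qed.

Lemma RTmul1 : left_id RTone RTmul.
Proof.
move=> g; rewrite [g in LHS]monalgE RTmulsumr [RHS]monalgE.
by apply/eq_bigr => p _; rewrite RTmulUU mul1r add0r.
Qed.

Lemma RTmulA : associative RTmul.
Proof.
move=> f g h.
have monE (u : RT d) : u = \sum_(p <- msupp u) (<< u@_p *g p >> : RT d).
  exact: monalgE.
rewrite (monE f) RTmulsuml RTmulsuml RTmulsuml; apply/eq_bigr => p _.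
rewrite (monE g) RTmulsuml RTmulsumr RTmulsumr RTmulsuml.
apply/eq_bigr => q _.
rewrite (monE h) !RTmulsumr; apply/eq_bigr => s _.
by rewrite !RTmulUU mulrA addrA.
Qed.

Lemma RTone_neq0 : RTone != 0.
Proof. by rewrite monalgU_eq0 oner_eq0. Qed.

End GroupRing.

HB.instance Definition _ d := GRing.Zmodule_isComNzRing.Build (RT d)
  (@RTmulA d) (@RTmulC d) (@RTmul1 d) (@RTmulDl d) (@RTone_neq0 d).

(******************************************************************************)
(* Convex geometry in N_R                                                     *)
(******************************************************************************)
Section Geometry.
Variables (R : realType) (d : nat).
Local Notation NR := ('rV[R]_d).
Local Notation N := ('rV[int]_d).
Local Notation M := ('rV[int]_d).
Implicit Types (A sigma tau : set NR) (Sigma : {fset (set NR)}).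

Definition toR (u : 'rV[int]_d) : NR := map_mx intr u.

Definition dot (u x : NR) : R := (u *m x^T) 0 0.

Definition lin_span A : set NR :=
  [set x | exists (n : nat) (c : 'I_n -> R) (y : 'I_n -> NR),
     (forall i, A (y i)) /\ x = \sum_i c i *: y i].

Definition differences A : set NR := [set x - y | x in A & y in A].

(* Dimension of the affine hull of A: the largest number of linearly
   independent differences of points of A. *)
Definition set_dim A : nat :=
  \max_(n < d.+1 | `[< exists B : 'M[R]_(n, d),
     row_free B /\ forall i, differences A (row i B) >]) n.

Definition relint A : set NR :=
  [set x | A x /\ exists2 e : R, 0 < e &
     forall y, lin_span (differences A) (y - x) ->
       (forall j, `|y 0 j - x 0 j| < e) -> A y].

Definition cone_hull (s : seq NR) : set NR :=
  [set x | exists2 c : 'I_(size s) -> R,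
     (forall i, 0 <= c i) & x = \sum_i c i *: s`_i].

Definition rational_polyhedral sigma : Prop :=
  exists s : seq N, sigma = cone_hull (map toR s).

Definition strongly_convex sigma : Prop :=
  forall x, sigma x -> sigma (- x) -> x = 0.

Definition face tau sigma : Prop :=
  exists2 u : NR, (forall x, sigma x -> 0 <= dot u x) &
    tau = [set x | sigma x /\ dot u x = 0].

Definition fan Sigma : Prop :=
  [/\ forall sigma, sigma \in Sigma ->
        rational_polyhedral sigma /\ strongly_convex sigma,
      forall sigma tau, sigma \in Sigma -> face tau sigma -> tau \in Sigma &
      forall sigma tau, sigma \in Sigma -> tau \in Sigma ->
        face (sigma `&` tau) sigma /\ face (sigma `&` tau) tau].

Definition complete Sigma : Prop :=
  forall x : NR, exists2 sigma, sigma \in Sigma & sigma x.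

(* The rows of an invertible integer matrix are the Z-bases of N. *)
Definition unimodular_cone sigma : Prop :=
  exists2 B : 'M[int]_d, B \in unitmx &
    exists I : {set 'I_d}, sigma = cone_hull [seq toR (row i B) | i <- enum I].

Definition unimodular Sigma : Prop :=
  forall sigma, sigma \in Sigma -> unimodular_cone sigma.

Definition cone_lattice sigma : set N := [set u | lin_span sigma (toR u)].

Definition finite_index (H : set N) : Prop :=
  exists s : seq N, forall x, exists2 y, y \in s & H (x - y).

Definition strongly_unimodular Sigma : Prop :=
  unimodular Sigma /\
  forall sigma tau, sigma \in Sigma -> tau \in Sigma ->
    let H := [set a + b | a in cone_lattice sigma & b in cone_lattice tau] in
    H = setT \/ ~ finite_index H.

Definition shift A (v : NR) : set NR := [set x + v | x in A].

Definition sufficiently_generic Sigma (v : NR) : Prop :=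
  forall sigma tau, sigma \in Sigma -> tau \in Sigma ->
    shift sigma v `&` tau !=set0 ->
    shift (relint sigma) v `&` relint tau !=set0 /\
    (set_dim (shift sigma v `&` tau))%:Z
      = (set_dim sigma)%:Z + (set_dim tau)%:Z - d%:Z.

Definition dual_monoid sigma : set M :=
  [set m | forall x, sigma x -> 0 <= dot (toR m) x].

Definition perp sigma : set M :=
  [set m | forall x, sigma x -> dot (toR m) x = 0].

End Geometry.

(******************************************************************************)
(* T-equivariant coherent sheaves on X                                        *)
(******************************************************************************)
Section Sheaves.
Variables (R : realType) (k : fieldType) (d : nat).
Local Notation cone := (set 'rV[R]_d).
Local Notation M := ('rV[int]_d).

(* k^(sdim kappa m) is the space of sections of weight m over U_kappa.  For
   tau a face of kappa and m' - m in the dual monoid of tau, sres kappa tau m m'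
   is restriction to U_tau followed by multiplication by chi^(m' - m); it acts
   on row vectors on the right.  The other values are irrelevant. *)
Record tsheaf := TSheaf {
  sdim : cone -> M -> nat;
  sres : forall (kappa tau : cone) (m m' : M),
           'M[k]_(sdim kappa m, sdim tau m') }.

(* Tensoring with the character u of T, i.e. multiplication by e^u in K_T(X). *)
Definition twist (u : M) (E : tsheaf) : tsheaf :=
  @TSheaf (fun kappa m => sdim E kappa (m - u))
          (fun kappa tau m m' => sres E kappa tau (m - u) (m' - u)).

(* O_V(sigma): on U_kappa, V(sigma) is Spec k[kappa^dual :&: sigma^perp :&: M]
   if sigma is a face of kappa, and it is empty otherwise. *)
Definition orbit_closure_sheaf (sigma : cone) : tsheaf :=
  @TSheaf
    (fun kappa m =>
       `[< [/\ sigma `<=` kappa, dual_monoid kappa m & perp sigma m] >] : nat)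
    (fun kappa tau m m' => const_mx 1).

Variable Sigma : {fset cone}.

Definition quasi_coherent (E : tsheaf) : Prop :=
  [/\ forall kappa m, kappa \in Sigma -> sres E kappa kappa m m = 1%:M,
      forall kappa tau rho m m' m'',
        kappa \in Sigma -> tau \in Sigma -> rho \in Sigma ->
        tau `<=` kappa -> rho `<=` tau ->
        dual_monoid tau (m' - m) -> dual_monoid rho (m'' - m') ->
        sres E kappa tau m m' *m sres E tau rho m' m''
          = sres E kappa rho m m'' &
      (* sections over U_tau are the localization of those over U_kappa at
         the chi^u with u in kappa^dual :&: tau^perp *)
      forall kappa tau m,
        kappa \in Sigma -> tau \in Sigma -> tau `<=` kappa ->
        (forall y : 'rV[k]_(sdim E tau m),
           exists (u : M) (x : 'rV[k]_(sdim E kappa (m + u))),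
             [/\ dual_monoid kappa u, perp tau u &
                 x *m sres E kappa tau (m + u) (m + u)
                   = y *m sres E tau tau m (m + u)]) /\
        (forall x : 'rV[k]_(sdim E kappa m),
           x *m sres E kappa tau m m = 0 ->
           exists u : M, [/\ dual_monoid kappa u, perp tau u &
                             x *m sres E kappa kappa m (m + u) = 0])].

Definition finitely_generated (E : tsheaf) : Prop :=
  forall kappa, kappa \in Sigma ->
  exists (n : nat) (w : 'I_n -> M) (x : forall i, 'rV[k]_(sdim E kappa (w i))),
  forall (m : M) (y : 'rV[k]_(sdim E kappa m)),
  exists2 c : 'I_n -> k,
    (forall i, c i != 0 -> dual_monoid kappa (m - w i)) &
    y = \sum_i c i *: (x i *m sres E kappa kappa (w i) m).

Definition coherent (E : tsheaf) : Prop :=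
  quasi_coherent E /\ finitely_generated E.

Definition smorphism (E F : tsheaf)
    (f : forall kappa m, 'M[k]_(sdim E kappa m, sdim F kappa m)) : Prop :=
  forall kappa tau m m', kappa \in Sigma -> tau \in Sigma ->
    tau `<=` kappa -> dual_monoid tau (m' - m) ->
    sres E kappa tau m m' *m f tau m' = f kappa m *m sres F kappa tau m m'.

(* Exactness is checked on sections over each U_kappa, which is affine. *)
Definition short_exact (E' E E'' : tsheaf) : Prop :=
  exists (f : forall kappa m, 'M[k]_(sdim E' kappa m, sdim E kappa m))
         (g : forall kappa m, 'M[k]_(sdim E kappa m, sdim E'' kappa m)),
    [/\ smorphism f, smorphism g &
        forall kappa m, kappa \in Sigma ->
          [/\ row_free (f kappa m), row_full (g kappa m) &
              (f kappa m == kermx (g kappa m))%MS]].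

(* The Grothendieck group of coherent sheaves.  Formal sums of sheaves are
   represented by their coefficient functions tsheaf -> int; KT_zero is the
   subgroup of those whose class is zero, generated by the relations
   [E] = [E'] + [E''] for 0 -> E' -> E -> E'' -> 0 exact.  *)
Definition cls (E : tsheaf) : tsheaf -> int := fun F => `[< F = E >]%:R.

Inductive KT_zero : (tsheaf -> int) -> Prop :=
| KT_zero0 : KT_zero (fun=> 0)
| KT_zeroB z w : KT_zero z -> KT_zero w -> KT_zero (fun F => z F - w F)
| KT_zero_exact E' E E'' :
    coherent E' -> coherent E -> coherent E'' -> short_exact E' E E'' ->
    KT_zero (fun F => cls E F - cls E' F - cls E'' F).

(******************************************************************************)
(* The equivariant Euler characteristic, by Cech cohomology for the cover     *)
(* (U_kappa)_(kappa in Sigma)                                                 *)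
(******************************************************************************)
Definition simplex (p : nat) : finType := {A : {set Sigma} | #|A| == p.+1}.

Definition vertices p (i : 'I_#|simplex p|) : {set Sigma} := val (enum_val i).

Definition cone_meet (A : {set Sigma}) : cone :=
  [set x | forall kappa : Sigma, kappa \in A -> val kappa x].

(* Incidence number of A and B: (-1)^j if A is B without its j-th element. *)
Definition cech_sign (A B : {set Sigma}) : k :=
  \sum_(b : Sigma | (b \in B) && (A == B :\ b)%SET)
    (-1) ^+ #|[pred a : Sigma | (a \in B) && (enum_rank a < enum_rank b)%N]|.

Definition cech_diff (E : tsheaf) (m : M) (p : nat) :=
  \mxblock_(i < #|simplex p|, j < #|simplex p.+1|)
    (cech_sign (vertices i) (vertices j)
       *: sres E (cone_meet (vertices i)) (cone_meet (vertices j)) m m).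

(* dim H^p(X, E)_m *)
Definition hdim (E : tsheaf) (m : M) (p : nat) : int :=
  (\rank (kermx (cech_diff E m p)))%:Z
  - (if p is q.+1 then \rank (cech_diff E m q) else 0%N)%:Z.

Definition euler_coef (E : tsheaf) (m : M) : int :=
  \sum_(p < #|{: Sigma}|) (-1) ^+ p * hdim E m p.

(* Cohomology of a coherent sheaf on a complete X is finite-dimensional, so
   this element of Z[M] exists (and it is unique). *)
Definition chiT (E : tsheaf) : RT d :=
  xget 0 [set a : RT d | forall m, a@_m = euler_coef E m].

(******************************************************************************)
(* T-equivariant vector bundles on X                                          *)
(******************************************************************************)

(* A vector bundle is given by equivariant trivializations over the U_kappa
   (these exist: graded projective modules over k[kappa^dual :&: M] are graded
   free when kappa is unimodular), namely
   a frame (e_i) over U_kappa, e_i of weight vwt kappa i, with transition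
   functions  e_i^kappa = \sum_j vtrans kappa tau i j chi^(w_i - w_j) e_j^tau
   over U_tau, for tau a face of kappa. *)
Record vbundle := VBundle {
  vidx : finType;
  vwt : cone -> vidx -> M;
  vtrans : cone -> cone -> vidx -> vidx -> k }.
Arguments vwt : clear implicits.
Arguments vtrans : clear implicits.

Definition is_vbundle (E : vbundle) : Prop :=
  [/\ forall kappa tau i j, kappa \in Sigma -> tau \in Sigma ->
        tau `<=` kappa -> vtrans E kappa tau i j != 0 ->
        dual_monoid tau (vwt E kappa i - vwt E tau j),
      forall kappa i j, kappa \in Sigma -> vtrans E kappa kappa i j = (i == j)%:R,
      forall kappa tau rho i l,
        kappa \in Sigma -> tau \in Sigma -> rho \in Sigma ->
        tau `<=` kappa -> rho `<=` tau ->
        \sum_j vtrans E kappa tau i j * vtrans E tau rho j l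
          = vtrans E kappa rho i l &
      forall kappa tau, kappa \in Sigma -> tau \in Sigma -> tau `<=` kappa ->
        exists c : vidx E -> vidx E -> k,
          [/\ forall j i, c j i != 0 ->
                dual_monoid tau (vwt E tau j - vwt E kappa i),
              forall i l, \sum_j vtrans E kappa tau i j * c j l = (i == l)%:R &
              forall j l, \sum_i c j i * vtrans E kappa tau i l = (j == l)%:R]].

Definition vtensor (E F : vbundle) : vbundle :=
  @VBundle (vidx E * vidx F)%type
    (fun kappa i => vwt E kappa i.1 + vwt F kappa i.2)
    (fun kappa tau i j =>
       vtrans E kappa tau i.1 j.1 * vtrans F kappa tau i.2 j.2).

(* E (x) F for a vector bundle E and a sheaf F: over U_kappa this is the direct
   sum over i of e_i (x) F, and e_i (x) F has F(m - w_i) in weight m. *)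
Definition stensor (E : vbundle) (F : tsheaf) : tsheaf :=
  @TSheaf
    (fun kappa m =>
       (\sum_(i < #|vidx E|) sdim F kappa (m - vwt E kappa (enum_val i)))%N)
    (fun kappa tau m m' =>
       \mxblock_(i < #|vidx E|, j < #|vidx E|)
         (vtrans E kappa tau (enum_val i) (enum_val j) *:
          sres F kappa tau (m - vwt E kappa (enum_val i))
                           (m' - vwt E tau (enum_val j)))).

(* Elements \sum_j n_j [E_j] of K_T(X), as the Grothendieck ring of vector
   bundles; the products are given by tensor products. *)
Record kclass := KClass {
  kidx : finType;
  kcoef : kidx -> int;
  kbundle : kidx -> vbundle }.
Arguments kcoef : clear implicits.
Arguments kbundle : clear implicits.

Definition is_kclass (alpha : kclass) : Prop :=
  forall j, is_vbundle (kbundle alpha j).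

Definition kmul (alpha beta : kclass) : kclass :=
  @KClass (kidx alpha * kidx beta)%type
    (fun j => kcoef alpha j.1 * kcoef beta j.2)
    (fun j => vtensor (kbundle alpha j.1) (kbundle beta j.2)).

(******************************************************************************)
(* Equivariant Grothendieck weights                                           *)
(******************************************************************************)

(* a acts on [O_V(sigma)] by \sum_m a_m [twist m O_V(sigma)]. *)
Definition gweight (g : Sigma -> RT d) : Prop :=
  forall a : Sigma -> RT d,
    KT_zero (fun F => \sum_(sigma : Sigma) \sum_(m <- msupp (a sigma))
      (a sigma)@_m * cls (twist m (orbit_closure_sheaf (val sigma))) F) ->
    \sum_(sigma : Sigma) a sigma * g sigma = 0.

Definition weight_of (alpha : kclass) (sigma : Sigma) : RT d :=
  \sum_(j : kidx alpha)
    chiT (stensor (kbundle alpha j) (orbit_closure_sheaf (val sigma)))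
      *~ kcoef alpha j.

(* The product transported from K_T(X): g_alpha g_beta = g_(alpha beta). *)
Definition wmul (g1 g2 : Sigma -> RT d) : Sigma -> RT d :=
  xget (fun=> 0) [set g | exists alpha beta : kclass,
    [/\ is_kclass alpha, is_kclass beta, weight_of alpha = g1,
        weight_of beta = g2 & g = weight_of (kmul alpha beta)]].

End Sheaves.

Arguments vwt {R k d} _ _ _.
Arguments vtrans {R k d} _ _ _ _ _.
Arguments kcoef {R k d} _ _.
Arguments kbundle {R k d} _ _.

(* Main.v *)
(** Localization at the maximal cones [k].  Let [u_(k,r)] be the basis of M dual to the rays [r]
    of [k], put [loc s k] = prod_(r in s) (1 - e^(u_(k,r))) if [s] is a face of [k] and 0 otherwise,
    [q_k = loc k k], and let [D] be the product of all the [q_k].  The Cech complex gives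
      D chi_T(E (x) O_V(s)) = sum_k (D / q_k) (loc s k) E|_k,
    and D g(s) = sum_k (D / q_k) (loc s k) g(k) holds for every weight [g], because both sides obey
    the relations of the exact sequences 0 -> F(S, h + delta_r) -> F(S, h) -> F(S + r, h) -> 0, where
    F(S, h) is a line bundle on an intersection of invariant divisors.  As [D] is not a zero divisor,
    the theorem reduces to the identity
      sum_(s, t) +- (loc s k) (loc t k') = [k = k'] q_k (loc gamma k)
    for maximal cones [k] and [k'], the sum being over the pairs of the theorem.  These pairs are the
    sets [Y] of rays that are acyclic and whose positive hull contains v, in a vector configuration
    attached to [k], [k'] and gamma.  For [k = k'] there is only one such [Y].  For [k <> k'], linear
    programming with a generic cost shows that the sum divided by prod_x (1 - e^(u x)) is invariant
    under translation by [u_(k,r)], [r] a ray of [k] outside [k'], hence that it vanishes.  The case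
    where gamma is the zero cone also produces a class in K_T(X) for every weight. *)

(* The quotients by q_k are rational functions, whereas the Cech complex and the linear programs
   produce Laurent expansions: indicators of half-open lattice cones, of infinite support. Functions
   on M form a module over R(T) under convolution, and multiplication by the factors 1 - e^u turns
   every such expansion, in whichever direction it is taken, into a point mass up to sign. The
   freedom of direction is used twice: reversing a generic direction bounds the support of an Euler
   characteristic from both sides, and it sorts the cones of the fan into intervals below maximal
   cones. A weight is known only through relations among orbit closures; for a non-maximal cone the
   missing equation comes from a character w that vanishes on it: exact sequences preserve the
   defect of the formula, while twisting multiplies it by e^w. Genericity of v and the index
   condition enter through spans: cones that meet after translation by v together span N_R, so their
   lattices generate N, and the linear algebra of the vector configuration becomes integral. *)
Require Import Defs.
From mathcomp Require Import all_boot all_order all_algebra finmap fingroup perm.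
From mathcomp Require Import boolp classical_sets reals.
From mathcomp Require Import ring lra zify fintype finset.

Set Implicit Arguments.
Unset Strict Implicit.
Unset Printing Implicit Defensive.

Import Order.TTheory GRing.Theory Num.Theory.

Local Open Scope ring_scope.

(** * The group ring acting on functions *)

Section GroupRingAction.
Variable d : nat.
Local Notation M := 'rV[int]_d.
Implicit Types (a b : RT d) (u m p : M) (phi psi : M -> int).

Definition chi (u : M) : RT d := << 1 *g u >>.

Lemma chi0 : chi 0 = 1. Proof. by []. Qed.

Lemma chiD u w : chi (u + w) = chi u * chi w.
Proof. by rewrite /chi [RHS]RTmulUU mulr1. Qed.

Lemma coef_chi u p : (chi u)@_p = (u == p)%:R.
Proof. exact: mcoeffU. Qed.

Lemma coef1 p : (1 : RT d)@_p = (0 == p)%:R.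
Proof. by rewrite -chi0 coef_chi. Qed.

Lemma monRTE a : a = \sum_(p <- msupp a) (chi p *~ a@_p).
Proof.
rewrite [LHS]monalgE; apply/eq_bigr => p _; apply/malgP => m.
by rewrite /chi mcoeffU raddfMz /= mcoeffU -mulrzl intz mulr_natr.
Qed.

(** Convolution makes the functions of arbitrary support a module over [RT d]. Expansions of 1/(1 -
    e^u) live in this module; on finitely supported functions it is the product of the ring
    ([act_coef]). *)
Definition act a phi : M -> int := fun m => \sum_(p <- msupp a) a@_p * phi (m - p).

Lemma actw (D : {fset M}) a phi m : (msupp a `<=` D)%fset ->
  act a phi m = \sum_(p <- D) a@_p * phi (m - p).
Proof.
move=> le; rewrite /act (big_fset_incl _ le) //= => p _ /mcoeff_outdom ->.
by rewrite mul0r.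
Qed.

Lemma actD a b phi m : act (a + b) phi m = act a phi m + act b phi m.
Proof.
rewrite (actw _ _ (msuppD_le a b)) (actw _ _ (fsubsetUl _ (msupp b))).
rewrite (actw _ _ (fsubsetUr (msupp a) _)) -big_split /=.
by apply/eq_bigr => p _; rewrite mcoeffD mulrDl.
Qed.

Lemma act0 phi m : act 0 phi m = 0.
Proof. by rewrite /act msupp0 big_seq_fset0. Qed.

Lemma actN a phi m : act (- a) phi m = - act a phi m.
Proof. by apply/eqP; rewrite -addr_eq0 -actD addNr act0. Qed.

Lemma act_sum (I : Type) (r : seq I) (P : pred I) (F : I -> RT d) phi m :
  act (\sum_(i <- r | P i) F i) phi m = \sum_(i <- r | P i) act (F i) phi m.
Proof.
exact: (big_morph (fun a => act a phi m) (fun x y => actD x y phi m) (act0 phi m)).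
Qed.

Lemma actMz a c phi m : act (a *~ c) phi m = act a phi m *~ c.
Proof.
have actn n : act (a *+ n) phi m = act a phi m *+ n.
  by elim: n => [|n IH]; rewrite ?mulr0n ?act0 // !mulrS actD IH.
by case: c => n; rewrite /intmul ?actN actn.
Qed.

Lemma act_chi u phi m : act (chi u) phi m = phi (m - u).
Proof.
by rewrite (actw _ _ msuppU_le) big_seq_fset1 mcoeffUU mul1r.
Qed.

Lemma act1 phi m : act 1 phi m = phi m.
Proof. by rewrite -chi0 act_chi subr0. Qed.

Lemma eq_act a phi psi : phi =1 psi -> act a phi =1 act a psi.
Proof. by move=> e m; apply/eq_bigr => p _; rewrite e. Qed.

Lemma act_addr a phi psi m :
  act a (fun p => phi p + psi p) m = act a phi m + act a psi m.
Proof. by rewrite -big_split; apply/eq_bigr => p _; rewrite mulrDr. Qed.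

Lemma act_sumr (I : Type) (r : seq I) (P : pred I) a (F : I -> M -> int) m :
  act a (fun p => \sum_(i <- r | P i) F i p) m = \sum_(i <- r | P i) act a (F i) m.
Proof.
rewrite /act exchange_big /=; apply/eq_bigr => p _; by rewrite mulr_sumr.
Qed.

Lemma act_mulzr a phi (c : int) m : act a (fun p => c * phi p) m = c * act a phi m.
Proof. by rewrite /act mulr_sumr; apply/eq_bigr => p _; rewrite mulrCA. Qed.

Lemma act_chiM u b phi m : act (chi u * b) phi m = act b phi (m - u).
Proof.
rewrite (monRTE b) mulr_sumr !act_sum; apply/eq_bigr => p _.
rewrite [X in act X]mulrzAr -chiD [LHS]actMz [RHS]actMz [in LHS]act_chi.
by rewrite [in RHS]act_chi opprD addrA.
Qed.

Lemma actM a b phi m : act (a * b) phi m = act a (act b phi) m.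
Proof.
rewrite {1}(monRTE a) mulr_suml act_sum; apply/eq_bigr => p _.
by rewrite [X in act X]mulrzAl [LHS]actMz act_chiM -mulrzl intz.
Qed.

Lemma act_coef a b m : act a (fun p => b@_p) m = (a * b)@_m.
Proof.
have delta (c : RT d) : (fun p => c@_p) =1 act c (fun p => (1 : RT d)@_p).
  move=> p; rewrite [in LHS](monRTE c) raddf_sum.
  rewrite /act; apply/eq_bigr => q _ /=.
  by rewrite raddfMz /= coef_chi coef1 [0 == _]eq_sym subr_eq0 [p == _]eq_sym -mulrzl intz.
by rewrite delta actM; apply/eq_act/delta.
Qed.

Lemma coef_finite (phi : M -> int) a :
  (forall m, phi m != 0 -> m \in msupp a) -> exists b : RT d, forall m, b@_m = phi m.
Proof.
move=> h; exists (\sum_(p <- msupp a) << phi p *g p >>) => m.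
rewrite raddf_sum /=; under eq_bigr do rewrite mcoeffU.
case: (boolP (m \in msupp a)) => ma.
  rewrite (big_fsetD1 m) //= eqxx mulr1n big_seq big1 ?addr0 // => p.
  by rewrite in_fsetD1 => /andP[/negPf -> _].
rewrite big_seq big1 => [|p pa]; last first.
  by case: eqP => // pm; rewrite -pm pa in ma.
by apply/esym/eqP; apply: contraNT ma => /h.
Qed.

Definition regular a := forall b, a * b = 0 -> b = 0.

Lemma regularM a b : regular a -> regular b -> regular (a * b).
Proof. by move=> ra rb c; rewrite -mulrA => /ra/rb. Qed.

Lemma regular1 : regular 1. Proof. by move=> b; rewrite mul1r. Qed.

Lemma regular_prod (I : Type) (r : seq I) (P : pred I) (F : I -> RT d) :
  (forall i, P i -> regular (F i)) -> regular (\prod_(i <- r | P i) F i).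
Proof. by move=> h; apply: big_ind; [exact: regular1 | move=> ? ?; exact: regularM | exact: h]. Qed.

Lemma regular_inj a b c : regular a -> a * b = a * c -> b = c.
Proof.
by move=> ra /eqP; rewrite -subr_eq0 -mulrBr => /eqP/ra/eqP; rewrite subr_eq0 => /eqP.
Qed.

(** The support would contain the whole progression [m - u *+ k], whose terms are distinct because u
    is nonzero. *)
Lemma shift_inv_finite (u : M) b : u != 0 -> (forall m, b@_(m - u) = b@_m) -> b = 0.
Proof.
move=> u0 h; apply/malgP => m; rewrite mcoeff0; apply/eqP/negPn/negP => bm.
have bk k : b@_(m - u *+ k) != 0.
  by elim: k => [|k IH]; rewrite ?mulr0n ?subr0 // mulrSr opprD addrA h.
pose N := size (msupp b).
have uni : uniq [seq m - u *+ k | k <- iota 0 N.+1].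
  rewrite map_inj_uniq ?iota_uniq // => i j /addrI/oppr_inj e.
  have [j0 uj] : exists j0, u 0 j0 != 0.
    apply/existsP; rewrite -[X in is_true X]negbK negb_exists; apply: contra u0 => /forallP z.
    by apply/eqP/rowP => j0; rewrite mxE; apply/eqP/negPn/z.
  move: e => /rowP/(_ j0); rewrite !mulmxnE => /eqP; rewrite -subr_eq0.
  rewrite -[_ *+ i]mulr_natr -[_ *+ j]mulr_natr -mulrBr mulf_eq0 (negPf uj) /=.
  by rewrite subr_eq0 eqr_nat => /eqP.
have sub : {subset [seq m - u *+ k | k <- iota 0 N.+1] <= msupp b}.
  by move=> x /mapP[k _ ->]; rewrite -mcoeff_neq0.
by have := uniq_leq_size uni sub; rewrite size_map size_iota ltnn.
Qed.

Lemma regular_chi u : u != 0 -> regular (1 - chi u).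
Proof.
move=> u0 b h; apply: (shift_inv_finite u0) => m.
have := congr1 (mcoeff m) h; rewrite -act_coef mcoeff0 actD act1 actN act_chi.
by move/eqP; rewrite subr_eq0 => /eqP ->.
Qed.

End GroupRingAction.

(** * Linear programming and chambers *)

Section Chambers.
Variables (R : realFieldType) (n : nat) (X : finType) (V : X -> 'rV[R]_n) (v : 'rV[R]_n).
Implicit Types (B Y : {set X}) (l m c : X -> R) (pi : 'cV[R]_n) (x : X).

Definition comb l : 'rV[R]_n := \sum_x l x *: V x.
Definition nonneg l := forall x, 0 <= l x.
Definition supp l Y := forall x, x \notin Y -> l x = 0.
Definition in_pos Y := exists l, [/\ nonneg l, supp l Y & comb l = v].
Definition indep B := forall l, supp l B -> comb l = 0 -> forall x, l x = 0.
Definition chamber_basis B := indep B /\ in_pos B.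
Definition acyclic Y :=
  forall l, nonneg l -> supp l Y -> comb l = 0 -> forall x, l x = 0.
(** The point v lies in no cone generated by a subfamily of smaller rank. *)
Definition generic_point :=
  forall Y, in_pos Y -> forall x, exists2 l, supp l Y & comb l = V x.
Definition pairing pi x : R := (V x *m pi) 0 0.
(** Optimality for the program that minimizes the cost c over the nonnegative solutions of
    [comb l = v] supported on Y. The vector [pi] is a dual solution; its strict slack outside B is
    what makes the optimal basis unique. *)
Definition optimal Y c B :=
  [/\ B \subset Y, chamber_basis B &
      exists pi, (forall b, b \in B -> pairing pi b = c b) /\
                 (forall x, x \in Y -> x \notin B -> pairing pi x < c x)].

Lemma combD l m : comb (fun x => l x + m x) = comb l + comb m.
Proof. by rewrite /comb -big_split; apply/eq_bigr => x _; rewrite scalerDl. Qed.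

Lemma combZ (t : R) l : comb (fun x => t * l x) = t *: comb l.
Proof. by rewrite /comb scaler_sumr; apply/eq_bigr => x _; rewrite scalerA. Qed.

Lemma combB l m : comb (fun x => l x - m x) = comb l - comb m.
Proof. by rewrite /comb -sumrB; apply/eq_bigr => x _; rewrite scalerBl. Qed.

Lemma comb_delta x : comb (fun y => (y == x)%:R) = V x.
Proof.
rewrite /comb (bigD1 x) //= eqxx scale1r big1 ?addr0 // => y /negPf ->.
by rewrite scale0r.
Qed.

Lemma pairing_comb pi l : \sum_x l x * pairing pi x = (comb l *m pi) 0 0.
Proof.
rewrite /comb mulmx_suml summxE; apply/eq_bigr => x _.
by rewrite -scalemxAl [RHS]mxE.
Qed.

(** The step length is the least ratio [l x / m x] over [0 < m x]: the coordinate that attains it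
    reaches 0 first, while the others are still nonnegative. *)
Lemma ratio_test l m : nonneg l -> (forall x, 0 < m x -> 0 < l x) ->
  (exists x, 0 < m x) ->
  exists t x0, [/\ 0 < t, 0 < m x0, l x0 - t * m x0 = 0 &
                   forall x, 0 <= l x - t * m x].
Proof.
move=> l0 lm [x1 mx1].
case: (Order.TotalTheory.arg_minP (fun x => l x / m x) (P := fun x => 0 < m x) mx1) => x0 m0 le.
exists (l x0 / m x0), x0; split=> //.
- by rewrite divr_gt0 ?lm.
- by rewrite divfK ?subrr // gt_eqF.
move=> x; rewrite subr_ge0; have [mx|mx] := ltP 0 (m x).
  by rewrite -ler_pdivlMr //; exact: le.
by apply: le_trans (l0 x); rewrite mulr_ge0_le0 // divr_ge0 ?l0 // ltW.
Qed.

(** Caratheodory: subtracting a multiple of a linear relation from a nonnegative solution kills a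
    coordinate, so a minimal support is independent. *)
Lemma in_pos_basis Y : in_pos Y -> exists2 B : {set X}, B \subset Y & chamber_basis B.
Proof.
have [k] := ubnP #|Y|; elim: k Y => // k IH Y; rewrite ltnS => leY pY.
have drop x l : x \in Y -> nonneg l -> supp l Y -> comb l = v -> l x = 0 ->
    exists2 B : {set X}, B \subset Y & chamber_basis B.
  move=> xY l0 ls lv lx; have [||B sB cB] := IH (Y :\ x).
  - by move: leY; rewrite (cardsD1 x) xY.
  - exists l; split=> // y; rewrite in_setD1 negb_and negbK => /orP[/eqP->//|].
    exact: ls.
  by exists B => //; apply: subset_trans sB (subD1set _ _).
case: (pselect (indep Y)) => [iY|]; first by exists Y.
move=> /existsNP[m0 /not_implyP[ms0 /not_implyP[mv0 /existsNP[x1 mx0]]]].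
have [l [l0 ls lv]] := pY.
case: (pselect (exists2 x, x \in Y & l x = 0)) => [[x xY lx]|nl].
  exact: drop lx.
have lpos x : x \in Y -> 0 < l x.
  by move=> xY; rewrite lt_neqAle l0 andbT; apply/eqP => e; apply: nl; exists x.
have [m [ms mv [x mx]]] : exists m, [/\ supp m Y, comb m = 0 & exists x, 0 < m x].
  have [mp|mn] := ltP 0 (m0 x1); first by exists m0; split=> //; exists x1.
  exists (fun x => -1 * m0 x); split.
  - by move=> x xY; rewrite ms0 // mulr0.
  - by rewrite combZ mv0 scaler0.
  - by exists x1; rewrite mulN1r oppr_gt0 lt_neqAle mn andbT; apply/eqP.
have mY y : 0 < m y -> y \in Y.
  by move=> my; apply: contraLR my => /ms ->; rewrite ltxx.
have [|||t [x0 [t0 mx0' e le]]] := @ratio_test l m => //.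
- by move=> y /mY/lpos.
- by exists x.
apply: (drop x0 (fun x => l x - t * m x)) => //.
- exact: mY.
- by move=> y yY; rewrite ls // ms // mulr0 subr0.
- by rewrite combB combZ mv scaler0 subr0.
Qed.

Hypothesis gen : generic_point.

(** A zero coordinate would put v in the positive hull of [B :\ b]; by genericity this set would
    span [V b], against independence. *)
Lemma basis_pos B l : chamber_basis B -> nonneg l -> supp l B -> comb l = v ->
  forall b, b \in B -> 0 < l b.
Proof.
move=> [iB _] l0 ls lv b bB; rewrite lt_neqAle l0 andbT; apply/eqP => lb.
have pB : in_pos (B :\ b).
  exists l; split=> // y; rewrite in_setD1 negb_and negbK => /orP[/eqP->//|].
  exact: ls.
have [l' ls' lv'] := gen pB b.
have := iB (fun x => l' x + -1 * (x == b)%:R) _ _ b.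
rewrite ls' ?setD11 // eqxx mulr1 add0r => H.
have /eqP : (-1 : R) = 0.
  apply: H.
    move=> y yB; rewrite ls' ?in_setD1 ?(negPf yB) ?andbF // add0r.
    by case: eqP yB => [->|]; rewrite ?bB // mulr0.
  by rewrite combD combZ comb_delta lv' scaleN1r subrr.
by rewrite oppr_eq0 oner_eq0.
Qed.

Definition mx_of B : 'M[R]_(#|B|, n) := \matrix_(i < #|B|) V (enum_val i).

Lemma comb_supp B l : supp l B ->
  comb l = \row_(i < #|B|) l (enum_val i) *m mx_of B.
Proof.
move=> ls; rewrite mulmx_sum_row.
under [RHS]eq_bigr do rewrite rowK mxE.
rewrite -(big_enum_val (fun x => l x *: V x)) /comb [RHS]big_mkcond /=.
by apply/eq_bigr => x _; case: ifPn => // /ls ->; rewrite scale0r.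
Qed.

Lemma indep_row_free B : indep B -> row_free (mx_of B).
Proof.
move=> iB; apply: inj_row_free => u uA.
pose l x := \sum_(i < #|B| | enum_val i == x) u 0 i.
have lE i : l (enum_val i) = u 0 i.
  rewrite /l (bigD1 i) //= big1 ?addr0 // => j /andP[/eqP/enum_val_inj -> /eqP].
  by [].
have ls : supp l B.
  move=> x xB; rewrite /l big_pred0 // => i; apply/negbTE; apply: contra xB => /eqP <-.
  exact: enum_valP.
have l0 : comb l = 0.
  by rewrite (comb_supp ls) -uA; congr (_ *m _); apply/rowP => i; rewrite mxE lE.
by apply/rowP => i; rewrite -lE (iB _ ls l0) mxE.
Qed.

Lemma potential B c : indep B -> exists pi, forall b, b \in B -> pairing pi b = c b.
Proof.
move=> /indep_row_free fB.
exists (pinvmx (mx_of B) *m \col_i c (enum_val i)) => b bB.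
rewrite /pairing.
have -> : V b = row (enum_rank_in bB b) (mx_of B) by rewrite rowK enum_rankK_in.
rewrite mulmxA -row_mul mulmxVp // row1.
by rewrite -rowE !mxE enum_rankK_in.
Qed.

Lemma basis_card B B' : chamber_basis B -> chamber_basis B' -> #|B| = #|B'|.
Proof.
have le B1 B2 : chamber_basis B2 -> (mx_of B1 <= mx_of B2)%MS.
  move=> [_ /gen g]; apply/row_subP => i; rewrite rowK.
  by have [l ls <-] := g (enum_val i); rewrite (comb_supp ls) submxMl.
move=> cB cB'; have [iB _] := cB; have [iB' _] := cB'.
have /eqP <- := indep_row_free iB; have /eqP <- := indep_row_free iB'.
by apply/eqP; rewrite eqn_leq !mxrankS // le.
Qed.

(** The simplex method: a basis of least cost is optimal, since a violated inequality would allow a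
    pivot to a cheaper basis. The condition on nonnegative relations keeps the program bounded, and
    the last condition excludes ties. *)
Lemma optimal_exists Y c :
  in_pos Y ->
  (forall l, nonneg l -> supp l Y -> comb l = 0 -> 0 <= \sum_x l x * c x) ->
  (forall B pi, chamber_basis B -> (forall b, b \in B -> pairing pi b = c b) ->
     forall x, x \notin B -> pairing pi x != c x) ->
  exists B, optimal Y c B.
Proof.
move=> pY crel cgen.
have /choice[lam lamP] B : exists l, chamber_basis B ->
    [/\ nonneg l, supp l B & comb l = v].
  case: (pselect (chamber_basis B)) => [cB|ncB]; last by exists (fun=> 0).
  by have [_ [l lP]] := cB; exists l.
have [B0 sB0 cB0] := in_pos_basis pY.
pose cost B := \sum_x lam B x * c x.
pose P B := `[< B \subset Y /\ chamber_basis B >].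
have PB0 : P B0 by apply/asboolP.
case: (Order.TotalTheory.arg_minP cost PB0) => B /asboolP[sB cB] Bmin.
have [pi piB] := potential c (proj1 cB).
exists B; split=> //; exists pi; split=> // x xY xB.
rewrite ltNge; apply/negP => ge.
have {ge} gt : c x < pairing pi x by rewrite lt_neqAle ge eq_sym (cgen B).
have [l0 ls lv] := lamP _ cB.
have [m0 ms0 mv0] := gen (proj2 cB) x.
(* Moving the solution along [- m] brings x into the basis at unit speed; [mcost] says that the cost
   then decreases. *)
pose m y := m0 y - (y == x)%:R.
have mv : comb m = 0.
  by rewrite combB comb_delta mv0 subrr.
have mx : m x = -1 by rewrite /m eqxx ms0 // sub0r.
have mB y : y != x -> y \notin B -> m y = 0.
  by move=> /negPf yx yB; rewrite /m yx ms0 // subr0.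
have mcost : 0 < \sum_y m y * c y.
  have -> : \sum_y m y * c y = \sum_y m y * (c y - pairing pi y).
    have e : \sum_y m y * pairing pi y = 0 by rewrite pairing_comb mv mul0mx mxE.
    by rewrite -[LHS]subr0 -[X in _ - X]e -sumrB; apply/eq_bigr => y _; rewrite mulrBr.
  rewrite (bigD1 x) //= big1 ?addr0 => [|y yx]; first by rewrite mx; lra.
  case: (boolP (y \in B)) => yB; first by rewrite piB // subrr mulr0.
  by rewrite mB // mul0r.
(* Without a positive entry, [- m] is a nonnegative relation of negative cost, which boundedness
   excludes. *)
case: (pselect (exists y, 0 < m y)) => [ex|nex]; last first.
  have := crel (fun y => -1 * m y); rewrite combZ mv scaler0.
  have -> : \sum_y -1 * m y * c y = - \sum_y m y * c y.
    by rewrite -sumrN; apply/eq_bigr => y _; rewrite -mulrA mulN1r.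
  rewrite oppr_ge0 leNgt mcost => H; suff : false by [].
  apply: H => // [y|y yY].
    rewrite mulN1r oppr_ge0 leNgt; apply/negP => my; apply: nex; by exists y.
  rewrite mB ?mulr0 //; first by apply: contraNneq yY => ->.
  by apply: contra yY; exact: (subsetP sB).
have mposB y : 0 < m y -> y \in B.
  move=> my; apply: contraLR my => yB; case: (eqVneq y x) => [->|yx].
    by rewrite mx oppr_gt0 ltr10.
  by rewrite mB // ltxx.
have [|||t [x0 [t0 mx0 e le]]] := @ratio_test (lam B) m => //.
  by move=> y /mposB; exact: basis_pos.
have x0B := mposB _ mx0.
pose l' y := lam B y - t * m y.
pose B' := (x |: B) :\ x0.
have x0x : x0 != x by apply: contraNneq xB => <-.
have s' : supp l' B'.
  move=> y; rewrite !inE negb_and negbK => /orP[/eqP->//|].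
  by rewrite negb_or => /andP[yx yB]; rewrite /l' ls // mB // mulr0 subr0.
have v' : comb l' = v.
  rewrite -lv -[RHS]addr0 -[in RHS](scaler0 _ (- t)) -mv -combZ -combD.
  by apply/eq_bigr => y _; rewrite mulNr.
have cB' : chamber_basis B'.
  split; last by exists l'.
  move=> k ks kv.
  have ks0 : supp (fun y => k y + k x * m y) B.
    move=> y yB; case: (eqVneq y x) => [->|yx]; first by rewrite mx mulrN1 subrr.
    by rewrite mB // mulr0 addr0 ks // !inE (negPf yB) (negPf yx) andbF.
  have kv0 : comb (fun y => k y + k x * m y) = 0.
    by rewrite combD combZ mv kv scaler0 addr0.
  have k0 := (proj1 cB) _ ks0 kv0.
  have kx : k x = 0.
    have := k0 x0; rewrite ks ?setD11 // add0r => /eqP.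
    by rewrite mulf_eq0 (gt_eqF mx0) orbF => /eqP.
  by move=> y; have := k0 y; rewrite kx mul0r addr0.
have [l0' ls' lv'] := lamP _ cB'.
have lE y : lam B' y = l' y.
  apply/eqP; rewrite -subr_eq0; apply/eqP.
  have := (proj1 cB') (fun y => lam B' y + -1 * l' y); rewrite combD combZ lv' v'.
  rewrite scaleN1r subrr => H; rewrite -[l' y]mul1r -mulNr; apply: H => // z zB.
  by rewrite ls' // s' // mulr0 addr0.
have /Bmin : P B'.
  apply/asboolP; split=> //; apply/subsetP => y; rewrite !inE => /andP[_ /orP[/eqP->//|]].
  exact: (subsetP sB).
apply/negP; rewrite -ltNge /cost.
under eq_bigr do rewrite lE /l' mulrBl -mulrA.
rewrite sumrB -mulr_sumr gtrBl.
by rewrite mulr_gt0.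
Qed.

(** Weak duality: a relation pairs to 0 with every potential, so its cost is a sum of nonnegative
    slacks. *)
Lemma optimal_rel Y c B l : optimal Y c B -> nonneg l -> supp l Y -> comb l = 0 ->
  0 <= \sum_x l x * c x.
Proof.
move=> [sB cB [pi [piB piY]]] l0 ls lv.
have e : \sum_y l y * pairing pi y = 0 by rewrite pairing_comb lv mul0mx mxE.
rewrite -[X in 0 <= X]subr0 -[X in _ - X]e -sumrB sumr_ge0 // => x _; rewrite -mulrBr.
case: (boolP (x \in B)) => xB; first by rewrite piB // subrr mulr0.
case: (boolP (x \in Y)) => xY; last by rewrite ls // mul0r.
by rewrite mulr_ge0 // subr_ge0 ltW // piY.
Qed.

(** Complementary slackness: the solution on [B'] has total slack 0 for the potential of B. It is
    positive on [B'], and slack is strict outside B. *)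
Lemma optimal_sub Y c B B' : optimal Y c B -> optimal Y c B' -> B' \subset B.
Proof.
move=> [sB cB [pi [piB piY]]] [sB' cB' [pi' [piB' piY']]].
have slack p (D : {set X}) l : (forall b, b \in D -> pairing p b = c b) ->
    (forall x, x \in Y -> x \notin D -> pairing p x < c x) -> nonneg l -> supp l Y ->
    forall x, 0 <= l x * (c x - pairing p x).
  move=> pD pY l0 ls x; case: (boolP (x \in D)) => xD.
    by rewrite pD // subrr mulr0.
  case: (boolP (x \in Y)) => xY; last by rewrite ls // mul0r.
  by rewrite mulr_ge0 // subr_ge0 ltW // pY.
have cost p l : comb l = v ->
    \sum_x l x * c x = (v *m p) 0 0 + \sum_x l x * (c x - pairing p x).
  move=> lv; rewrite -lv -pairing_comb -big_split; apply/eq_bigr => x _ /=; ring.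
have [_ [l [l0 ls lv]]] := cB; have [_ [l' [l0' ls' lv']]] := cB'.
have lsY : supp l Y by move=> x xY; apply: ls; apply: contra xY; apply: (subsetP sB).
have lsY' : supp l' Y by move=> x xY; apply: ls'; apply: contra xY; apply: (subsetP sB').
have tight p (D : {set X}) k : (forall b, b \in D -> pairing p b = c b) -> supp k D ->
    \sum_x k x * (c x - pairing p x) = 0.
  move=> pD kD; apply: big1 => x _; case: (boolP (x \in D)) => xD.
    by rewrite pD // subrr mulr0.
  by rewrite kD // mul0r.
have z : \sum_x l' x * (c x - pairing pi x) = 0.
  have := cost pi l lv; have := cost pi l' lv'; have := cost pi' l lv.
  have := cost pi' l' lv'; rewrite (tight pi B l) // (tight pi' B' l') // !addr0.
  have h1 : 0 <= \sum_x l' x * (c x - pairing pi x).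
    by apply: sumr_ge0 => x _; exact: (slack pi B).
  have h2 : 0 <= \sum_x l x * (c x - pairing pi' x).
    by apply: sumr_ge0 => x _; exact: (slack pi' B').
  move=> h3 h4 h5 h6; lra.
apply/subsetP => x xB'; apply/negPn/negP => xB.
have lx := basis_pos cB' l0' ls' lv' xB'.
have /(_ x isT)/eqP := psumr_eq0P (fun x _ => slack pi B l' piB piY l0' lsY' x) z.
rewrite mulf_eq0 gt_eqF //= subr_eq0 gt_eqF // piY //.
exact: (subsetP sB').
Qed.

End Chambers.

(** On the moment curve (1, t, t^2, ...) each form becomes a nonzero polynomial in t, and some
    positive integer is a root of none of them. *)
Lemma generic_weights (R : realFieldType) (J K : finType) (c : K -> J -> R) :
  (forall k, exists j, c k j != 0) ->
  exists w : J -> R, (forall j, 0 < w j) /\ forall k, \sum_j c k j * w j != 0.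
Proof.
move=> c0.
pose p k : {poly R} := \sum_j c k j *: 'X^(enum_rank j).
have p0 k : p k != 0.
  have [j cj] := c0 k; apply: contraNneq cj => /(congr1 (fun q : {poly R} => q`_(enum_rank j))).
  rewrite coef0 /p coef_sum (bigD1 j) //= coefZ coefXn eqxx mulr1 big1 ?addr0 => [->//|i ij].
  rewrite coefZ coefXn (inj_eq val_inj) (inj_eq enum_rank_inj) eq_sym (negPf ij).
  by rewrite mulr0.
pose P := \prod_k p k.
have P0 : P != 0 by rewrite prodf_seq_neq0; apply/allP => k _; rewrite p0.
have [t t0 Pt] : exists2 t : R, 0 < t & P.[t] != 0.
  pose s := [seq (i.+1)%:R : R | i <- iota 0 (size P)].
  have us : uniq s by rewrite map_inj_uniq ?iota_uniq // => i j /eqP; rewrite eqr_nat => /eqP[].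
  have [ar|] := boolP (all (root P) s).
    by have := max_poly_roots P0 ar us; rewrite size_map size_iota ltnn.
  by case/allPn => x /mapP[i _ ->] xr; exists i.+1%:R; rewrite ?ltr0n.
exists (fun j => t ^+ (enum_rank j)); split=> [j|k]; first by rewrite exprn_gt0.
move: Pt; rewrite horner_prod prodf_seq_neq0 => /allP/(_ k (mem_index_enum k)).
rewrite /p horner_sum; under eq_bigr do rewrite hornerZ hornerXn.
by [].
Qed.

(** * Indicators of half-open lattice cones *)

Section LatticeCones.
Variables (M : zmodType) (X : finType) (u : X -> M).
Implicit Types (S P : {set X}) (k : X -> int).

Definition zcomb k : M := \sum_x u x *~ k x.
Definition zindep S :=
  forall k, (forall x, x \notin S -> k x = 0) -> zcomb k = 0 -> forall x, k x = 0.
(** Up to the sign (-1)^#|S :&: P| this is the expansion of the product of 1/(1 - e^(u x)) over S,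
    with the directions in P reversed. *)
Definition cone_ind S P (m : M) : int :=
  `[< exists k, [/\ forall x, x \notin S -> k x = 0, zcomb k = m &
        forall x, x \in S -> if x \in P then k x < 0 else 0 <= k x] >]%:R.

Lemma zcombD k l : zcomb (fun x => k x + l x) = zcomb k + zcomb l.
Proof. by rewrite /zcomb -big_split; apply/eq_bigr => x _; rewrite mulrzDr. Qed.

Lemma zcombB k l : zcomb (fun x => k x - l x) = zcomb k - zcomb l.
Proof. by rewrite /zcomb -sumrB; apply/eq_bigr => x _; rewrite mulrzBr. Qed.

Lemma zcomb_ind (N : {set X}) : zcomb (fun x => (x \in N)%:Z) = \sum_(x in N) u x.
Proof.
rewrite /zcomb [RHS]big_mkcond; apply/eq_bigr => x _.
by case: ifP; rewrite ?mulr1z ?mulr0z.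
Qed.

Lemma zcomb_delta y : zcomb (fun x => (x == y)%:Z) = u y.
Proof.
rewrite /zcomb (bigD1 y) //= eqxx mulr1z big1 ?addr0 // => x /negPf ->.
by rewrite mulr0z.
Qed.

Lemma cone_indE S P k : zindep S -> (forall x, x \notin S -> k x = 0) ->
  cone_ind S P (zcomb k) =
  [forall x, (x \in S) ==> (if x \in P then k x < 0 else 0 <= k x)]%:R.
Proof.
move=> iS ks; congr (_%:R); congr nat_of_bool; apply/asboolP/forallP => [[l [ls e lP]] x|h].
  apply/implyP => xS; have := lP x xS; suff -> : l x = k x by [].
  apply/eqP; rewrite -subr_eq0; apply/eqP.
  apply: (iS (fun x => l x - k x)); last by rewrite zcombB e subrr.
  by move=> y yS; rewrite ls // ks // subrr.
by exists k; split=> // x xS; exact: (implyP (h x)).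
Qed.

(** The difference telescopes in the direction of y: only combinations with coefficient 0 at y
    survive, and they come from the second term, hence with a sign, when y is in P. *)
Lemma cone_ind_step S P y m : zindep S -> y \in S ->
  cone_ind S P m - cone_ind S P (m - u y) =
  (-1) ^+ (y \in P) * cone_ind (S :\ y) P m.
Proof.
move=> iS yS.
have iSy : zindep (S :\ y).
  by move=> k ks; apply: iS => x xS; apply: ks; rewrite in_setD1 (negPf xS) andbF.
have [[k ks <-{m}]|nk] := pselect (exists2 k, (forall x, x \notin S -> k x = 0) & zcomb k = m).
  have ks' x : x \notin S -> k x - (x == y)%:Z = 0.
    by move=> xS; rewrite ks // sub0r; case: eqP xS => [->|//]; rewrite yS.
  rewrite -[u y]zcomb_delta -zcombB (cone_indE P iS ks) (cone_indE P iS ks').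
  have [ky|ky] := eqVneq (k y) 0.
    have ksy x : x \notin S :\ y -> k x = 0.
      by rewrite in_setD1 negb_and negbK => /orP[/eqP->|/ks].
    rewrite (cone_indE P iSy ksy).
    set a := [forall x, _]; set b := [forall x, _]; set c := [forall x, _].
    have aE : a = (y \notin P) && c.
      apply/forallP/andP => [h|[yP /forallP h] x].
        split; first by have := h y; rewrite yS ky ltxx; case: (y \in P).
        apply/forallP => x; have := h x; rewrite in_setD1.
        by case: (x == y) => //=; rewrite implybT.
      have := h x; rewrite in_setD1; case: eqP => [->|//] _.
      by rewrite yS (negPf yP) ky.
    have bE : b = (y \in P) && c.
      apply/forallP/andP => [h|[yP /forallP h] x].
        split; first by have := h y; rewrite yS ky eqxx; case: (y \in P).
        apply/forallP => x; have := h x; rewrite in_setD1.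
        by case: (x == y) => //=; rewrite ?subr0 ?implybT.
      have := h x; rewrite in_setD1; case: eqP => [->|_] /=; last by rewrite subr0.
      by rewrite yS yP ky.
    by clearbody a b c; rewrite aE bE {aE bE}; case: (y \in P); case: c.
  have -> : cone_ind (S :\ y) P (zcomb k) = 0.
    rewrite /cone_ind; case: asboolP => // -[l [ls e _]].
    move/eqP: ky; case; have := ls y; rewrite setD11 => <- //.
    apply/eqP; rewrite -subr_eq0; apply/eqP.
    apply: (iS (fun x => k x - l x)); last by rewrite zcombB e subrr.
    by move=> x xS; rewrite ks // ls ?subrr // in_setD1 (negPf xS) andbF.
  rewrite mulr0; apply/eqP; rewrite subr_eq0; apply/eqP; congr (_%:R); congr nat_of_bool.
  apply/eq_forallb => x; congr (_ ==> _); case: (eqVneq x y) => [->|_]; last by rewrite subr0.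
  by case: ifP => _; lia.
(* From here on m is no integral combination over S, so all three indicators vanish. *)
have z (T Q : {set X}) q : T \subset S -> (exists2 k, (forall x, x \notin S -> k x = 0) & zcomb k = q - m) ->
    cone_ind T Q q = 0.
  move=> sT [l ls le]; rewrite /cone_ind; case: asboolP => // -[k [ks e _]].
  case: nk; exists (fun x => k x - l x); last by rewrite zcombB e le opprB addrC subrK.
  by move=> x xS; rewrite ls // ks ?subrr //; apply: contra xS => /(subsetP sT).
have z0 : zcomb (fun=> 0) = 0 by rewrite /zcomb big1 // => x _; rewrite mulr0z.
have zE (T : {set X}) : T \subset S -> cone_ind T P m = 0.
  by move=> sT; apply: z => //; exists (fun=> 0); rewrite // z0 subrr.
rewrite !zE ?subsetDl // mulr0 z // ?subrr //.
exists (fun x => 0 - (x == y)%:Z); last by rewrite zcombB zcomb_delta z0 sub0r addrAC subrr add0r.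
by move=> x; case: eqP => [->|]; rewrite ?yS // subrr.
Qed.

End LatticeCones.

Section Action.
Variables (M : zmodType) (A : comNzRingType) (z : M -> A).
Variable act : A -> (M -> int) -> M -> int.
Hypothesis act_ext : forall a f g, f =1 g -> act a f =1 act a g.
Hypothesis actD : forall a b f m, act (a + b) f m = act a f m + act b f m.
Hypothesis act_addr : forall a f g m, act a (fun p => f p + g p) m = act a f m + act a g m.
Hypothesis act1 : forall f m, act 1 f m = f m.
Hypothesis actM : forall a b f m, act (a * b) f m = act a (act b f) m.
Hypothesis act_z : forall w f m, act (z w) f m = f (m - w).

Definition delta0 (m : M) : int := (m == 0)%:R.

Lemma gact0 f m : act 0 f m = 0.
Proof. by apply: (addrI (act 0 f m)); rewrite -actD !addr0. Qed.

Lemma gactN a f m : act (- a) f m = - act a f m.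
Proof. by apply/eqP; rewrite -addr_eq0 -actD addNr gact0. Qed.

Lemma gact_zero a m : act a (fun=> 0) m = 0.
Proof.
apply: (addrI (act a (fun=> 0) m)); by rewrite -act_addr !addr0.
Qed.

Lemma gact_oppr a f m : act a (fun p => - f p) m = - act a f m.
Proof.
apply/eqP; rewrite -addr_eq0 -act_addr -[X in _ == X](gact_zero a m); apply/eqP.
by apply: act_ext => p; rewrite addNr.
Qed.

Lemma gact_signr a f (n : nat) m : act a (fun p => (-1) ^+ n * f p) m = (-1) ^+ n * act a f m.
Proof.
rewrite -signr_odd; case: (odd n); last by rewrite mul1r; apply: act_ext => p; rewrite mul1r.
by rewrite mulN1r -gact_oppr; apply: act_ext => p; rewrite mulN1r.
Qed.

Lemma gact_sum (I : Type) (r : seq I) (P : pred I) (F : I -> A) f m :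
  act (\sum_(i <- r | P i) F i) f m = \sum_(i <- r | P i) act (F i) f m.
Proof. exact: (big_morph (fun a => act a f m) (fun a b => actD a b f m) (gact0 f m)). Qed.

Lemma gact_sumr (I : Type) (r : seq I) (P : pred I) a (F : I -> M -> int) m :
  act a (fun p => \sum_(i <- r | P i) F i p) m = \sum_(i <- r | P i) act a (F i) m.
Proof.
elim: r => [|i r IH].
  rewrite big_nil; transitivity (act a (fun=> 0) m); last exact: gact_zero.
  by apply: act_ext => p; rewrite big_nil.
rewrite big_cons -IH; case: ifP => Pi.
  by rewrite -act_addr; apply: act_ext => p; rewrite big_cons Pi.
by apply: act_ext => p; rewrite big_cons Pi.
Qed.

(** Each factor removes one generator of the cone by [cone_ind_step], until only the origin is
    left. *)
Lemma act_cone (X : finType) (u : X -> M) (S P : {set X}) m : zindep u S ->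
  act (\prod_(x in S) (1 - z (u x))) (cone_ind u S P) m = (-1) ^+ #|S :&: P| * delta0 m.
Proof.
have [k] := ubnP #|S|; elim: k S m => // k IH S m; rewrite ltnS => leS iS.
have [->|[y yS]] := set_0Vmem S.
  rewrite big_set0 act1 set0I cards0 mul1r; congr (_%:R); congr nat_of_bool.
  apply/asboolP/eqP => [[l [ls <- _]]|->].
    by rewrite /zcomb big1 // => x _; rewrite ls ?inE // mulr0z.
  by exists (fun=> 0); split=> // [|x]; rewrite ?inE // /zcomb big1 // => x _; rewrite mulr0z.
have iSy : zindep u (S :\ y).
  by move=> l ls; apply: iS => x xS; apply: ls; rewrite in_setD1 (negPf xS) andbF.
rewrite (big_setD1 y) //= mulrC actM.
have -> : act (\prod_(x in S :\ y) (1 - z (u x))) (act (1 - z (u y)) (cone_ind u S P)) m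
   = act (\prod_(x in S :\ y) (1 - z (u x)))
        (fun p => (-1) ^+ (y \in P) * cone_ind u (S :\ y) P p) m.
  by apply: act_ext => p; rewrite actD act1 gactN act_z cone_ind_step.
rewrite gact_signr IH //; last by move: leS; rewrite (cardsD1 y) yS.
rewrite mulrA -exprD; congr (_ ^+ _ * _).
by rewrite [in RHS](cardsD1 y) !inE yS /= setIDAC.
Qed.

End Action.

(** The sum expands a product with one factor per element: - (1 - w x) on B, where x is forced; 1 -
    (1 - w x) = w x on N, where x is free; 1 elsewhere. *)
Lemma sum_between_sets (A : comNzRingType) (X : finType) (w : X -> A) (B N : {set X}) :
  [disjoint B & N] ->
  \sum_(Y : {set X} | (B \subset Y) && (Y \subset B :|: N))
     (-1) ^+ #|Y| * \prod_(x in Y) (1 - w x)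
  = (-1) ^+ #|B| * \prod_(x in B) (1 - w x) * \prod_(x in N) w x.
Proof.
move=> dBN.
pose F x : A := if x \in B :|: N then - (1 - w x) else 0.
pose G x : A := if x \in B then 0 else 1.
have FG x : F x + G x = (if x \in B then - (1 - w x) else 1) * (if x \in N then w x else 1).
  rewrite /F /G inE; have := disjointFr dBN (x := x).
  case: (x \in B) => [/(_ isT)-> /=|_ /=]; first by rewrite addr0 mulr1.
  by case: (x \in N); rewrite ?add0r mul1r // opprB subrK.
transitivity (\prod_x (F x + G x)).
  rewrite bigA_distr [RHS](bigID (fun Y : {set X} => (B \subset Y) && (Y \subset B :|: N))) /=.
  rewrite [X in _ = _ + X]big1 ?addr0 => [|Y]; last first.
    rewrite negb_and => /orP[] /subsetPn[x xB xY].
      by rewrite (bigD1 x) //= (negPf xY) /G xB mul0r.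
    by rewrite (bigD1 x) //= xB /F (negPf xY) mul0r.
  apply/eq_bigr => Y /andP[sB sN]; rewrite [RHS](bigID (mem Y)) /=.
  rewrite [X in _ = _ * X]big1 ?mulr1 => [|x xY]; last first.
    by rewrite (negPf xY) /G; case: ifPn => // /(subsetP sB); rewrite (negPf xY).
  rewrite -prodr_const -big_split; apply/eq_bigr => x xY /=.
  by rewrite xY /F (subsetP sN) // mulN1r.
under eq_bigr do rewrite FG.
rewrite big_split /=; congr (_ * _); last by rewrite [RHS]big_mkcond.
rewrite -prodr_const -big_split [RHS]big_mkcond /=.
by apply/eq_bigr => x _; rewrite mulN1r.
Qed.

(** * The signed sum over chambers *)

Section ChamberSum.
Variables (R : realFieldType) (n : nat) (X : finType) (V : X -> 'rV[R]_n) (v : 'rV[R]_n).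
Variables (M : zmodType) (A : comNzRingType) (z : M -> A) (u : X -> M).
Variable act : A -> (M -> int) -> M -> int.
Hypothesis act_ext : forall a f g, f =1 g -> act a f =1 act a g.
Hypothesis actD : forall a b f m, act (a + b) f m = act a f m + act b f m.
Hypothesis act_addr : forall a f g m, act a (fun p => f p + g p) m = act a f m + act a g m.
Hypothesis act1 : forall f m, act 1 f m = f m.
Hypothesis actM : forall a b f m, act (a * b) f m = act a (act b f) m.
Hypothesis act_z : forall w f m, act (z w) f m = f (m - w).
Hypothesis act_faithful : forall a, (forall m, act a (@delta0 M) m = 0) -> a = 0.
Hypothesis zD : forall a b, z (a + b) = z a * z b.
Hypothesis z0 : z 0 = 1.

Hypothesis gen : generic_point V v.
(* The family u is Gale dual to V. *)
Hypothesis gale : forall l : X -> int,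
  zcomb u l = 0 <-> exists pi, forall x, pairing V pi x = (l x)%:~R.
(** By [gale], l and [l'] have the same [zcomb]; hence the [u x] with x outside a basis generate the
    same lattice as the whole family. *)
Hypothesis unimod : forall B (l : X -> int), chamber_basis V v B ->
  exists l' : X -> int, (forall b, b \in B -> l' b = 0) /\
    exists pi, forall x, pairing V pi x = (l x - l' x)%:~R.

Definition chamber_sum : A :=
  \sum_(Y : {set X} | `[< acyclic V Y /\ in_pos V v Y >])
    (-1) ^+ #|Y| * \prod_(x in Y) (1 - z (u x)).

Local Notation basis B := (chamber_basis V v B).

Lemma pairingB pi1 pi2 x : pairing V (pi1 - pi2) x = pairing V pi1 x - pairing V pi2 x.
Proof. by rewrite /pairing mulmxBr !mxE. Qed.

Lemma pairingN pi x : pairing V (- pi) x = - pairing V pi x.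
Proof. by rewrite /pairing mulmxN mxE. Qed.

Lemma pairingD pi1 pi2 x : pairing V (pi1 + pi2) x = pairing V pi1 x + pairing V pi2 x.
Proof. by rewrite /pairing mulmxDr !mxE. Qed.

Lemma pairing0_basis B pi : basis B -> (forall b, b \in B -> pairing V pi b = 0) ->
  forall x, pairing V pi x = 0.
Proof.
move=> [_ /gen g] h x; have [l ls lx] := g x.
rewrite /pairing -lx -pairing_comb big1 // => y _.
by case: (boolP (y \in B)) => yB; [rewrite h // mulr0|rewrite ls // mul0r].
Qed.

(** A relation is a potential by Gale duality; supported off B, it vanishes on B, hence
    everywhere. *)
Lemma basis_zindep B : basis B -> zindep u (~: B).
Proof.
move=> cB k ks /gale[pi piE] x; apply/eqP; rewrite -(intr_eq0 R) -piE; apply/eqP.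
by apply: (pairing0_basis cB) => b bB; rewrite piE ks // inE negbK.
Qed.

(** A perturbation that breaks ties: its reduced costs are nonzero, and they stay below 1 so that
    they never outweigh an integer. *)
Lemma generic_cost : exists l0 : X -> R, (forall x, 0 < l0 x) /\
  forall B pi, basis B -> (forall b, b \in B -> pairing V pi b = l0 b) ->
    forall x, x \notin B -> 0 < `|l0 x - pairing V pi x| < 1.
Proof.
have /choice[m mP] (k : {set X} * X) : exists l : X -> R, basis k.1 ->
    supp l k.1 /\ comb V l = V k.2.
  case: (pselect (basis k.1)) => [cB|ncB]; last by exists (fun=> 0).
  by have [_ /gen/(_ k.2)[l ls lx]] := cB; exists l.
pose good (k : {set X} * X) := `[< basis k.1 >] && (k.2 \notin k.1).
(* For a good pair, the form whose value at a cost is the reduced cost of [k.2] over the basis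
   [k.1]. In all cases its coefficient at [k.2] is 1, so it is nonzero. *)
pose c k y := (y == k.2)%:R - if good k then m k y else 0.
have [|w [w0 wP]] := @generic_weights R X _ c.
  move=> k; exists k.2; rewrite /c eqxx /good.
  case: ifPn => [/andP[/asboolP/mP[ms _] kB]|_]; last by rewrite subr0 oner_eq0.
  by rewrite ms // subr0 oner_eq0.
pose K := 1 + \sum_k `|\sum_y c k y * w y|.
have K0 : 0 < K by rewrite ltr_wpDr // sumr_ge0.
exists (fun x => K^-1 * w x); split=> [x|B pi cB piB x xB].
  by rewrite mulr_gt0 ?invr_gt0.
have -> : K^-1 * w x - pairing V pi x = K^-1 * \sum_y c (B, x) y * w y.
  have gBx : good (B, x) by rewrite /good /= xB andbT; apply/asboolP.
  have [ms mv] := mP (B, x) cB.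
  rewrite /c gBx /=; under eq_bigr do rewrite mulrBl.
  rewrite sumrB mulrBr; congr (_ - _).
    rewrite (bigD1 x) //= eqxx mul1r big1 ?addr0 // => y /negPf ->.
    by rewrite mul0r.
  rewrite [in LHS]/pairing -mv -pairing_comb mulr_sumr; apply/eq_bigr => y _.
  case: (boolP (y \in B)) => yB; first by rewrite piB // mulrCA.
  by rewrite ms // !mul0r mulr0.
rewrite normrM gtr0_norm ?invr_gt0 // mulr_gt0 ?invr_gt0 ?normr_gt0 //=.
rewrite mulrC ltr_pdivrMr // mul1r /K (bigD1 (B, x)) //=.
have : 0 <= \sum_(i | i != (B, x)) `|\sum_y c i y * w y| by apply: sumr_ge0.
lra.
Qed.

(* The optimal bases for the cost - l0 partition the sets Y, which makes chamber_sum an alternating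
   sum over bases.  Divided by \prod_x (1 - z (u x)), it is up to sign the sum S of the indicators of
   shifted cones, and S (zcomb u l) = 1 exactly when the linear program with cost l + l0 has an
   optimum.  This depends only on the values of the cost on the nonnegative relations of V, which do
   not involve x0: hence S is invariant under translation by u x0. *)
Lemma chamber_sum_eq0 (x0 : X) : u x0 != 0 ->
  (forall l, nonneg l -> comb V l = 0 -> l x0 = 0) ->
  (1 - z (u x0)) * chamber_sum = 0.
Proof.
move=> ux0 rel0.
have [l0 [l0pos l0gen]] := generic_cost.
have /choice[piB piBP] (B : {set X}) : exists pi, basis B -> forall b, b \in B ->
    pairing V pi b = l0 b.
  case: (pselect (basis B)) => [[/(potential l0)[pi piP] _]|]; first by exists pi.
  by exists 0.
pose r B x := l0 x - pairing V (piB B) x.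
have rgen B x : basis B -> x \notin B -> 0 < `|r B x| < 1.
  by move=> cB; apply: l0gen => // b bB; exact: piBP.
(* Under the cost [- l0] the optimality inequality at x outside B reads [r B x < 0], so the sets Y
   with optimal basis B form an interval. *)
pose N (B : {set X}) := [set x | (x \notin B) && (r B x < 0)].
have optE (Y B : {set X}) : optimal V v Y (fun x => - l0 x) B <->
    basis B /\ (B \subset Y) && (Y \subset B :|: N B).
  split=> [[sB cB [pi [piE piY]]]|[cB /andP[sB sY]]].
    split=> //; rewrite sB; apply/subsetP => x xY; rewrite !inE.
    case: (boolP (x \in B)) => //= xB.
    have H : pairing V (pi + piB B) x = 0.
      apply: (pairing0_basis cB) => b bB; rewrite pairingD piE // piBP //.
      by rewrite addNr.
    by have := piY x xY xB; move: H; rewrite pairingD /r; lra.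
  split=> //; exists (- piB B); split=> [b bB|x xY xB].
    by rewrite pairingN piBP.
  by have := subsetP sY x xY; rewrite !inE (negPf xB) /= /r pairingN; lra.
have TE : chamber_sum = \sum_(B : {set X} | `[< basis B >])
    (-1) ^+ #|B| * \prod_(x in B) (1 - z (u x)) * \prod_(x in N B) z (u x).
  under [RHS]eq_bigr => B _.
    rewrite -sum_between_sets; last first.
      by rewrite disjoint_subset; apply/subsetP => x xB; rewrite !inE xB.
    over.
  rewrite (exchange_big_dep predT) //= /chamber_sum big_mkcond /=; apply/eq_bigr => Y _.
  case: asboolP => [[aY pY]|nY]; last first.
    rewrite big1 // => B /andP[/asboolP cB /andP[sB sY]]; case: nY.
    have oB : optimal V v Y (fun x => - l0 x) B by apply/optE; rewrite sB sY.
    split; last first.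
      have [_ [l [ln ls lv]]] := cB; exists l; split=> // x xY; apply: ls.
      by apply: contra xY; exact: (subsetP sB).
    (* The cost [- l0] is negative, so a nonnegative relation of nonnegative cost is zero: the
       bounded programs are the acyclic ones. *)
    move=> l ln ls lv x; have := optimal_rel oB ln ls lv.
    under eq_bigr do rewrite mulrN.
    rewrite sumrN oppr_ge0 => le; apply/eqP.
    have h : \sum_x l x * l0 x = 0.
      apply/eqP; rewrite eq_le le; apply: sumr_ge0 => y _.
      by rewrite mulr_ge0 // ltW.
    have /(_ x isT)/eqP := psumr_eq0P (fun y _ => mulr_ge0 (ln y) (ltW (l0pos y))) h.
    by rewrite mulf_eq0 (gt_eqF (l0pos x)) orbF.
  have [B oB] : exists B, optimal V v Y (fun x => - l0 x) B.
    apply: (optimal_exists gen pY) => [l ln ls lv|B pi cB piE x xB].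
      by rewrite big1 // => x _; rewrite (aY l) // mul0r.
    apply/eqP => e.
    have H b : b \in B -> pairing V (- pi) b = l0 b by move=> bB; rewrite pairingN piE // opprK.
    by have := l0gen B (- pi) cB H x xB; rewrite pairingN e opprK subrr normr0 ltxx.
  have [cB /andP[sB sY]] := (optE Y B).1 oB.
  rewrite (big_pred1 B) // => B' /=; apply/andP/eqP => [[/asboolP cB' sB']|->].
    have oB' : optimal V v Y (fun x => - l0 x) B' by apply/optE.
    by apply/eqP; rewrite eqEsubset (optimal_sub gen oB oB') (optimal_sub gen oB' oB).
  by split; [apply/asboolP|rewrite sB sY].
have [[B0 cB0]|nB] := pselect (exists B, basis B); last first.
  rewrite TE big_pred0 ?mulr0 // => B; apply/asboolP => cB; apply: nB; by exists B.
(* The translation by the sum over [N B] accounts for the last factors in [TE]. *)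
pose S m := \sum_(B : {set X} | `[< basis B >])
  cone_ind u (~: B) set0 (m - \sum_(x in N B) u x).
have zsum (P : {set X}) : z (\sum_(x in P) u x) = \prod_(x in P) z (u x).
  exact: (big_morph z zD z0).
pose Q := \prod_x (1 - z (u x)).
have sgn a f q : act ((-1) ^+ #|B0| * a) f q = (-1) ^+ #|B0| * act a f q.
  rewrite -signr_odd -[in RHS]signr_odd; case: (odd _); rewrite ?mul1r //.
  by rewrite !mulN1r (gactN actD).
(* All bases have the same size, so they carry one common sign; the factors of Q outside B turn the
   cone of B into a point mass. *)
have QS m : act Q S m = (-1) ^+ #|B0| * act chamber_sum (@delta0 M) m.
  rewrite TE (gact_sum actD) (gact_sumr act_ext act_addr) mulr_sumr.
  apply/eq_bigr => B /asboolP cB.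
  rewrite (basis_card gen cB cB0) -mulrA sgn mulrA -exprD addnn -signr_odd odd_double mul1r.
  pose w := \sum_(x in N B) u x.
  transitivity (act Q (act (z w) (cone_ind u (~: B) set0)) m).
    by apply: act_ext => p; rewrite act_z.
  have -> : Q = \prod_(x in B) (1 - z (u x)) * \prod_(x in ~: B) (1 - z (u x)).
    rewrite /Q (bigID (mem B)) /=; congr (_ * _); apply: eq_bigl => x; by rewrite inE.
  rewrite -actM mulrAC actM -zsum; apply: act_ext => p.
  rewrite (act_cone act_ext actD act_addr act1 actM act_z) ?setI0 ?cards0 ?mul1r //.
  exact: basis_zindep.
(* Optimality requires [0 < l' x + r B x] outside B. Since the reduced cost is smaller than 1 in
   absolute value, this means [0 <= l' x] when it is positive and [1 <= l' x] when it is negative;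
   hence the shift by [N B]. *)
have coneopt (B : {set X}) (l : X -> int) : basis B ->
    cone_ind u (~: B) set0 (zcomb u l - \sum_(x in N B) u x) =
    `[< optimal V v setT (fun x => (l x)%:~R + l0 x) B >]%:R.
  move=> cB; congr (_%:R); congr nat_of_bool; apply/asboolP/asboolP.
    move=> [k [ks ke kP]].
    have /gale[pi piE] : zcomb u (fun x => l x - (k x + (x \in N B)%:Z)) = 0.
      by rewrite zcombB zcombD zcomb_ind ke subrK subrr.
    split; rewrite ?subsetT //; exists (pi + piB B); split=> [b bB|x _ xB].
      have bN : (b \in N B) = false by rewrite inE bB.
      have kb : k b = 0 by apply: ks; rewrite inE negbK.
      have e : l b - (k b + (b \in N B)%:Z) = l b by rewrite kb bN; lia.
      by rewrite pairingD piE piBP // e.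
    have := kP x; rewrite in_setC xB in_set0 => /(_ isT) k0.
    rewrite pairingD piE; have := rgen B x cB xB.
    rewrite /N inE xB /=; case: (ltP (r B x) 0) => rx.
      rewrite (ltr0_norm rx) => /andP[_].
      have : (0 : R) <= (k x)%:~R by rewrite ler0z.
      rewrite /r !rmorphB !rmorphD /=; lra.
    rewrite (ger0_norm rx) => /andP[].
    have : (0 : R) <= (k x)%:~R by rewrite ler0z.
    rewrite /r !rmorphB !rmorphD /=; lra.
  move=> [_ _ [pi [piE piL]]].
  have [l' [lB [pi1 pi1E]]] := unimod l cB.
  have piBE x : pairing V pi x - pairing V pi1 x = pairing V (piB B) x.
    apply/eqP; rewrite -subr_eq0 -!pairingB; apply/eqP.
    apply: (pairing0_basis cB) => b bB; rewrite !pairingB piE // pi1E piBP // lB //.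
    by rewrite subr0 [X in X - _ - _]addrC addrK subrr.
  exists (fun x => l' x - (x \in N B)%:Z); split.
  - by move=> x; rewrite inE negbK => xB; rewrite lB // inE xB.
  - rewrite zcombB zcomb_ind; congr (_ - _); apply/eqP; rewrite eq_sym -subr_eq0 -zcombB.
    by apply/eqP/gale; exists pi1.
  move=> x; rewrite in_setC in_set0 => xB; have := piL x (in_setT x) xB.
  have := rgen B x cB xB; rewrite inE xB /=.
  have -> : pairing V pi x = (l x)%:~R - (l' x)%:~R + (l0 x - r B x).
    by rewrite /r opprB [l0 x + _]addrC subrK -piBE pi1E rmorphB /= addrC subrK.
  case: (ltP (r B x) 0) => rx.
    rewrite (ltr0_norm rx) => /andP[r0 r1] h.
    have : (0 : R) < (l' x)%:~R by lra.
    by rewrite ltr0z; lia.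
  rewrite (ger0_norm rx) => /andP[r0 r1] h.
  have : (-1 : R) < (l' x)%:~R by lra.
  by rewrite -(rmorphN1 (intmul (1 : R))) /= ltr_int; lia.
have Sopt l : S (zcomb u l) = `[< exists B, optimal V v setT (fun x => (l x)%:~R + l0 x) B >]%:R.
  rewrite /S; under eq_bigr => B /asboolP cB do rewrite coneopt //.
  case: asboolP => [[B oB]|no]; last first.
    by rewrite big1 // => B _; case: asboolP => // oB; case: no; exists B.
  have [_ cB _] := oB.
  rewrite (bigD1 B) /=; last exact/asboolP.
  rewrite big1 ?addr0; first by case: asboolP.
  move=> B' /andP[_ /eqP BB']; case: asboolP => // oB'; case: BB'.
  by apply/eqP; rewrite eqEsubset (optimal_sub gen oB oB') (optimal_sub gen oB' oB).
have optex l : (exists B, optimal V v setT (fun x => (l x)%:~R + l0 x) B) <->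
    forall k, nonneg k -> comb V k = 0 -> 0 <= \sum_x k x * ((l x)%:~R + l0 x).
  split=> [[B oB] k kn kv|h].
    by apply: (optimal_rel oB) => // x; rewrite inE.
  apply: (optimal_exists gen).
  - by have [_ [k [kn ks kv]]] := cB0; exists k; split=> // x; rewrite inE.
  - by move=> k kn _; exact: h.
  - move=> B pi cB piE x xB.
    have [l' [lB [pi1 pi1E]]] := unimod l cB.
    have piBE y : pairing V pi y - pairing V pi1 y = pairing V (piB B) y.
      apply/eqP; rewrite -subr_eq0 -!pairingB; apply/eqP.
      apply: (pairing0_basis cB) => b bB; rewrite !pairingB piE // pi1E piBP // lB //.
      by rewrite subr0 [X in X - _ - _]addrC addrK subrr.
    have -> : pairing V pi x = (l x)%:~R - (l' x)%:~R + (l0 x - r B x).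
      by rewrite /r opprB [l0 x + _]addrC subrK -piBE pi1E rmorphB /= addrC subrK.
    have /andP[r0 r1] := rgen B x cB xB; apply/eqP => e.
    have rl : r B x = - (l' x)%:~R by lra.
    move: r0 r1; rewrite rl normrN -intr_norm ltr0z -(rmorph1 (intmul (1 : R))) /= ltr_int.
    by lia.
have Sshift l : S (zcomb u l) = S (zcomb u (fun x => l x - (x == x0)%:Z)).
  rewrite !Sopt; congr (_%:R); congr nat_of_bool; apply/asbool_equiv_eq.
  apply: iff_trans (optex _) _; apply: iff_sym; apply: iff_trans (optex _) _.
  have e k : nonneg k -> comb V k = 0 ->
     \sum_x k x * ((l x - (x == x0)%:Z)%:~R + l0 x) = \sum_x k x * ((l x)%:~R + l0 x).
    move=> kn kv; apply/eq_bigr => x _; case: eqP => [->|_]; last by rewrite subr0.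
    by rewrite rel0 // !mul0r.
  by split=> h k kn kv; have := h k kn kv; rewrite e.
have Sinv m : S (m - u x0) = S m.
  have [[l <-]|nl] := pselect (exists l, zcomb u l = m).
    by rewrite Sshift zcombB zcomb_delta.
  (* If m is not an integral combination of the [u x], neither is its translate, and S vanishes at
     both. *)
  have S0 p : (exists l, zcomb u l = p - m) -> S p = 0.
    move=> [l le]; apply: big1 => B _; rewrite /cone_ind; case: asboolP => // -[k [_ ke _]].
    case: nl; exists (fun x => k x + (x \in N B)%:Z - l x).
    by rewrite zcombB zcombD zcomb_ind ke le subrK opprB addrC subrK.
  rewrite !S0 //.
    by exists (fun=> 0); rewrite subrr /zcomb big1 // => x _; rewrite mulr0z.
  exists (fun x => 0 - (x == x0)%:Z); rewrite zcombB zcomb_delta addrAC subrr add0r.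
  rewrite -[RHS]sub0r; congr (_ - _).
  by rewrite /zcomb big1 // => x _; rewrite mulr0z.
apply: act_faithful => m.
have -> : act ((1 - z (u x0)) * chamber_sum) (@delta0 M) m =
   act (1 - z (u x0)) (fun p => (-1) ^+ #|B0| * act Q S p) m.
  rewrite actM; apply: act_ext => p; rewrite QS mulrA -exprD addnn -signr_odd odd_double.
  by rewrite mul1r.
rewrite (gact_signr act_ext act_addr) -actM [X in act X S]mulrC actM.
suff -> : act Q (act (1 - z (u x0)) S) m = 0 by rewrite mulr0.
transitivity (act Q (fun=> 0) m); last exact: gact_zero.
by apply: act_ext => p; rewrite actD act1 (gactN actD) act_z Sinv subrr.
Qed.

End ChamberSum.

Definition ev (d : nat) (m n : 'rV[int]_d) : int := (m *m n^T) 0 0.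

(** * Rays and dual bases of a unimodular fan *)

Section Dot.
Variables (R : realType) (d : nat).
Implicit Types (x y u w : 'rV[R]_d) (m n : 'rV[int]_d).

Lemma dotE u x : dot u x = \sum_j u 0 j * x 0 j.
Proof. by rewrite /dot mxE; apply/eq_bigr => j _; rewrite mxE. Qed.

Lemma evE m n : ev m n = \sum_j m 0 j * n 0 j.
Proof. by rewrite /ev mxE; apply/eq_bigr => j _; rewrite mxE. Qed.

Lemma dot_toR m n : dot (toR R m) (toR R n) = (ev m n)%:~R.
Proof. by rewrite dotE evE rmorph_sum; apply/eq_bigr => j _; rewrite !mxE rmorphM. Qed.

Lemma dotDr u x y : dot u (x + y) = dot u x + dot u y.
Proof. by rewrite !dotE -big_split; apply/eq_bigr => j _; rewrite mxE mulrDr. Qed.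

Lemma dotZr u (c : R) x : dot u (c *: x) = c * dot u x.
Proof. by rewrite !dotE mulr_sumr; apply/eq_bigr => j _; rewrite mxE mulrCA. Qed.

Lemma dot0r u : dot u 0 = 0.
Proof. by rewrite dotE big1 // => j _; rewrite mxE mulr0. Qed.

Lemma dotC u x : dot u x = dot x u.
Proof. by rewrite !dotE; apply/eq_bigr => j _; rewrite mulrC. Qed.

Lemma dotDl u w x : dot (u + w) x = dot u x + dot w x.
Proof. by rewrite dotC dotDr !(dotC x). Qed.

Lemma dotNl u x : dot (- u) x = - dot u x.
Proof. by rewrite !dotE -sumrN; apply/eq_bigr => j _; rewrite mxE mulNr. Qed.

Lemma dot_sumr (I : Type) (r : seq I) (P : pred I) u (F : I -> 'rV[R]_d) :
  dot u (\sum_(i <- r | P i) F i) = \sum_(i <- r | P i) dot u (F i).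
Proof. exact: (big_morph (dot u) (dotDr u) (dot0r u)). Qed.

Lemma dot_suml (I : Type) (r : seq I) (P : pred I) x (F : I -> 'rV[R]_d) :
  dot (\sum_(i <- r | P i) F i) x = \sum_(i <- r | P i) dot (F i) x.
Proof. by rewrite dotC dot_sumr; apply/eq_bigr => i _; rewrite dotC. Qed.

Lemma toRD m n : toR R (m + n) = toR R m + toR R n.
Proof. exact: map_mxD. Qed.

Lemma toRN m : toR R (- m) = - toR R m.
Proof. exact: map_mxN. Qed.

Lemma toR_inj : injective (@toR R d).
Proof.
move=> m n /rowP e; apply/rowP => j; have := e j; rewrite !mxE => /eqP.
by rewrite eqr_int => /eqP.
Qed.

Lemma evDl m1 m2 n : ev (m1 + m2) n = ev m1 n + ev m2 n.
Proof. by rewrite !evE -big_split; apply/eq_bigr => j _; rewrite mxE mulrDl. Qed.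

Lemma evNl m n : ev (- m) n = - ev m n.
Proof. by rewrite !evE -sumrN; apply/eq_bigr => j _; rewrite mxE mulNr. Qed.

Lemma ev0l n : ev 0 n = 0.
Proof. by rewrite evE big1 // => j _; rewrite mxE mul0r. Qed.

Lemma evMzl m n (c : int) : ev (m *~ c) n = ev m n * c.
Proof.
rewrite !evE mulr_suml; apply/eq_bigr => j _.
by rewrite -scaler_int mxE intz mulrC [c * _]mulrC mulrA [n 0 j * _]mulrC.
Qed.

Lemma ev_suml (I : Type) (r : seq I) (P : pred I) n (F : I -> 'rV[int]_d) :
  ev (\sum_(i <- r | P i) F i) n = \sum_(i <- r | P i) ev (F i) n.
Proof. exact: (big_morph (fun m => ev m n) (fun a b => evDl a b n) (ev0l n)). Qed.

End Dot.

Section ConeHull.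
Variables (R : realType) (d : nat).
Implicit Types (x y : 'rV[R]_d) (s : seq 'rV[R]_d).

Lemma cone_hull_mem s x : x \in s -> cone_hull s x.
Proof.
move=> xs; pose k := Ordinal (etrans (index_mem x s) xs : (index x s < size s)%N).
exists (fun i => (i == k)%:R) => //.
rewrite (bigD1 k) //= eqxx scale1r nth_index // big1 ?addr0 // => i /negPf ->.
by rewrite scale0r.
Qed.

Lemma cone_hull0 s : cone_hull s 0.
Proof. by exists (fun=> 0) => //; rewrite big1 // => i _; rewrite scale0r. Qed.

Lemma cone_hullD s x y : cone_hull s x -> cone_hull s y -> cone_hull s (x + y).
Proof.
move=> [a a0 ->] [b b0 ->]; exists (fun i => a i + b i).
  by move=> i; rewrite addr_ge0.
by rewrite -big_split; apply/eq_bigr => i _; rewrite scalerDl.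
Qed.

Lemma cone_hullZ s (c : R) x : 0 <= c -> cone_hull s x -> cone_hull s (c *: x).
Proof.
move=> c0 [a a0 ->]; exists (fun i => c * a i).
  by move=> i; rewrite mulr_ge0.
by rewrite scaler_sumr; apply/eq_bigr => i _; rewrite scalerA.
Qed.

Lemma cone_hull_sum s (I : Type) (r : seq I) (P : pred I) (F : I -> 'rV[R]_d) :
  (forall i, P i -> cone_hull s (F i)) -> cone_hull s (\sum_(i <- r | P i) F i).
Proof.
by move=> h; apply: big_ind h; [exact: cone_hull0|exact: cone_hullD].
Qed.

Lemma cone_hull_ind s (P : 'rV[R]_d -> Prop) :
  P 0 -> (forall x y, P x -> P y -> P (x + y)) ->
  (forall c x, 0 <= c -> P x -> P (c *: x)) -> (forall x, x \in s -> P x) ->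
  forall x, cone_hull s x -> P x.
Proof.
move=> P0 PD PZ Ps x [c c0 ->]; apply: big_ind => // i _; apply: PZ => //.
by apply: Ps; exact: mem_nth.
Qed.

Variable b : 'M[int]_d.
Hypothesis bU : b \in unitmx.
Definition coord x i : R := (x *m map_mx intr (invmx b)) 0 i.

Lemma mulBC : (map_mx intr b : 'M[R]_d) *m map_mx intr (invmx b) = 1%:M.
Proof. by rewrite -map_mxM mulmxV // map_mx1. Qed.

Lemma mulCB : (map_mx intr (invmx b) : 'M[R]_d) *m map_mx intr b = 1%:M.
Proof. by rewrite -map_mxM mulVmx // map_mx1. Qed.

Lemma coordD x y i : coord (x + y) i = coord x i + coord y i.
Proof. by rewrite /coord mulmxDl mxE. Qed.

Lemma coordZ (c : R) x i : coord (c *: x) i = c * coord x i.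
Proof. by rewrite /coord -scalemxAl mxE. Qed.

Lemma coord0 i : coord 0 i = 0.
Proof. by rewrite /coord mul0mx mxE. Qed.

Lemma coord_sum (I : Type) (r : seq I) (P : pred I) (F : I -> 'rV[R]_d) i :
  coord (\sum_(j <- r | P j) F j) i = \sum_(j <- r | P j) coord (F j) i.
Proof. exact: (big_morph (fun x => coord x i) (fun x y => coordD x y i) (coord0 i)). Qed.

Lemma coord_row i j : coord (toR R (row j b)) i = (j == i)%:R.
Proof. by rewrite /coord /toR map_row -row_mul mulBC !mxE. Qed.

Lemma coord_inj x y : (forall i, coord x i = coord y i) -> x = y.
Proof.
move=> e; rewrite -[x]mulmx1 -[y]mulmx1 -mulCB !mulmxA; congr (_ *m _).
by apply/rowP => i; exact: e.
Qed.

Lemma coord_expand x : x = \sum_i coord x i *: toR R (row i b).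
Proof.
apply: coord_inj => i; rewrite coord_sum (bigD1 i) //= coordZ coord_row eqxx mulr1.
rewrite big1 ?addr0 // => j /negPf ji; by rewrite coordZ coord_row ji mulr0.
Qed.

Lemma coord_int (n : 'rV[int]_d) i : coord (toR R n) i = ((n *m invmx b) 0 i)%:~R.
Proof. by rewrite /coord /toR -map_mxM mxE. Qed.

Lemma coord_dot x i : coord x i = dot (toR R (col i (invmx b))^T) x.
Proof.
by rewrite /coord mxE dotE; apply/eq_bigr => j _; rewrite !mxE mulrC.
Qed.

Lemma cone_hullE (I : {set 'I_d}) x :
  cone_hull [seq toR R (row i b) | i <- enum I] x <->
  forall i, 0 <= coord x i /\ (i \notin I -> coord x i = 0).
Proof.
split=> [|h].
  apply: (cone_hull_ind (P := fun x => forall i, 0 <= coord x i /\ (i \notin I -> coord x i = 0))).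
  - by move=> i; rewrite coord0.
  - move=> y z yP zP i; have [y0 yI] := yP i; have [z0 zI] := zP i.
    rewrite coordD addr_ge0 //; split=> // iI; by rewrite yI // zI // addr0.
  - move=> c y c0 yP i; have [y0 yI] := yP i; rewrite coordZ mulr_ge0 //.
    by split=> // iI; rewrite yI // mulr0.
  - move=> y /mapP[j]; rewrite mem_enum => jI -> i; rewrite coord_row ler0n; split=> //.
    by case: eqP => // <-; rewrite jI.
rewrite [x]coord_expand; apply: cone_hull_sum => i _; have [i0 iI] := h i.
case: (boolP (i \in I)) => II; last by rewrite iI // scale0r; exact: cone_hull0.
by apply: cone_hullZ => //; apply: cone_hull_mem; apply: map_f; rewrite mem_enum.
Qed.

End ConeHull.

(* du s is the dual basis of the rays of s; du s r is irrelevant if r is not a ray of s. *)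
Record fan_data (R : realType) (d : nat) (Sigma : {fset set 'rV[R]_d}) := FanData {
  ray : finType;
  vec : ray -> 'rV[int]_d;
  du : Sigma -> ray -> 'rV[int]_d;
  rays : Sigma -> {set ray} := fun s => [set r | `[< val s (toR R (vec r)) >]];
  vec_inj : injective vec;
  du_vec : forall s r t, r \in rays s -> t \in rays s -> ev (du s r) (vec t) = (r == t)%:Z;
  cone_gen : forall s x, val s x <-> exists c : ray -> R,
    [/\ forall r, 0 <= c r, forall r, r \notin rays s -> c r = 0 &
        x = \sum_r c r *: toR R (vec r)];
  face_rays : forall s (S : {set ray}), S \subset rays s -> exists t, rays t = S;
  capS : forall s t : Sigma, exists w : Sigma, val w = (val s `&` val t)%classic;
  nonmax : forall s, #|rays s| != d ->
    exists2 w, w != 0 & forall r, r \in rays s -> ev w (vec r) = 0;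
  max_expand : forall s, #|rays s| = d -> forall x : 'rV[R]_d,
    x = \sum_(r in rays s) dot (toR R (du s r)) x *: toR R (vec r) }.

Section FanDataExists.
Variables (R : realType) (d : nat) (Sigma : {fset set 'rV[R]_d}).
Hypothesis fanS : fan Sigma.
Variables (bas : Sigma -> 'M[int]_d) (idx : Sigma -> {set 'I_d}).
Hypothesis basU : forall s, bas s \in unitmx.
Hypothesis valE : forall s, val s = cone_hull [seq toR R (row i (bas s)) | i <- enum (idx s)].

Local Notation crd s := (coord (bas s)).

Lemma in_cone s x : val s x <-> forall i, 0 <= crd s x i /\ (i \notin idx s -> crd s x i = 0).
Proof. by rewrite valE cone_hullE. Qed.

Definition rayseq := [seq row i (bas s) | s <- enum {: Sigma}, i <- enum (idx s)].

Lemma rayseqP n : reflect (exists s i, i \in idx s /\ n = row i (bas s)) (n \in rayseq).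
Proof.
apply: (iffP allpairsPdep) => [[s [i [_ iI ->]]]|[s [i [iI ->]]]].
  by exists s, i; split=> //; rewrite -mem_enum.
by exists s, i; split=> //; rewrite mem_enum.
Qed.

Let vecf (r : seq_sub rayseq) : 'rV[int]_d := val r.
Let raysf (s : Sigma) : {set seq_sub rayseq} := [set r | `[< val s (toR R (vecf r)) >]].

Lemma row_in_cone s i : i \in idx s -> val s (toR R (row i (bas s))).
Proof.
move=> iI; apply/in_cone => j; rewrite coord_row // ler0n; split=> //.
by case: eqP => // <-; rewrite iI.
Qed.

(** A generator [n0] of a cone k spans a face of k, and this face meets s in a face of s. If [n0]
    lies in s, some generator of s with nonzero coefficient in [n0] lies in that face, hence on the
    same ray. Both are primitive, so they agree. *)
Lemma ray_is_row s r : r \in raysf s -> exists2 i, i \in idx s & vecf r = row i (bas s).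
Proof.
rewrite inE => /asboolP; rewrite /vecf; case: r => n /= /rayseqP[k [j [jI ->]]] sn.
set n0 := row j (bas k).
(* The sum of the other dual coordinates of k is a supporting functional that cuts out the ray of
   [n0]. *)
pose w : 'rV[R]_d := \sum_(i in idx k :\ j) toR R (col i (invmx (bas k)))^T.
have wE x : dot w x = \sum_(i in idx k :\ j) crd k x i.
  by rewrite dot_suml; apply/eq_bigr => i _; rewrite coord_dot.
have [_ fc cap] := fanS.
have rho_face : face [set x | val k x /\ dot w x = 0]%classic (val k).
  exists w => // x /in_cone kx; rewrite wE; apply: sumr_ge0 => i _; exact: (kx i).1.
have rhoS := fc _ _ (valP k) rho_face.
have rhoE x : (val k x /\ dot w x = 0) -> x = crd k x j *: toR R n0.
  move=> [/in_cone kx]; rewrite wE => /psumr_eq0P w0.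
  rewrite {1}(coord_expand (basU k) x) (bigD1 j) //= big1 ?addr0 // => i ij.
  case: (boolP (i \in idx k)) => iI; last by rewrite (kx i).2 // scale0r.
  rewrite w0 ?scale0r //; first by move=> l _; exact: (kx l).1.
  by rewrite !inE ij.
have rho_n0 : val k (toR R n0) /\ dot w (toR R n0) = 0.
  split; first exact: row_in_cone.
  rewrite wE big1 // => i; rewrite in_setD1 => /andP[ij _].
  by rewrite coord_row // eq_sym (negPf ij).
have [[w' w'0 capE] _] := cap _ _ (valP s) rhoS.
have capn0 : (val s `&` [set x | val k x /\ dot w x = 0])%classic (toR R n0) by split.
have n0w : dot w' (toR R n0) = 0 by move: capn0; rewrite capE => -[].
have n0s := (in_cone s _).1 sn.
have n0exp := coord_expand (basU s) (toR R n0).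
have sum0 : \sum_i crd s (toR R n0) i * dot w' (toR R (row i (bas s))) = 0.
  transitivity (dot w' (toR R n0)); last exact: n0w.
  rewrite [in RHS]n0exp dot_sumr.
  by apply/eq_bigr => i _; rewrite dotZr.
have term_ge0 i : 0 <= crd s (toR R n0) i * dot w' (toR R (row i (bas s))).
  case: (boolP (i \in idx s)) => iI; last by rewrite (n0s i).2 // mul0r.
  by rewrite mulr_ge0 // ?(n0s i).1 // w'0 //; exact: row_in_cone.
have [i cn0] : exists i, crd s (toR R n0) i != 0.
  apply: contrapT => /forallNP h.
  have z : toR R n0 = 0.
    apply: (coord_inj (basU s)) => i; rewrite coord0; apply/eqP/negPn/negP.
    exact: h.
  have := coord_row R (basU k) j j; rewrite -/n0 z coord0 eqxx => /eqP.
  by rewrite eq_sym oner_eq0.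
have iI : i \in idx s by apply: contraNT cn0 => /(n0s i).2 ->.
have e0 : dot w' (toR R (row i (bas s))) = 0.
  have /(_ i isT)/eqP := psumr_eq0P (fun i _ => term_ge0 i) sum0.
  by rewrite mulf_eq0 (negPf cn0) => /eqP.
have : (val s `&` [set x | val k x /\ dot w x = 0])%classic (toR R (row i (bas s))).
  by rewrite capE; split=> //; exact: row_in_cone.
move=> [_ /rhoE]; set t := crd k _ j => et.
have tpos : 0 <= t.
  have : (val s `&` [set x | val k x /\ dot w x = 0])%classic (toR R (row i (bas s))).
    by rewrite capE; split=> //; exact: row_in_cone.
  by move=> [_ [/in_cone/(_ j)[]]].
have h1 : t * crd s (toR R n0) i = 1.
  by rewrite -coordZ -et coord_row // eqxx.
exists i => //; apply: (@toR_inj R); rewrite et.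
move: h1 tpos; rewrite /t !coord_int; set a := (_ *m _) 0 j; set b := (_ *m _) 0 i.
move=> h1; rewrite ler0z => a0.
have ab : a * b = 1 by apply/eqP; rewrite -(eqr_int R) intrM; apply/eqP.
have /eqP := congr1 absz ab; rewrite abszM muln_eq1 => /andP[/eqP a1 _].
have -> : a = 1 by lia.
by rewrite scale1r.
Qed.


Lemma row_is_ray s i : i \in idx s -> exists2 r, r \in raysf s & vecf r = row i (bas s).
Proof.
move=> iI; have nr : row i (bas s) \in rayseq by apply/rayseqP; exists s, i.
exists (SeqSub nr) => //; rewrite inE; apply/asboolP; exact: row_in_cone.
Qed.

Let duf s r : 'rV[int]_d :=
  if [pick i | (i \in idx s) && (vecf r == row i (bas s))] is Some i
  then (col i (invmx (bas s)))^T else 0.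

Lemma row_inj s i j : row i (bas s) = row j (bas s) -> i = j.
Proof.
move=> e; have := coord_row R (basU s) j i; rewrite e coord_row // eqxx.
by case: eqP => [->//|_ /eqP]; rewrite oner_eq0.
Qed.

Lemma dufE s r i : i \in idx s -> vecf r = row i (bas s) ->
  duf s r = (col i (invmx (bas s)))^T.
Proof.
move=> iI e; rewrite /duf; case: pickP => [j /andP[jI /eqP ej]|/(_ i)]; last by rewrite iI e eqxx.
by congr ((col _ _)^T); apply: (@row_inj s); rewrite -ej -e.
Qed.

Lemma dot_duf s r i x : i \in idx s -> vecf r = row i (bas s) ->
  dot (toR R (duf s r)) x = crd s x i.
Proof. by move=> iI e; rewrite (dufE iI e) coord_dot. Qed.

Lemma vecf_inj : injective vecf. Proof. exact: val_inj. Qed.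

Lemma duf_vec s r t : r \in raysf s -> t \in raysf s -> ev (duf s r) (vecf t) = (r == t)%:Z.
Proof.
move=> /ray_is_row[i iI ei] /ray_is_row[j jI ej]; apply/eqP.
rewrite -(eqr_int R) -dot_toR (dot_duf _ iI ei) ej coord_row //.
have -> : (r == t) = (j == i).
  apply/eqP/eqP => [rt|ji]; last by apply: vecf_inj; rewrite ei ej ji.
  by apply: (@row_inj s); rewrite -ei -ej rt.
by case: eqP.
Qed.

Lemma expand_rays s x : (forall i, i \notin idx s -> crd s x i = 0) ->
  x = \sum_(r in raysf s) dot (toR R (duf s r)) x *: toR R (vecf r).
Proof.
move=> xI; apply: (coord_inj (basU s)) => i; rewrite coord_sum.
case: (boolP (i \in idx s)) => iI; last first.
  rewrite xI // big1 // => r /ray_is_row[j jI ej]; rewrite coordZ ej coord_row //.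
  by case: eqP => [ji|_]; [move: iI; rewrite -ji jI|rewrite mulr0].
have [r rs er] := row_is_ray iI.
rewrite (bigD1 r) //= big1 ?addr0 => [|t /andP[/ray_is_row[j jI ej] tr]].
  by rewrite coordZ er coord_row // eqxx mulr1 (dot_duf _ iI er).
rewrite coordZ ej coord_row //; case: eqP => [ji|_]; last by rewrite mulr0.
by case/eqP: tr; apply: vecf_inj; rewrite ej er ji.
Qed.

Lemma card_raysf s : #|raysf s| = #|idx s|.
Proof.
pose f r := [pick i | (i \in idx s) && (vecf r == row i (bas s))].
have fE r i : i \in idx s -> vecf r = row i (bas s) -> f r = Some i.
  move=> iI e; rewrite /f; case: pickP => [j /andP[jI /eqP ej]|/(_ i)]; last by rewrite iI e eqxx.
  by congr Some; apply: (@row_inj s); rewrite -ej -e.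
rewrite -(card_in_imset (f := f)); last first.
  move=> r t /ray_is_row[i iI ei] /ray_is_row[j jI ej].
  rewrite (fE _ _ iI ei) (fE _ _ jI ej) => -[ij].
  by apply: vecf_inj; rewrite ei ej ij.
rewrite -(card_imset (mem (idx s)) (@Some_inj _)); apply: eq_card => o.
apply/imsetP/imsetP => [[r /ray_is_row[i iI ei] ->]|[i iI ->]].
  by exists i => //; exact: fE.
by have [r rs er] := row_is_ray iI; exists r => //; rewrite (fE _ _ iI er).
Qed.

Lemma fan_data_of_bases : inhabited (fan_data Sigma).
Proof.
have [_ fc cap] := fanS.
constructor; apply: (@FanData R d Sigma (seq_sub rayseq) vecf duf).
- exact: vecf_inj.
- exact: duf_vec.
- move=> s x; split=> [sx|[c [c0 cs ->]]].
    have sxI := (in_cone s x).1 sx.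
    exists (fun r => if r \in raysf s then dot (toR R (duf s r)) x else 0); split.
    + move=> r; case: ifP => // /ray_is_row[i iI ei]; rewrite (dot_duf _ iI ei).
      exact: (sxI i).1.
    + by move=> r /negPf; rewrite /raysf => ->.
    + rewrite {1}(expand_rays (fun i => (sxI i).2)) big_mkcond; apply/eq_bigr => r _.
      by rewrite /raysf; case: ifP => //; rewrite scale0r.
  rewrite valE; apply: cone_hull_sum => r _; rewrite -valE.
  case: (boolP (r \in raysf s)) => rs; last first.
    by rewrite cs // scale0r valE; exact: cone_hull0.
  rewrite valE; apply: cone_hullZ => //; rewrite -valE.
  by move: rs; rewrite inE => /asboolP.
- move=> s S sS.
  (* The face with set of rays S is the zero locus of the sum of the dual vectors outside S. *)
  pose w : 'rV[R]_d := \sum_(r in raysf s :\: S) toR R (duf s r).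
  have w_ge0 x : val s x -> forall r, r \in raysf s -> 0 <= dot (toR R (duf s r)) x.
    move=> /in_cone xs r /ray_is_row[i iI ei]; rewrite (dot_duf _ iI ei).
    exact: (xs i).1.
  have wface : face [set x | val s x /\ dot w x = 0]%classic (val s).
    exists w => // x xs; rewrite /w dot_suml; apply: sumr_ge0 => r.
    by rewrite inE => /andP[_]; exact: w_ge0.
  exists [` fc _ _ (valP s) wface ]%fset; apply/setP => r; rewrite inE /=.
  have wr : r \in raysf s -> dot w (toR R (vecf r)) = (r \notin S)%:R.
    move=> rs; rewrite /w dot_suml.
    under eq_bigr => t.
      rewrite inE => /andP[_ ts]; rewrite dot_toR duf_vec //; over.
    case: (boolP (r \in S)) => rS /=.
      rewrite big1 // => t; rewrite inE; case: eqP => [->|//].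
      by rewrite rS.
    rewrite (bigD1 r) /=; last by rewrite finset.in_setD rS rs.
    rewrite eqxx big1 ?addr0 // => t /andP[_ /negPf ->].
    by [].
  apply/asboolP/idP => [[rs e]|rS].
    have rs' : r \in raysf s by rewrite inE; apply/asboolP.
    move: e; rewrite wr //; case: (r \in S) => //= /eqP; by rewrite oner_eq0.
  have rs := subsetP sS r rS; split; last by rewrite wr // rS.
  by move: rs; rewrite inE => /asboolP.
- move=> s t; have [f _] := cap _ _ (valP s) (valP t).
  by exists [` fc _ _ (valP s) f ]%fset.
- move=> s; rewrite -[#|_|]/(#|raysf s|) card_raysf => ns.
  have /subsetPn[i _ iI] : ~~ (setT \subset idx s).
    apply: contra ns => sT; have -> : idx s = setT by apply/eqP; rewrite -subTset.
    by rewrite cardsT card_ord.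
  exists (col i (invmx (bas s)))^T.
    apply/eqP => z; have := coord_row R (basU s) i i; rewrite coord_dot z eqxx.
    by rewrite -[X in dot X]/(toR R 0) dot_toR ev0l => /eqP; rewrite eq_sym oner_eq0.
  move=> r /ray_is_row[j jI ej]; apply/eqP; rewrite -(eqr_int R) -dot_toR -coord_dot.
  rewrite -[vecf r]/(vecf r) ej coord_row //; case: (eqVneq j i) => // ji; move: iI; by rewrite -ji jI.
- move=> s; rewrite -[#|_|]/(#|raysf s|) card_raysf => sd x; apply: expand_rays => i.
  have -> : idx s = setT.
    by apply/eqP; rewrite eqEcard subsetT cardsT card_ord sd leqnn.
  by rewrite inE.
Qed.

End FanDataExists.

Lemma fan_data_exists (R : realType) (d : nat) (Sigma : {fset set 'rV[R]_d}) :
  fan Sigma -> unimodular Sigma -> inhabited (fan_data Sigma).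
Proof.
move=> fS uS.
have /choice[bas] (s : Sigma) : exists B : 'M[int]_d, B \in unitmx /\
    exists I : {set 'I_d}, val s = cone_hull [seq toR R (row i B) | i <- enum I].
  by have [B BU [I e]] := uS _ (valP s); exists B; split=> //; exists I.
move=> h; have /choice[idx idxP] (s : Sigma) := (h s).2.
exact: (fan_data_of_bases fS (fun s => (h s).1) idxP).
Qed.

(** * Complete fans and generic directions *)

Section FanCombinatorics.
Variables (R : realType) (d : nat) (Sigma : {fset set 'rV[R]_d}) (F : fan_data Sigma).
Local Notation ray := (ray F).
Local Notation vec := (@vec R d Sigma F).
Local Notation rays := (@rays R d Sigma F).
Local Notation du := (@du R d Sigma F).
Implicit Types (s t k tau : Sigma) (r : ray) (x xi : 'rV[R]_d).

Local Notation crd s r x := (dot (toR R (du s r)) x).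

Lemma in_rays s r : (r \in rays s) = `[< val s (toR R (vec r)) >].
Proof. by rewrite inE. Qed.

Lemma crd_ray s r r' : r \in rays s -> r' \in rays s -> crd s r (toR R (vec r')) = (r == r')%:R.
Proof. by move=> rs ts; rewrite dot_toR du_vec //; case: eqP. Qed.

Lemma crd_sum s (I : {set ray}) (c : ray -> R) r : r \in rays s -> I \subset rays s ->
  crd s r (\sum_(q in I) c q *: toR R (vec q)) = if r \in I then c r else 0.
Proof.
move=> rs /subsetP Is; rewrite dot_sumr.
have tE q : q \in I -> crd s r (c q *: toR R (vec q)) = c q * (r == q)%:R.
  by move=> /Is qs; rewrite dotZr crd_ray.
rewrite (eq_bigr _ tE); case: ifPn => rI.
  rewrite (bigD1 r) //= eqxx mulr1 big1 ?addr0 // => q /andP[_ /negPf qr].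
  by rewrite eq_sym qr mulr0.
rewrite big1 // => q qI; case: (eqVneq r q) => [rq|_]; last by rewrite mulr0.
by move: rI; rewrite rq qI.
Qed.

Lemma coneP s x : val s x <-> exists c : ray -> R, (forall r, r \in rays s -> 0 <= c r) /\
  x = \sum_(r in rays s) c r *: toR R (vec r).
Proof.
split=> [/(cone_gen F)[c [c0 cs ->]]|[c [c0 ->]]].
  exists c; split=> [r rs|]; first exact: c0.
  rewrite [RHS]big_mkcond; apply/eq_bigr => r _; case: ifPn => // rs.
  by rewrite cs // scale0r.
apply/(cone_gen F); exists (fun r => if r \in rays s then c r else 0); split.
- by move=> r; case: ifP => // /c0.
- by move=> r /negPf ->.
- rewrite big_mkcond; apply/eq_bigr => r _; by case: ifP; rewrite ?scale0r.
Qed.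

Lemma cone_crd s x : val s x ->
  (forall r, r \in rays s -> 0 <= crd s r x) /\
  x = \sum_(r in rays s) crd s r x *: toR R (vec r).
Proof.
move=> /coneP[c [c0 ->]].
have cE r : r \in rays s -> crd s r (\sum_(q in rays s) c q *: toR R (vec q)) = c r.
  by move=> rs; rewrite crd_sum // rs.
split=> [r rs|]; first by rewrite cE // c0.
by apply/eq_bigr => r rs; rewrite cE.
Qed.

Lemma rays_subP s t : (rays s \subset rays t) <-> (val s `<=` val t)%classic.
Proof.
split=> [st x /coneP[c [c0 ->]]|st].
  apply/coneP; exists (fun r => if r \in rays s then c r else 0); split.
    by move=> r _; case: ifP => // /c0.
  rewrite [LHS]big_mkcond [RHS]big_mkcond /=; apply/eq_bigr => r _.
  case: ifPn => rs; first by rewrite (subsetP st).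
  by rewrite scale0r; case: ifP.
apply/subsetP => r; rewrite [_ \in rays s]in_rays [_ \in rays t]in_rays.
by move=> /asboolP /st rt; apply/asboolP.
Qed.

Lemma rays_inj : injective rays.
Proof.
move=> s t e; apply/val_inj/seteqP.
by split; apply/rays_subP; rewrite e.
Qed.

Lemma rays_cap s t w : val w = (val s `&` val t)%classic -> rays w = rays s :&: rays t.
Proof.
move=> e; apply/setP => r; rewrite in_setI [LHS]in_rays e.
rewrite [_ \in rays s]in_rays [_ \in rays t]in_rays.
apply/asboolP/andP => [[a b]|[/asboolP a /asboolP b]]; last by split.
by split; apply/asboolP.
Qed.

(** The point lies in the common face, which is spanned by the shared rays; uniqueness of
    coordinates in s leaves no positive coordinate at any other ray. *)
Lemma relint_sub s t (c : ray -> R) : (forall r, r \in rays s -> 0 < c r) ->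
  val t (\sum_(r in rays s) c r *: toR R (vec r)) -> rays s \subset rays t.
Proof.
move=> c0 tx; have [w we] := capS F s t; have wE := rays_cap we.
have ws : rays w \subset rays s by rewrite wE subsetIl.
have /coneP[b [b0 e]] : val w (\sum_(r in rays s) c r *: toR R (vec r)).
  by rewrite we; split=> //; apply/coneP; exists c; split=> // r /c0/ltW.
apply/subsetP => r rs; apply/negPn/negP => rt.
have := congr1 (dot (toR R (du s r))) e; rewrite !crd_sum // rs wE inE rs (negPf rt) /=.
by move=> z; have := c0 r rs; rewrite z ltxx.
Qed.

Lemma card_rays_le s : (#|rays s| <= d)%N.
Proof.
pose V r := toR R (vec r).
have iV : indep V (rays s).
  move=> l ls e r; case: (boolP (r \in rays s)) => rs; last exact: ls.
  have := congr1 (dot (toR R (du s r))) e.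
  have -> : comb V l = \sum_(r in rays s) l r *: toR R (vec r).
    rewrite [RHS]big_mkcond; apply/eq_bigr => q _; case: ifPn => // qs.
    by rewrite ls // scale0r.
  by rewrite crd_sum // rs dot0r.
by have /eqP <- := indep_row_free iV; exact: rank_leq_col.
Qed.

Definition ismax s := #|rays s| == d.

Lemma max_sub k t : ismax k -> rays k \subset rays t -> k = t.
Proof.
move=> /eqP kd kt; apply: rays_inj; apply/eqP.
by rewrite eqEcard kt kd card_rays_le.
Qed.

Lemma max_cone k x : ismax k -> val k x <-> forall r, r \in rays k -> 0 <= crd k r x.
Proof.
move=> /eqP km; split=> [/cone_crd[]//|h].
by rewrite (max_expand km x); apply/coneP; exists (fun r => crd k r x).
Qed.

(** The first condition decides every sign in an expansion along xi; the second keeps xi out of the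
    span of each non-maximal cone, so that small displacements along xi end in maximal cones. *)
Definition generic_dir xi :=
  (forall s r, r \in rays s -> crd s r xi != 0) /\
  (forall s, ~~ ismax s -> exists w : 'rV[R]_d,
     (forall r, r \in rays s -> dot w (toR R (vec r)) = 0) /\ dot w xi != 0).

Lemma generic_dirN xi : generic_dir xi -> generic_dir (- xi).
Proof.
have dN u x : dot u (- x) = - dot u x :> R by rewrite -scaleN1r dotZr mulN1r.
move=> [a b]; split=> [s r rs|s sm]; first by rewrite dN oppr_eq0 a.
by have [w [w1 w2]] := b s sm; exists w; rewrite dN oppr_eq0.
Qed.

Lemma generic_dir_exists : exists xi, generic_dir xi.
Proof.
have /choice[w wP] s : exists w : 'rV[int]_d, ~~ ismax s ->
    w != 0 /\ forall r, r \in rays s -> ev w (vec r) = 0.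
  case: (boolP (ismax s)) => sm; first by exists 0.
  by have [w w0 wr] := nonmax sm; exists w.
pose good (p : Sigma * option ray) :=
  if p.2 is Some r then r \in rays p.1 else ~~ ismax p.1.
pose c (p : {p | good p}) (j : 'I_d) : R :=
  (if (val p).2 is Some r then toR R (du (val p).1 r) else toR R (w (val p).1)) 0 j.
have [|v [_ vP]] := @generic_weights R 'I_d {p | good p} c.
  have nz (y : 'rV[R]_d) : y != 0 -> exists j, y 0 j != 0.
    move=> y0; apply: contrapT => /forallNP h; move/eqP: y0; apply.
    apply/rowP => j; rewrite mxE; apply/eqP/negPn/negP; exact: h.
  move=> [[s [r|]] /= gp]; apply: nz.
    apply/eqP => z; have := crd_ray gp gp; rewrite z dotC dot0r eqxx => /eqP.
    by rewrite eq_sym oner_eq0.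
  have [w0 _] := wP s gp; apply: contra w0 => /eqP z; apply/eqP/(@toR_inj R).
  by rewrite z; apply/rowP => j; rewrite !mxE.
exists (\row_j v j); split=> [s r rs|s sm].
  have := vP (exist good (s, Some r) rs); rewrite /c /= dotE.
  by under [X in _ -> is_true (X != _)]eq_bigr do rewrite [in X in _ * X]mxE.
exists (toR R (w s)); split=> [r rs|]; first by rewrite dot_toR (wP s sm).2.
have := vP (exist good (s, None) sm); rewrite /c /= dotE.
by under [X in _ -> is_true (X != _)]eq_bigr do rewrite [in X in _ * X]mxE.
Qed.

(** The maximal cone k contains x + t xi for x in the relative interior of tau and small t > 0. *)
Definition star_rel xi tau k :=
  [&& ismax k, rays tau \subset rays k &
      [forall r in rays k :\: rays tau, 0 < crd k r xi]].

Hypothesis compl : complete Sigma.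

Lemma small_pos (K : finType) (e : K -> R) : (forall j : K, 0 < e j) ->
  exists2 t0 : R, 0 < t0 & forall j : K, t0 < e j.
Proof.
move=> e0; have s0 : 0 <= \sum_k (e k)^-1 by apply: sumr_ge0 => k _; rewrite invr_ge0 ltW.
have S0 : 0 < 1 + \sum_k (e k)^-1 by lra.
exists (1 + \sum_k (e k)^-1)^-1; first by rewrite invr_gt0.
move=> k; rewrite -[e k]invrK ltf_pV2 ?posrE ?invr_gt0 //.
rewrite (bigD1 k) //=.
have : 0 <= \sum_(i | i != k) (e i)^-1 by apply: sumr_ge0 => i _; rewrite invr_ge0 ltW.
lra.
Qed.

(** As there are finitely many cones, one of them contains [x + t0 *: xi] for arbitrarily small
    [t0]. Two such points would put xi in the span of the cone if it were not maximal, and in the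
    limit x itself lies in the cone. *)
Lemma star_exists xi tau : generic_dir xi -> exists k, star_rel xi tau k.
Proof.
move=> [gen1 gen2].
pose x := \sum_(r in rays tau) 1 *: toR R (vec r) : 'rV[R]_d.
have [k kP] : exists k, forall e : R, 0 < e -> exists t0 : R, [/\ 0 < t0, t0 < e & val k (x + t0 *: xi)].
  apply: contrapT => /forallNP h.
  have /choice[e eP] k : exists e : R, 0 < e /\ forall t0 : R, 0 < t0 -> t0 < e -> ~ val k (x + t0 *: xi).
    have /existsNP[e] := h k; move=> /not_implyP[e0 ne]; exists e; split=> // t t0 te kt.
    by apply: ne; exists t.
  have [t t0 tP] := small_pos (fun k => (eP k).1).
  have [k kS kx] := compl (x + t *: xi).
  exact: ((eP [` kS]%fset).2 t t0 (tP _) kx).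
have km : ismax k.
  apply/negPn/negP => nm; have [w [wr wxi]] := gen2 k nm.
  have wk y : val k y -> dot w y = 0.
    move=> /coneP[c [_ ->]]; rewrite dot_sumr big1 // => r rk.
    by rewrite dotZr wr // mulr0.
  have [t1 [t10 _ /wk]] := kP 1 ltr01.
  have [t2 [t20 t21 /wk]] := kP t1 t10.
  rewrite !dotDr !dotZr => e2 e1.
  have /eqP : (t1 - t2) * dot w xi = 0 by lra.
  by rewrite mulf_eq0 (negPf wxi) orbF subr_eq0 => /eqP e; move: t21; rewrite e ltxx.
have x0 r : r \in rays k -> 0 <= crd k r x.
  move=> rk; rewrite leNgt; apply/negP => xr.
  have D0 : 0 < 1 + `|crd k r xi| by rewrite ltr_pwDl.
  have [|t [t0 te /(max_cone _ km)/(_ r rk)]] := kP (- crd k r x / (1 + `|crd k r xi|)).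
    by rewrite divr_gt0 // oppr_gt0.
  rewrite dotDr dotZr; move: te; rewrite ltr_pdivlMr // mulrDr mulr1.
  have := ler_wpM2l (ltW t0) (ler_norm (crd k r xi)).
  lra.
have kx : val k x by apply/max_cone.
have tk : rays tau \subset rays k by apply: (relint_sub _ kx) => r _; exact: ltr01.
exists k; rewrite /star_rel km tk; apply/forall_inP => r; rewrite inE => /andP[rt rk].
have [t [t0 _ /(max_cone _ km)/(_ r rk)]] := kP 1 ltr01.
rewrite dotDr dotZr /x crd_sum // (negPf rt) add0r pmulr_rge0 // => h.
by rewrite lt_neqAle eq_sym gen1.
Qed.

(** A small displacement of x along xi is interior to k and lies in [k'], so [relint_sub]
    applies. *)
Lemma star_unique xi tau k k' : star_rel xi tau k -> star_rel xi tau k' -> k = k'.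
Proof.
move=> /and3P[km tk /forall_inP kP] /and3P[km' tk' /forall_inP kP'].
pose x := \sum_(r in rays tau) 1 *: toR R (vec r) : 'rV[R]_d.
have [t t0 tP] : exists2 t : R, 0 < t & forall l : bool * ray,
    t < (1 + `|crd (if l.1 then k else k') l.2 xi|)^-1.
  by apply: small_pos => l; rewrite invr_gt0 ltr_pwDl.
have pos s r : rays tau \subset rays s -> (forall q, q \in rays s :\: rays tau -> 0 < crd s q xi) ->
    r \in rays s -> t < (1 + `|crd s r xi|)^-1 -> 0 < crd s r (x + t *: xi).
  move=> ts sP rs tr; rewrite dotDr dotZr /x crd_sum //.
  case: ifPn => rt; last by rewrite add0r mulr_gt0 // sP // inE rt rs.
  have D0 : 0 < 1 + `|crd s r xi| by rewrite ltr_pwDl.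
  move: tr; rewrite -[X in _ < X -> _]mul1r ltr_pdivlMr // mulrDr mulr1.
  have : - (t * `|crd s r xi|) <= t * crd s r xi.
    by rewrite -mulrN; apply: (ler_wpM2l (ltW t0)); rewrite lerNl -normrN ler_norm.
  lra.
apply: (max_sub km).
have e := max_expand (eqP km) (x + t *: xi).
apply: (@relint_sub k k' (fun r => crd k r (x + t *: xi))).
  by move=> r rk; apply: pos => //; exact: (tP (true, r)).
rewrite -e; apply/max_cone => // r rk; apply/ltW/pos => //; exact: (tP (false, r)).
Qed.

Lemma sum_faces (A : zmodType) k (P : pred {set ray}) (G : {set ray} -> A) :
  \sum_(tau | (rays tau \subset rays k) && P (rays tau)) G (rays tau) =
  \sum_(S : {set ray} | (S \subset rays k) && P S) G S.
Proof.
have /choice[h hP] (S : {set ray}) : exists t, S \subset rays k -> rays t = S.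
  case: (boolP (S \subset rays k)) => Sk; last by exists k.
  by have [t tS] := face_rays Sk; exists t.
rewrite [RHS](reindex_onto rays h); last by move=> S /andP[/hP].
apply: eq_bigl => tau; case: (boolP (rays tau \subset rays k)) => //= tk.
by rewrite (rays_inj (hP _ tk)) eqxx andbT.
Qed.

Definition neg xi k := [set r in rays k | crd k r xi < 0].

(** Each maximal cone k collects the faces between [neg xi k] and k. With existence and uniqueness
    of k this partitions the fan into intervals, as in a Bialynicki-Birula decomposition. *)
Lemma star_relE xi tau k : generic_dir xi -> ismax k ->
  star_rel xi tau k = (rays tau \subset rays k) && (neg xi k \subset rays tau).
Proof.
move=> [gen _] km; rewrite /star_rel km /=; congr (_ && _).
apply/forall_inP/subsetP => h r; rewrite inE => /andP[a b].
  apply/negPn/negP => rt; have := h r; rewrite inE rt a => /(_ isT).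
  by rewrite ltNge (ltW b).
rewrite lt_neqAle eq_sym gen // leNgt; apply/negP => n.
by have := h r; rewrite inE b n (negPf a) => /(_ isT).
Qed.

(** On the interval of k the alternating sum factors over the rays, and a ray that may be left out
    contributes G - 1. For an indicator G this replaces a half-space by minus its complement. *)
Lemma sum_star_flip (A : comNzRingType) (G : Sigma -> ray -> A) sigma xi :
  generic_dir xi ->
  \sum_(tau | rays sigma \subset rays tau)
     \sum_(k | star_rel xi tau k) (-1) ^+ (d - #|rays tau|) * \prod_(r in rays tau) G k r =
  \sum_(k | ismax k && (rays sigma \subset rays k))
    \prod_(r in neg xi k :|: rays sigma) G k r *
    \prod_(r in rays k :\: (neg xi k :|: rays sigma)) (G k r - 1).
Proof.
move=> gxi; rewrite (exchange_big_dep ismax) /=; last by move=> tau k _ /and3P[].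
rewrite [LHS](bigID (fun k => rays sigma \subset rays k)) /= [X in _ + X]big1 ?addr0; last first.
  move=> k /andP[km nsk]; rewrite big_pred0 // => tau; rewrite star_relE //.
  apply/negbTE; apply: contra nsk => /and3P[a b _]; exact: subset_trans a b.
apply/eq_bigr => k /andP[km sk].
set N := neg xi k :|: rays sigma.
have Nk : N \subset rays k by rewrite subUset sk andbT /neg; apply/subsetP => r; rewrite inE => /andP[].
have NK : N :|: (rays k :\: N) = rays k by rewrite -{1}(setIidPr Nk) setID.
under eq_bigl do rewrite star_relE // andbCA -subUset.
rewrite (sum_faces k (fun S => _ \subset S)
   (fun S => (-1) ^+ (d - #|S|) * \prod_(r in S) G k r)).
have -> : \sum_(S : {set ray} | (S \subset rays k) && (rays sigma :|: neg xi k \subset S))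
    (-1) ^+ (d - #|S|) * \prod_(r in S) G k r =
  (-1) ^+ #|rays k| * \sum_(S : {set ray} | (N \subset S) && (S \subset N :|: (rays k :\: N)))
    (-1) ^+ #|S| * \prod_(r in S) (1 - (1 - G k r)).
  rewrite mulr_sumr; apply: eq_big => S.
    by rewrite NK andbC setUC.
  move=> /andP[Sk _]; rewrite mulrA -exprD -signr_odd -[in RHS]signr_odd.
  have cS := subset_leq_card Sk; rewrite oddB; last exact: leq_trans cS (card_rays_le k).
  rewrite oddD (eqP km); congr (_ * _); apply/eq_bigr => r _.
  by rewrite opprB addrC subrK.
rewrite sum_between_sets; last by rewrite disjoints_subset setCD subsetUr.
have -> : \prod_(x in N) (1 - (1 - G k x)) = \prod_(x in N) G k x.
  by apply/eq_bigr => r _; rewrite opprB addrC subrK.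
have -> : \prod_(r in rays k :\: N) (G k r - 1) =
    (-1) ^+ #|rays k :\: N| * \prod_(r in rays k :\: N) (1 - G k r).
  rewrite -prodr_const -big_split; apply/eq_bigr => r _ /=.
  by rewrite mulN1r opprB.
have -> : (-1) ^+ #|rays k :\: N| = (-1) ^+ #|rays k| * (-1) ^+ #|N| :> A.
  rewrite -exprD -signr_odd -[RHS]signr_odd cardsDS // oddB ?oddD //.
  exact: subset_leq_card.
by rewrite !mulrA; congr (_ * _); rewrite -[RHS]mulrA [RHS]mulrC.
Qed.

(** For G = 1 the term of k survives only when no ray can be left out, that is when
    [star_rel (- xi) sigma k] holds, and this happens for exactly one k. *)
Lemma sum_codim sigma :
  \sum_(tau | rays sigma \subset rays tau) (-1) ^+ (d - #|rays tau|) = 1 :> int.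
Proof.
have [xi gxi] := generic_dir_exists.
have -> : \sum_(tau | rays sigma \subset rays tau) (-1) ^+ (d - #|rays tau|) =
  \sum_(tau | rays sigma \subset rays tau)
     \sum_(k | star_rel xi tau k) (-1) ^+ (d - #|rays tau|) * \prod_(r in rays tau) 1 :> int.
  apply/eq_bigr => tau _; have [k kP] := star_exists tau gxi.
  rewrite (big_pred1 k) ?big1 ?mulr1 // => k' /=; apply/idP/eqP => [h|->//].
  exact: (star_unique h kP).
rewrite (sum_star_flip (fun _ _ => 1) sigma gxi).
have [k0 k0P] := star_exists sigma (generic_dirN gxi).
have [k0m k0s k0pos] := and3P k0P.
have negE k r : r \in rays k -> (r \in neg xi k) = (0 < crd k r (- xi)).
  move=> rk; rewrite inE rk -scaleN1r dotZr mulN1r oppr_gt0 //.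
rewrite (bigD1 k0) /=; last by rewrite k0m.
rewrite [X in _ + X]big1 ?addr0 => [|k /andP[/andP[km sk] kk0]]; last first.
  rewrite big1 // mul1r.
  have /subsetPn[r rk] : ~~ (rays k \subset neg xi k :|: rays sigma).
    apply: contra kk0 => h; apply/eqP/(star_unique _ k0P).
    rewrite /star_rel km sk; apply/forall_inP => r; rewrite in_setD => /andP[rs rk].
    by have := subsetP h r rk; rewrite in_setU (negPf rs) orbF negE.
  by move=> rN; rewrite (bigD1 r) /= ?in_setD ?rN ?rk // subrr mul0r.
rewrite big1 // mul1r big1 // => r.
rewrite in_setD in_setU negb_or -andbA => /and3P[rn rs rk].
by have /forall_inP/(_ r) := k0pos; rewrite in_setD rs rk -negE // (negPf rn) => /(_ isT).
Qed.

End FanCombinatorics.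

(** * Euler characteristics and localization *)

Section EulerCech.
Variables (R : realType) (K : fieldType) (d : nat) (Sigma : {fset set 'rV[R]_d}).
Variables (E : tsheaf R K d) (m : 'rV[int]_d).

Let C p := \sum_(A : simplex Sigma p) (sdim E (cone_meet (val A)) m)%:Z.

Lemma hdimE p : hdim Sigma E m p =
  C p - (\rank (cech_diff Sigma E m p))%:Z
  - (if p is q.+1 then (\rank (cech_diff Sigma E m q))%:Z else 0).
Proof.
rewrite /hdim mxrank_ker -subzn ?rank_leq_row //; congr (_ - _ - _); last by case: p.
rewrite (big_morph Posz PoszD (erefl _)) /C.
by rewrite -(big_enum_val (fun A : simplex Sigma p => (sdim E (cone_meet (val A)) m)%:Z)).
Qed.

Lemma sum_hdim n : \sum_(p < n) (-1) ^+ p * hdim Sigma E m p =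
  \sum_(p < n) (-1) ^+ p * C p +
  (if n is q.+1 then (-1) ^+ n * (\rank (cech_diff Sigma E m q))%:Z else 0).
Proof.
elim: n => [|n IH]; first by rewrite !big_ord0 addr0.
rewrite big_ord_recr IH [in RHS]big_ord_recr /= hdimE.
case: n IH => [|n] _; first by rewrite !big_ord0; ring.
rewrite !exprS; ring.
Qed.

(** Euler-Poincare: the ranks of the differentials cancel and the dimensions of the cochain spaces
    remain. *)
Lemma euler_coef_sum : euler_coef Sigma E m =
  \sum_(A : {set Sigma} | A != set0) (-1) ^+ #|A|.-1 * (sdim E (cone_meet A) m)%:Z.
Proof.
rewrite /euler_coef sum_hdim.
(* The last differential has target 0, since no simplex has more vertices than there are cones. *)
have -> : (if #|{: Sigma}| is q.+1
    then (-1) ^+ #|{: Sigma}| * (\rank (cech_diff Sigma E m q))%:Z else 0) = 0.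
  case nE : #|{: Sigma}| => [//|q].
  suff -> : \rank (cech_diff Sigma E m q) = 0%N by rewrite mulr0.
  apply/eqP; rewrite -leqn0; apply: leq_trans (rank_leq_col _) _.
  rewrite leqn0 sum_nat_eq0; apply/forallP => j; exfalso.
  have := valP (enum_val j); rewrite /= => /eqP e.
  by have := max_card (mem (val (enum_val j))); rewrite e nE ltnn.
rewrite addr0 [RHS](partition_big (fun A : {set Sigma} => inord #|A|.-1 : 'I_(#|{: Sigma}|.+1)) predT) //=.
rewrite big_ord_recr /= [X in _ + X]big_pred0 ?addr0 => [|A]; last first.
  apply/negbTE/negP => /andP[A0 /eqP e].
  have leA : (#|A| <= #|{: Sigma}|)%N by exact: max_card.
  have := congr1 val e; rewrite /= inordK; last by rewrite ltnS (leq_trans (leq_pred _)).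
  move: A0 leA; rewrite -card_gt0 => A0; rewrite -(prednK A0) => lt e'.
  by move: e' lt => /= ->; rewrite ltnn.
apply/eq_bigr => p _; rewrite /C mulr_sumr.
rewrite [RHS](eq_bigl (fun A : {set Sigma} => #|A| == p.+1)); last first.
  move=> A; have leA : (#|A| <= #|{: Sigma}|)%N by exact: max_card.
  have pl := ltn_ord p.
  rewrite -[X in _ && X](inj_eq val_inj) /= inordK; last by rewrite ltnS (leq_trans (leq_pred _)).
  by rewrite -card_gt0; case: #|A|.
rewrite [RHS](reindex_omap (val : simplex Sigma p -> {set Sigma}) insub); last first.
  by move=> A pA; rewrite insubT.
apply: eq_big => [A|A _]; last by rewrite (eqP (valP A)).
by case: A => A pA /=; rewrite insubT /= pA eqxx.
Qed.

End EulerCech.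

Section EulerFan.
Variables (R : realType) (K : fieldType) (d : nat) (Sigma : {fset set 'rV[R]_d}) (F : fan_data Sigma).
Hypothesis compl : complete Sigma.
Local Notation ray := (ray F).
Local Notation rays := (@rays R d Sigma F).

Lemma cone_meet_in (A : {set Sigma}) : A != set0 -> exists t : Sigma, val t = cone_meet A.
Proof.
have [n] := ubnP #|A|; elim: n A => // n IH A; rewrite ltnS => leA A0.
have /set0Pn[k kA] := A0.
have [A1|A1] := eqVneq (A :\ k) set0.
  exists k; apply/seteqP; split=> [x kx k' k'A|x /(_ k kA)//].
  suff -> : k' = k by [].
  apply/eqP; have := in_set0 k'; rewrite -A1 in_setD1 k'A andbT => /negbT.
  by rewrite negbK.
have [|t te] := IH (A :\ k) _ A1; first by move: leA; rewrite (cardsD1 k) kA.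
have [w we] := capS F k t; exists w; rewrite we te; apply/seteqP; split=> x.
  move=> [kx mx] k' k'A; have [->//|kk'] := eqVneq k' k.
  by apply: mx; rewrite in_setD1 kk'.
move=> h; split; first exact: h.
by move=> k'; rewrite in_setD1 => /andP[_ /h].
Qed.

Lemma sum_proper_subsets (T : finType) (U : {set T}) : U != set0 ->
  \sum_(A : {set T} | (A != set0) && (A \subset U)) (-1) ^+ #|A|.-1 = 1 :> int.
Proof.
move=> /set0Pn[u uU].
have dj : [disjoint set0 & U] by rewrite disjoints_subset sub0set.
have := @sum_between_sets int T (fun=> 0) set0 U dj.
have -> : \prod_(x in U) 0 = 0 :> int by rewrite (bigD1 u) //= mul0r.
rewrite mulr0.
rewrite (bigD1 set0) /=; last by rewrite !sub0set.
rewrite cards0 expr0 mul1r big_set0.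
move=> /eqP; rewrite addrC addr_eq0 => /eqP e.
apply: oppr_inj; rewrite -[RHS]e -sumrN; apply: eq_big => A.
  by rewrite sub0set set0U /= andbC.
rewrite -card_gt0 => /andP[A0 _]; rewrite big1 ?mulr1 => [|x]; last by rewrite subr0.
by rewrite -[in RHS](prednK A0) exprS mulN1r.
Qed.

(** Let [mu t] be the signed count of the sets of cones with intersection t. By inclusion-exclusion
    its sum over the cones containing t is 1. By [sum_codim] the sign of the codimension obeys the
    same recursion, so the two agree by induction on the codimension. *)
Lemma moebius (H : set 'rV[R]_d -> int) :
  \sum_(A : {set Sigma} | A != set0) (-1) ^+ #|A|.-1 * H (cone_meet A) =
  \sum_(tau : Sigma) (-1) ^+ (d - #|rays tau|) * H (val tau).
Proof.
have /choice[tA tAP] (A : {set Sigma}) : exists t : option Sigma, A != set0 ->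
    if t is Some t then val t = cone_meet A else False.
  case: (boolP (A == set0)) => A0; first by exists None.
  by have [t te] := cone_meet_in A0; exists (Some t).
pose mu t := \sum_(A : {set Sigma} | (A != set0) && (tA A == Some t)) (-1) ^+ #|A|.-1 : int.
have tA_some A : A != set0 -> exists2 t, tA A = Some t & val t = cone_meet A.
  by move=> /tAP; case: (tA A) => // t; exists t.
have muS : forall G : Sigma -> int, \sum_t mu t * G t =
    \sum_(A : {set Sigma} | A != set0) (-1) ^+ #|A|.-1 * (if tA A is Some t then G t else 0).
  move=> G; rewrite /mu; under eq_bigr do rewrite mulr_suml.
  rewrite (exchange_big_dep (fun A : {set Sigma} => A != set0)) /=; last by move=> t A _ /andP[].
  apply/eq_bigr => A A0; have [t te _] := tA_some A A0.
  rewrite te A0 /= (big_pred1 t) // => t'; by rewrite (inj_eq Some_inj) eq_sym.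
have muE n t : (d - #|rays t| < n)%N -> mu t = (-1) ^+ (d - #|rays t|).
  elim: n t => // n IH t; rewrite ltnS => len.
  have h1 : \sum_(t' | rays t \subset rays t') mu t' = 1.
    rewrite -[RHS](@sum_proper_subsets _ [set k | rays t \subset rays k]); last first.
      by apply/set0Pn; exists t; rewrite inE.
    have -> : \sum_(t' | rays t \subset rays t') mu t' =
        \sum_t' mu t' * (rays t \subset rays t')%:R.
      by rewrite big_mkcond; apply/eq_bigr => t' _; case: ifP; rewrite ?mulr1 ?mulr0.
    rewrite muS [RHS]big_mkcondr; apply/eq_bigr => A A0.
    have [t' -> te] := tA_some A A0.
    have -> : (rays t \subset rays t') = (A \subset [set k | rays t \subset rays k]).
      apply/idP/subsetP => [/rays_subP h k kA|h].
        by rewrite inE; apply/rays_subP => x /h; rewrite te; apply.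
      apply/rays_subP => x tx; rewrite te => k /h; rewrite inE => /rays_subP; exact.
    by case: ifP; rewrite ?mulr1 ?mulr0.
  have h2 := sum_codim F compl t.
  move: h1 h2; rewrite (bigD1 t) //= => h1; rewrite (bigD1 t) //= => h2.
  apply: (addIr (\sum_(i | (rays t \subset rays i) && (i != t)) mu i)).
  rewrite h1 -[LHS]h2; congr (_ + _); apply/esym/eq_bigr => t' /andP[tt' nt].
  apply: IH; have : (#|rays t| < #|rays t'|)%N.
    apply: proper_card; rewrite properEneq tt' andbT.
    by apply: contra nt => /eqP/rays_inj ->.
  by have := card_rays_le F t'; lia.
have -> : \sum_(tau : Sigma) (-1) ^+ (d - #|rays tau|) * H (val tau) = \sum_t mu t * H (val t).
  by apply/eq_bigr => t _; rewrite (muE _ t (ltnSn _)).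
by rewrite muS; apply/eq_bigr => A A0; have [t -> <-] := tA_some A A0.
Qed.

Lemma euler_coefE (E : tsheaf R K d) m : euler_coef Sigma E m =
  \sum_(tau : Sigma) (-1) ^+ (d - #|rays tau|) * (sdim E (val tau) m)%:Z.
Proof. by rewrite euler_coef_sum (moebius (fun c => (sdim E c m)%:Z)). Qed.

End EulerFan.

(** Some term of the Leibniz expansion of the determinant is nonzero. *)
Lemma det_neq0_perm (K : fieldType) n (A B : 'M[K]_n) : A *m B = 1%:M ->
  exists s : 'S_n, forall i, A i (s i) != 0.
Proof.
move=> AB; have dA : \det A != 0.
  have := congr1 determinant AB; rewrite det_mulmx det1 => /eqP; apply: contraTneq => ->.
  by rewrite mul0r eq_sym oner_eq0.
apply: contrapT => /forallNP h; move/eqP: dA; apply; rewrite /determinant big1 // => s _.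
have [i /negP] := (existsNP _).2 (h s).
by rewrite negbK => /eqP e; rewrite (bigD1 i) //= e mul0r mulr0.
Qed.

(* The displacements are nonnegative and sum to 0, because s and t are bijective. *)
Lemma perm_sum_eq (R : numDomainType) n (f g : 'I_n -> R) (s t : 'S_n) :
  (forall i, 0 <= f i - g (s i)) -> (forall i, 0 <= g i - f (t i)) ->
  forall i, f i = g (s i).
Proof.
move=> fg gf i.
have e : \sum_i (f i - g (s i)) + \sum_i (g i - f (t i)) = 0.
  have gs : \sum_i g (s i) = \sum_i g i by rewrite [RHS](reindex_inj (@perm_inj _ s)).
  have ft : \sum_i f (t i) = \sum_i f i by rewrite [RHS](reindex_inj (@perm_inj _ t)).
  rewrite !sumrB gs ft.
  by rewrite addrC addrA subrK subrr.
have a : 0 <= \sum_i (f i - g (s i)) by apply: sumr_ge0.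
have b : 0 <= \sum_i (g i - f (t i)) by apply: sumr_ge0.
have /eqP z : \sum_i (f i - g (s i)) == 0.
  by move: e => /eqP; rewrite paddr_eq0 // => /andP[].
have /(_ i isT)/eqP := psumr_eq0P (fun i _ => fg i) z.
by rewrite subr_eq0 => /eqP.
Qed.

Lemma dot_delta (R : realType) d (u : 'rV[R]_d) j : dot u (delta_mx 0 j) = u 0 j.
Proof. by rewrite /dot trmx_delta -colE mxE. Qed.

Lemma toR0 (R : realType) d : toR R (0 : 'rV[int]_d) = 0.
Proof. by apply/rowP => l; rewrite !mxE. Qed.

Lemma prodD1_comm (A : comNzRingType) (I : finType) (P : pred I) (f : I -> A) k : P k ->
  \prod_(i | P i) f i = \prod_(i | P i && (i != k)) f i * f k.
Proof. by move=> Pk; rewrite (bigD1 k) //= mulrC. Qed.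

Lemma mulr_rearrange (A : comNzRingType) (a b c w : A) : a * (b * c) * w = (a * b * w) * c.
Proof. by rewrite mulrA mulrAC. Qed.

Lemma prod_setD (A : comNzRingType) (I : finType) (f : I -> A) (S T : {set I}) : S \subset T ->
  \prod_(i in T) f i = \prod_(i in S) f i * \prod_(i in T :\: S) f i.
Proof.
move=> ST; rewrite (big_setID S) /=; congr (_ * _).
by apply: eq_bigl => r; rewrite (setIidPr ST).
Qed.

Section Bundles.
Variables (R : realType) (K : fieldType) (d : nat) (Sigma : {fset set 'rV[R]_d}) (F : fan_data Sigma).
Local Notation ray := (ray F).
Local Notation vec := (@vec R d Sigma F).
Local Notation rays := (@rays R d Sigma F).
Local Notation du := (@du R d Sigma F).
Implicit Types (s t k tau : Sigma) (m : 'rV[int]_d).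

Lemma ev_ge0_dot m r : (0 <= dot (toR R m) (toR R (vec r))) = (0 <= ev m (vec r)).
Proof. by rewrite dot_toR ler0z. Qed.

Lemma dual_monoidE s m : dual_monoid (val s) m <-> forall r, r \in rays s -> 0 <= ev m (vec r).
Proof.
split=> [h r rs|h x /coneP].
  by rewrite -ev_ge0_dot; apply: h; move: rs; rewrite in_rays => /asboolP.
move=> /(_ F)[c [c0 ->]]; rewrite dot_sumr; apply: sumr_ge0 => r rs.
by rewrite dotZr mulr_ge0 ?c0 // ev_ge0_dot h.
Qed.

Lemma perpE s m : perp (val s) m <-> forall r, r \in rays s -> ev m (vec r) = 0.
Proof.
split=> [h r rs|h x /coneP].
  apply/eqP; rewrite -(eqr_int R) -dot_toR; apply/eqP; apply: h.
  by move: rs; rewrite in_rays => /asboolP.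
move=> /(_ F)[c [c0 ->]]; rewrite dot_sumr big1 // => r rs.
by rewrite dotZr dot_toR h // mulr0.
Qed.

(** Nonzero entries of the transition matrix and of its inverse give bijections between the two
    frames, one each way, along which no weight increases on the rays of tau. By [perm_sum_eq]
    nothing decreases either. *)
Lemma vbundle_compat (E : vbundle R K d) k tau : is_vbundle Sigma E ->
  (val tau `<=` val k)%classic ->
  exists p : 'S_#|vidx E|, forall i r, r \in rays tau ->
    ev (vwt E (val k) (enum_val i)) (vec r) = ev (vwt E (val tau) (enum_val (p i))) (vec r).
Proof.
move=> [vE _ _ vinv] tk.
have [c [cE c1 c2]] := vinv _ _ (valP k) (valP tau) tk.
pose A := \matrix_(i < #|vidx E|, j < #|vidx E|) vtrans E (val k) (val tau) (enum_val i) (enum_val j).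
pose B := \matrix_(i < #|vidx E|, j < #|vidx E|) c (enum_val i) (enum_val j).
have eqI (i j : 'I_#|vidx E|) : (enum_val i == enum_val j) = (i == j).
  by rewrite (inj_eq enum_val_inj).
have AB : A *m B = 1%:M.
  apply/matrixP => i j; rewrite !mxE -eqI -c1 [RHS]big_enum_val.
  by apply/eq_bigr => l _; rewrite !mxE.
have BA : B *m A = 1%:M.
  apply/matrixP => i j; rewrite !mxE -eqI -c2 [RHS]big_enum_val.
  by apply/eq_bigr => l _; rewrite !mxE.
have [p pP] := det_neq0_perm AB; have [q qP] := det_neq0_perm BA.
exists p => i r rt.
apply: (perm_sum_eq (f := fun i => ev (vwt E (val k) (enum_val i)) (vec r))
  (g := fun i => ev (vwt E (val tau) (enum_val i)) (vec r)) (s := p) (t := q)) => l.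
  rewrite -evNl -evDl; apply: ((dual_monoidE tau _).1 _ r rt).
  apply: (vE (val k) (val tau)) => //; [exact: valP|exact: valP|].
  by have := pP l; rewrite mxE.
rewrite -evNl -evDl; apply: ((dual_monoidE tau _).1 _ r rt).
by apply: cE; have := qP l; rewrite mxE.
Qed.

Definition local_ind (sigma : Sigma) (r : ray) m : int :=
  (if r \in rays sigma then ev m (vec r) == 0 else 0 <= ev m (vec r))%:R.

Lemma local_prod sigma tau m : rays sigma \subset rays tau ->
  \prod_(r in rays tau) local_ind sigma r m =
  `[< dual_monoid (val tau) m /\ perp (val sigma) m >]%:R.
Proof.
move=> st; case: asboolP => [[/dual_monoidE dm /perpE pm]|h].
  by rewrite big1 // => r rt; rewrite /local_ind; case: ifP => [/pm->|_]; rewrite ?eqxx ?dm.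
apply/eqP; rewrite -[_ == _]negbK prodf_seq_neq0; apply/negP => /allP g; apply: h.
have gr r : r \in rays tau -> (if r \in rays sigma then ev m (vec r) == 0 else 0 <= ev m (vec r)).
  move=> rt; have := g r (mem_index_enum _); rewrite rt /local_ind /=.
  by case: (if _ then _ else _).
split.
  apply/dual_monoidE => r rt; have := gr r rt; case: ifP => // _ /eqP ->.
  exact: lexx.
by apply/perpE => r rs; have := gr r (subsetP st r rs); rewrite rs => /eqP.
Qed.

(** The frame over tau is replaced by that of a larger cone k, so that all faces in the interval of
    k use the same weights. *)
Lemma sdim_tensor (E : vbundle R K d) sigma tau k m : is_vbundle Sigma E ->
  (rays tau \subset rays k) ->
  (sdim (stensor E (orbit_closure_sheaf K (val sigma))) (val tau) m)%:Z =
  if rays sigma \subset rays tau then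
    \sum_(i : vidx E) \prod_(r in rays tau) local_ind sigma r (m - vwt E (val k) i)
  else 0.
Proof.
move=> vE tk; rewrite /= (big_morph Posz PoszD (erefl _)).
case: ifPn => [st|nst]; last first.
  rewrite big1 // => i _; case: asboolP => // -[/rays_subP a _ _].
  by rewrite a in nst.
have [p pP] := vbundle_compat vE ((rays_subP F tau k).1 tk).
rewrite (reindex_inj (@perm_inj _ p)) /= [RHS]big_enum_val.
apply/eq_bigr => i _; rewrite local_prod //.
rewrite -[LHS]natz; congr (_%:R); congr nat_of_bool; apply: asbool_equiv_eq.
have e r : r \in rays tau -> ev (m - vwt E (val tau) (enum_val (p i))) (vec r) =
    ev (m - vwt E (val k) (enum_val i)) (vec r).
  by move=> rt; rewrite !evDl !evNl pP.
split=> [[_ /dual_monoidE a /perpE b]|[/dual_monoidE a /perpE b]]; split.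
- by apply/dual_monoidE => r rt; rewrite -e // a.
- by apply/perpE => r rs; rewrite -e ?b ?(subsetP st).
- exact: (rays_subP F sigma tau).1 st.
- by apply/dual_monoidE => r rt; rewrite e // a.
- by apply/perpE => r rs; rewrite e ?b ?(subsetP st).
Qed.

Lemma expand_max k m : ismax F k -> m = \sum_(r in rays k) du k r *~ ev m (vec r).
Proof.
move=> /eqP km; apply: (@toR_inj R); apply/rowP => j.
have e := max_expand km.
have {}e x : dot (toR R m) x = dot (toR R (\sum_(r in rays k) du k r *~ ev m (vec r))) x.
  rewrite [in LHS](e x) dot_sumr.
  have -> : toR R (\sum_(r in rays k) du k r *~ ev m (vec r)) =
     \sum_(r in rays k) (ev m (vec r))%:~R *: toR R (du k r).
    rewrite (big_morph _ (@toRD R d) (@toR0 R d)).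
    by apply/eq_bigr => r _; apply/rowP => l; rewrite -scaler_int !mxE rmorphM intz.
  rewrite dot_suml; apply/eq_bigr => r _; rewrite dotZr dot_toR mulrC.
  by rewrite [RHS]dotC dotZr [dot x _]dotC.
by have := e (delta_mx 0 j); rewrite !dot_delta.
Qed.

Lemma ev_sum_du s (I : {set ray}) (c : ray -> int) r : I \subset rays s -> r \in rays s ->
  ev (\sum_(q in I) du s q *~ c q) (vec r) = if r \in I then c r else 0.
Proof.
move=> Is rs; rewrite ev_suml.
have tE q : q \in I -> ev (du s q *~ c q) (vec r) = if q == r then c q else 0.
  by move=> /(subsetP Is) qs; rewrite evMzl du_vec //; case: eqP; rewrite ?mul1r ?mul0r.
rewrite (eq_bigr _ tE); case: ifPn => rI.
  by rewrite (bigD1 r) //= eqxx big1 ?addr0 // => q /andP[_ /negPf ->].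
rewrite big1 // => q qI; case: eqP => // qr; by rewrite -qr qI in rI.
Qed.

Lemma zindep_du k (S : {set ray}) : S \subset rays k -> zindep (du k) S.
Proof.
move=> /subsetP Sk l ls e r; case: (boolP (r \in S)) => rS; last exact: ls.
have := congr1 (fun m => ev m (vec r)) e; rewrite ev0l /zcomb ev_suml (bigD1 r) //=.
rewrite evMzl du_vec ?Sk // eqxx mul1r big1 ?addr0 // => t tr; rewrite evMzl.
case: (boolP (t \in S)) => tS; last by rewrite ls // mulr0.
by rewrite du_vec ?Sk // (negPf tr) mul0r.
Qed.

(** Outside N the factor [local_ind sigma r m - 1] is minus the indicator of a negative coordinate,
    so the product is the cone with these directions reversed. *)
Lemma cone_ind_flip k sigma (N : {set ray}) m : ismax F k ->
  rays sigma \subset N -> N \subset rays k ->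
  \prod_(r in N) local_ind sigma r m * \prod_(r in rays k :\: N) (local_ind sigma r m - 1) =
  (-1) ^+ #|rays k :\: N| * cone_ind (du k) (rays k :\: rays sigma) (rays k :\: N) m.
Proof.
move=> km sN Nk; have sk := subset_trans sN Nk.
have loc_out r : r \in rays k :\: N -> local_ind sigma r m - 1 = - ((ev m (vec r) < 0)%R)%:R.
  rewrite in_setD => /andP[rN rk]; rewrite /local_ind.
  have -> : (r \in rays sigma) = false by apply: contraNF rN => /(subsetP sN).
  by rewrite ltNge; case: (0 <= _).
rewrite (eq_bigr _ loc_out).
have -> : \prod_(r in rays k :\: N) - ((ev m (vec r) < 0)%R)%:R =
    (-1) ^+ #|rays k :\: N| * \prod_(r in rays k :\: N) ((ev m (vec r) < 0)%R)%:R :> int.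
  rewrite -prodr_const -big_split; apply/eq_bigr => r _ /=; by rewrite mulN1r.
rewrite mulrCA; congr (_ * _).
rewrite /cone_ind; case: asboolP => [[l [ls <- lP]]|no].
  have evl r : r \in rays k -> ev (zcomb (du k) l) (vec r) = l r.
    move=> rk; rewrite /zcomb ev_suml (bigD1 r) //= evMzl du_vec // eqxx mul1r.
    rewrite big1 ?addr0 // => t tr; rewrite evMzl.
    case: (boolP (t \in rays k)) => tk; first by rewrite du_vec // (negPf tr) mul0r.
    by rewrite ls ?mulr0 // in_setD negb_and tk orbT.
  rewrite big1 => [|r rN].
    rewrite big1 ?mulr1 // => r; rewrite in_setD => /andP[rN rk]; rewrite evl //.
    have := lP r; rewrite !in_setD rN rk andbT; case: (boolP (r \in rays sigma)) => rs.
      by rewrite (subsetP sN) in rN.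
    by move=> /(_ isT) /= ->.
  rewrite /local_ind evl ?(subsetP Nk) //; case: ifPn => rs.
    by rewrite ls ?eqxx // in_setD rs.
  by have := lP r; rewrite !in_setD rs rN (subsetP Nk) //= => /(_ isT) ->.
apply/eqP/negPn/negP; rewrite mulf_eq0 negb_or !prodf_seq_neq0 => /andP[/allP a /allP b].
have aN r : r \in N -> if r \in rays sigma then ev m (vec r) == 0 else 0 <= ev m (vec r).
  move=> rN; have := a r (mem_index_enum _); rewrite rN /local_ind /=.
  by case: (if _ then _ else _).
have bN r : r \in rays k :\: N -> ev m (vec r) < 0.
  by move=> rN; have := b r (mem_index_enum _); rewrite rN /=; case: (_ < _).
apply: no; exists (fun r => if r \in rays k :\: rays sigma then ev m (vec r) else 0); split.
- by move=> r /negPf ->.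
- rewrite [RHS](expand_max m km) [RHS]big_mkcond; apply/eq_bigr => r _.
  rewrite in_setD; case: (boolP (r \in rays k)) => rk; rewrite ?andbF ?mulr0z // andbT.
  case: (boolP (r \in rays sigma)) => rs //=; rewrite mulr0z.
  have := aN r (subsetP sN r rs); rewrite rs => /eqP ->; by rewrite mulr0z.
- move=> r rks; rewrite rks; move: rks; rewrite !in_setD => /andP[rs rk]; rewrite rk andbT.
  case: (boolP (r \in N)) => rN /=; last by apply: bN; rewrite in_setD rN.
  by have := aN r rN; rewrite (negPf rs).
Qed.


Hypothesis compl : complete Sigma.

(** The expansion of the product of 1/(1 - e^(u_(k,r))), r in k outside sigma, in which all
    exponents pair nonpositively with xi ([flipped_dir]). *)
Definition flipped xi sigma k m : int :=
  (-1) ^+ #|rays k :\: (neg F xi k :|: rays sigma)| *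
  cone_ind (du k) (rays k :\: rays sigma) (rays k :\: (neg F xi k :|: rays sigma)) m.

(** Each tau in the Cech sum is computed in the frame of the maximal cone that xi assigns to it;
    then the sum over each interval factors. *)
Lemma euler_tensor (E : vbundle R K d) sigma xi m : is_vbundle Sigma E -> generic_dir F xi ->
  euler_coef Sigma (stensor E (orbit_closure_sheaf K (val sigma))) m =
  \sum_(k | ismax F k && (rays sigma \subset rays k)) \sum_(i : vidx E)
     flipped xi sigma k (m - vwt E (val k) i).
Proof.
move=> vE gxi; rewrite (euler_coefE F compl).
transitivity (\sum_(i : vidx E) \sum_(tau | rays sigma \subset rays tau)
   \sum_(k | star_rel F xi tau k) (-1) ^+ (d - #|rays tau|) *
     \prod_(r in rays tau) local_ind sigma r (m - vwt E (val k) i)).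
  rewrite exchange_big /= [RHS]big_mkcond; apply/eq_bigr => tau _.
  have [k kP] := star_exists compl tau gxi.
  have tk : rays tau \subset rays k by case/and3P: kP.
  rewrite (sdim_tensor _ _ vE tk); case: ifP => st; last by rewrite mulr0.
  rewrite mulr_sumr; apply/eq_bigr => i _; rewrite (big_pred1 k) // => k' /=.
  by apply/idP/eqP => [h|->//]; exact: (star_unique h kP).
rewrite [RHS]exchange_big /=; apply/eq_bigr => i _.
rewrite (sum_star_flip (fun k r => local_ind sigma r (m - vwt E (val k) i)) sigma gxi).
apply/eq_bigr => k /andP[km sk]; rewrite /flipped cone_ind_flip ?subsetUr //.
by rewrite subUset sk andbT; apply/subsetP => r; rewrite inE => /andP[].
Qed.

Lemma flipped_dir xi sigma k m : flipped xi sigma k m != 0 -> dot (toR R m) xi <= 0.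
Proof.
rewrite /flipped mulf_eq0 negb_or => /andP[_].
rewrite /cone_ind; case: asboolP => // -[l [ls <- lP]] _.
rewrite /zcomb (big_morph _ (@toRD R d) (@toR0 R d)) dot_suml.
apply: sumr_le0 => r _.
have -> : toR R (du k r *~ l r) = (l r)%:~R *: toR R (du k r).
  by apply/rowP => j; rewrite -scaler_int !mxE rmorphM intz.
rewrite dotC dotZr [dot xi _]dotC.
case: (boolP (r \in rays k :\: rays sigma)) => rks; last by rewrite ls // mul0r.
have := lP r rks; move: rks; rewrite in_setD => /andP[rs rk].
rewrite in_setD in_setU (negPf rs) orbF rk andbT inE rk /= -leNgt.
case: (leP 0 (dot (toR R (du k r)) xi)) => h l0.
  by rewrite mulr_le0_ge0 // lerz0 ltW.
by rewrite mulr_ge0_le0 // ?ler0z // ltW.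
Qed.

Definition ray_prod k (S : {set ray}) : RT d := \prod_(r in S) (1 - chi (du k r)).
Definition loc sigma k : RT d :=
  if rays sigma \subset rays k then ray_prod k (rays sigma) else 0.
Definition cofactor_max k : RT d := \prod_(k' | ismax F k' && (k' != k)) ray_prod k' (rays k').
Definition denom : RT d := \prod_(k | ismax F k) ray_prod k (rays k).
Definition bundle_at (E : vbundle R K d) k : RT d := \sum_(i : vidx E) chi (vwt E (val k) i).

Lemma du_neq0 k r : r \in rays k -> du k r != 0.
Proof.
move=> rk; apply/eqP => z; have := du_vec rk rk; rewrite z ev0l eqxx.
by [].
Qed.

Lemma ray_prod_regular k (S : {set ray}) : S \subset rays k -> regular (ray_prod k S).
Proof. by move=> /subsetP Sk; apply: regular_prod => r /Sk/du_neq0/regular_chi. Qed.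

Lemma denom_regular : regular denom.
Proof. by apply: regular_prod => k _; exact: ray_prod_regular. Qed.

Lemma denomE k : ismax F k -> denom = cofactor_max k * ray_prod k (rays k).
Proof. exact: prodD1_comm. Qed.

Lemma ray_prodU k (S T : {set ray}) : S \subset T ->
  ray_prod k T = ray_prod k S * ray_prod k (T :\: S).
Proof.
exact: prod_setD.
Qed.

Lemma act_flipped xi sigma k m : rays sigma \subset rays k ->
  act (ray_prod k (rays k :\: rays sigma)) (flipped xi sigma k) m = delta0 m.
Proof.
move=> sk; rewrite /flipped act_mulzr.
have zi : zindep (du k) (rays k :\: rays sigma) by apply: zindep_du; exact: subsetDl.
rewrite (act_cone (@eq_act d) (@actD d) (@act_addr d) (@act1 d) (@actM d) (@act_chi d) _ _ zi).
have -> : (rays k :\: rays sigma) :&: (rays k :\: (neg F xi k :|: rays sigma)) =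
    rays k :\: (neg F xi k :|: rays sigma).
  by apply/setIidPr/setDS; exact: subsetUr.
exact: signrMK.
Qed.

Lemma act_delta0 a m : act a (@delta0 _) m = a@_m.
Proof.
transitivity (act a (fun p => (1 : RT d)@_p) m); last by rewrite act_coef mulr1.
by apply: eq_act => p; rewrite coef1 /delta0 eq_sym.
Qed.

Lemma act_denom_euler (E : vbundle R K d) sigma m : is_vbundle Sigma E ->
  act denom (euler_coef Sigma (stensor E (orbit_closure_sheaf K (val sigma)))) m =
  (\sum_(k | ismax F k) cofactor_max k * loc sigma k * bundle_at E k)@_m.
Proof.
move=> vE; have [xi gxi] := generic_dir_exists F.
rewrite (eq_act _ (fun p => euler_tensor sigma p vE gxi)) act_sumr.
rewrite raddf_sum /= [RHS](bigID (fun k => rays sigma \subset rays k)) /=.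
rewrite [X in _ + X]big1 ?addr0 => [|k /andP[_ /negPf nsk]]; last first.
  by rewrite /loc nsk mulr0 mul0r mcoeff0.
apply/eq_bigr => k /andP[km sk]; rewrite act_sumr /loc sk /bundle_at mulr_sumr raddf_sum /=.
apply/eq_bigr => i _; set w := vwt E (val k) i.
transitivity (act denom (act (chi w) (flipped xi sigma k)) m).
  by apply: eq_act => p; rewrite act_chi.
have e : denom * chi w = cofactor_max k * ray_prod k (rays sigma) * chi w *
    ray_prod k (rays k :\: rays sigma).
  rewrite (denomE km) (ray_prodU k sk); exact: mulr_rearrange.
transitivity (act (denom * chi w) (flipped xi sigma k) m); first exact/esym/actM.
rewrite e; etransitivity; first exact: actM.
rewrite -act_delta0; apply: eq_act => p; exact: act_flipped.
Qed.

End Bundles.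

(** * Finite support from bounded support in a direction *)

Section Strips.
Variables (R : realType) (d : nat) (xi : 'rV[R]_d).
Implicit Types (phi : 'rV[int]_d -> int) (m u : 'rV[int]_d).

Local Notation ht m := (dot (toR R m) xi).

Definition in_strip phi := exists C : R, forall m, phi m != 0 -> `|ht m| <= C.

Lemma htD m u : ht (m + u) = ht m + ht u.
Proof. by rewrite toRD dotDl. Qed.

Lemma htN m : ht (- m) = - ht m.
Proof. by rewrite toRN dotNl. Qed.

Lemma htMn m n : ht (m *+ n) = ht m *+ n.
Proof.
elim: n => [|n IH]; last by rewrite !mulrS htD IH.
by rewrite !mulr0n toR0 dotC dot0r.
Qed.

Lemma in_strip_act (a : RT d) phi : in_strip phi -> in_strip (act a phi).
Proof.
move=> [C hC]; exists (C + \sum_(p <- msupp a) `|ht p|) => m am.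
have [p pa pm] : exists2 p, p \in msupp a & phi (m - p) != 0.
  apply: contrapT => h; move/eqP: am; apply; rewrite /act big_seq big1 // => p pa.
  have [->|np] := eqVneq (phi (m - p)) 0; first by rewrite mulr0.
  by case: h; exists p.
have -> : m = (m - p) + p by rewrite subrK.
rewrite htD; apply: le_trans (ler_normD _ _) _; apply: lerD; first exact: hC.
rewrite (big_fsetD1 p) //= lerDl; exact: sumr_ge0.
Qed.

Lemma geom_chi u K : (\sum_(i < K) chi u ^+ i) * (1 - chi u) = 1 - chi (u *+ K) :> RT d.
Proof.
have -> : chi (u *+ K) = chi u ^+ K.
  elim: K => [|K IH]; first by rewrite mulr0n expr0 chi0.
  by rewrite mulrS chiD IH exprS.
have h (A : comNzRingType) (x : A) : (\sum_(i < K) x ^+ i) * (1 - x) = 1 - x ^+ K.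
  by rewrite -[RHS]opprB subrX1 mulrC -mulNr opprB.
exact: h.
Qed.

(** A geometric sum telescopes the hypothesis to the finitely supported function phi m - phi (m - K
    u). For large K the two points cannot both lie in the strip, so this equals phi m wherever phi m
    is nonzero. *)
Lemma finite_of_act_chi u phi (b : RT d) : ht u != 0 -> in_strip phi ->
  (forall m, act (1 - chi u) phi m = b@_m) -> exists a : RT d, forall m, a@_m = phi m.
Proof.
move=> u0 [C hC] hb.
have [K hK] : exists K : nat, C + C < `|ht u| *+ K.
  exists (Num.truncn ((C + C) / `|ht u|)).+1.
  by rewrite -mulr_natr mulrC -ltr_pdivrMr ?normr_gt0 // truncnS_gt.
apply: (@coef_finite _ _ ((\sum_(i < K) chi u ^+ i) * b)) => m pm.
have e : act (1 - chi (u *+ K)) phi m = ((\sum_(i < K) chi u ^+ i) * b)@_m.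
  rewrite -geom_chi; etransitivity; first exact: actM.
  by rewrite -act_coef; apply: eq_act.
rewrite -mcoeff_neq0 -e actD act1 actN act_chi.
have -> : phi (m - u *+ K) = 0; last by rewrite subr0.
apply/eqP; apply: contraT => /hC; rewrite htD htN htMn => h2; have h1 := hC m pm.
have : `|ht u *+ K| <= C + C.
  have -> : ht u *+ K = ht m - (ht m - ht u *+ K) by rewrite opprB addrC subrK.
  by apply: le_trans (ler_normB _ _) (lerD h1 h2).
by rewrite normrMn leNgt hK.
Qed.

Lemma finite_of_act_prod (us : seq 'rV[int]_d) phi (b : RT d) :
  (forall u, u \in us -> ht u != 0) -> in_strip phi ->
  (forall m, act (\prod_(u <- us) (1 - chi u)) phi m = b@_m) ->
  exists a : RT d, forall m, a@_m = phi m.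
Proof.
elim: us phi b => [|u us IH] phi b hus hphi hb.
  by exists b => m; rewrite -hb big_nil act1.
have [|m|c hc] := finite_of_act_chi (phi := act (\prod_(u <- us) (1 - chi u)) phi) (b := b)
   (hus u (mem_head u us)).
- exact: in_strip_act.
- by rewrite -hb big_cons; exact/esym/actM.
apply: (IH phi c) => // w wus; apply: hus; by rewrite in_cons wus orbT.
Qed.

End Strips.

Section Localization.
Variables (R : realType) (K : fieldType) (d : nat) (Sigma : {fset set 'rV[R]_d}) (F : fan_data Sigma).
Local Notation ray := (ray F).
Local Notation rays := (@rays R d Sigma F).
Local Notation du := (@du R d Sigma F).
Hypothesis compl : complete Sigma.

(* chiT is a choice among the elements of Z[M] with given coefficients, so it is 0 unless the Euler
   characteristic has finite support: its support is bounded in every generic direction, and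
   becomes finite after multiplication by denom F. *)
Lemma euler_in_strip (E : vbundle R K d) (sigma : Sigma) xi : is_vbundle Sigma E -> generic_dir F xi ->
  in_strip xi (euler_coef Sigma (stensor E (orbit_closure_sheaf K (val sigma)))).
Proof.
move=> vE gxi; pose C (k : Sigma) : R := \sum_(i : vidx E) `|dot (toR R (vwt E (val k) i)) xi|.
(* A one-sided bound from the expansion in the direction [eta], used for xi and for [- xi]. *)
have side eta m : generic_dir F eta -> (forall (k : Sigma) i, dot (toR R (vwt E (val k) i)) eta <= C k) ->
    euler_coef Sigma (stensor E (orbit_closure_sheaf K (val sigma))) m != 0 ->
    dot (toR R m) eta <= \sum_k C k.
  move=> geta hC; rewrite (euler_tensor compl _ _ vE geta) => h.
  have [k [i fki]] : exists (k : Sigma) i, flipped F eta sigma k (m - vwt E (val k) i) != 0.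
    apply: contrapT => no; move/eqP: h; apply; apply: big1 => k _; apply: big1 => i _.
    apply/eqP/negPn/negP => f0; apply: no; by exists k, i.
  have := flipped_dir fki; rewrite htD htN subr_le0 => le.
  apply: le_trans le _; apply: le_trans (hC k i) _.
  rewrite (bigD1 k) //= lerDl; apply: sumr_ge0 => k' _; exact: sumr_ge0.
have Cge (k : Sigma) i : `|dot (toR R (vwt E (val k) i)) xi| <= C k.
  by rewrite /C (bigD1 i) //= lerDl; exact: sumr_ge0.
exists (\sum_k C k) => m em; rewrite ler_norml; apply/andP; split; last first.
  apply: side => // k i; apply: le_trans (Cge k i); exact: ler_norm.
have dN (x : 'rV[R]_d) : dot x (- xi) = - dot x xi by rewrite dotC dotNl dotC.
rewrite lerNl -dN; apply: side => //; first exact: generic_dirN.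
move=> k i; rewrite dN; apply: le_trans (Cge k i); rewrite -normrN; exact: ler_norm.
Qed.

Theorem localization (E : vbundle R K d) (sigma : Sigma) : is_vbundle Sigma E ->
  denom F * chiT Sigma (stensor E (orbit_closure_sheaf K (val sigma))) =
  \sum_(k | ismax F k) cofactor_max F k * loc F sigma k * bundle_at E k.
Proof.
move=> vE; have [xi gxi] := generic_dir_exists F.
pose phi := euler_coef Sigma (stensor E (orbit_closure_sheaf K (val sigma))); set rhs := \sum_(k | _) _.
pose us := [seq du p.1 p.2 | p <- enum [pred p : Sigma * ray | ismax F p.1 && (p.2 \in rays p.1)]].
have dE : denom F = \prod_(u <- us) (1 - chi u).
  rewrite /us big_map big_enum /= /denom /ray_prod.
  by rewrite pair_big_dep.
have [a ha] : exists a : RT d, forall m, a@_m = phi m.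
  apply: (@finite_of_act_prod R d xi us phi rhs).
  - move=> u /mapP[p]; rewrite mem_enum => /andP[_ pr] ->; exact: (gxi.1 _ _ pr).
  - exact: euler_in_strip.
  - move=> m; rewrite -dE; exact: act_denom_euler.
have -> : chiT Sigma (stensor E (orbit_closure_sheaf K (val sigma))) = a.
  rewrite /chiT; have := @xgetPex _ 0 [set b : RT d | forall m, b@_m = phi m]%classic (ex_intro _ a ha).
  by move=> /= h; apply/malgP => m; rewrite h ha.
apply/malgP => m; rewrite -act_coef -act_denom_euler //; exact: eq_act.
Qed.

End Localization.

(** * Pairs of cones meeting generically *)

Section GenericDims.
Variables (R : realType) (d : nat) (Sigma : {fset set 'rV[R]_d}) (F : fan_data Sigma).
Local Notation ray := (ray F).
Local Notation vec := (@vec R d Sigma F).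
Local Notation rays := (@rays R d Sigma F).
Local Notation du := (@du R d Sigma F).
Local Notation rv := (fun r : ray => toR R (vec r)).
Implicit Types (s t : Sigma) (x y : 'rV[R]_d).

Definition ray_mx s : 'M[R]_(#|rays s|, d) := mx_of rv (rays s).

Lemma ray_mx_free s : row_free (ray_mx s).
Proof.
apply: indep_row_free => l ls e r; case: (boolP (r \in rays s)) => rs; last exact: ls.
have := congr1 (dot (toR R (du s r))) e.
have -> : comb rv l = \sum_(r in rays s) l r *: toR R (vec r).
  rewrite [RHS]big_mkcond; apply/eq_bigr => q _; case: ifPn => // qs.
  by rewrite ls // scale0r.
by rewrite crd_sum // rs dot0r.
Qed.

Lemma sub_ray_mx s x : (x <= ray_mx s)%MS <->
  exists c : ray -> R, x = \sum_(r in rays s) c r *: toR R (vec r).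
Proof.
split=> [/submxP[u ->]|[c ->]]; last first.
  apply: summx_sub => r rs; apply: scalemx_sub.
  have -> : toR R (vec r) = row (enum_rank_in rs r) (ray_mx s).
    by rewrite rowK enum_rankK_in.
  exact: row_sub.
exists (fun r => \sum_(i < #|rays s| | enum_val i == r) u 0 i).
rewrite mulmx_sum_row [RHS]big_enum_val; apply/eq_bigr => i _; rewrite rowK; congr (_ *: _).
by rewrite (bigD1 i) //= big1 ?addr0 // => j /andP[/eqP/enum_val_inj -> /eqP].
Qed.

Lemma cone_sub_ray_mx s x : val s x -> (x <= ray_mx s)%MS.
Proof. by move=> /(coneP F)[c [_ e]]; apply/sub_ray_mx; exists c. Qed.

Lemma cone_ray s r : r \in rays s -> val s (toR R (vec r)).
Proof. by rewrite in_rays => /asboolP. Qed.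

Lemma cone_zero s : val s 0.
Proof.
apply/(coneP F); exists (fun=> 0); split=> //; rewrite big1 // => r _.
by rewrite scale0r.
Qed.

Lemma set_dimE s : set_dim (val s) = #|rays s|.
Proof.
apply/eqP; rewrite eqn_leq; apply/andP; split.
  apply/bigmax_leqP => n /asboolP[B [fB dB]].
  move: fB; rewrite /row_free => /eqP <-; rewrite -(eqP (ray_mx_free s)).
  apply: mxrankS; apply/row_subP => i; have [x sx [y sy <-]] := dB i.
  apply: addmx_sub; first exact: cone_sub_ray_mx.
  by rewrite eqmx_opp; exact: cone_sub_ray_mx.
have lt : (#|rays s| < d.+1)%N by rewrite ltnS card_rays_le.
apply: (leq_bigmax_cond (Ordinal lt)); apply/asboolP; exists (ray_mx s).
split=> [|i]; first exact: ray_mx_free.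
exists (toR R (vec (enum_val i))); first by apply: cone_ray; exact: enum_valP.
by exists 0; [exact: cone_zero | rewrite subr0 rowK].
Qed.

Lemma lin_span_differences s x : (x <= ray_mx s)%MS -> lin_span (differences (val s)) x.
Proof.
move=> /submxP[u ->]; exists #|rays s|, (fun i => u 0 i), (fun i => row i (ray_mx s)).
split=> [i|]; last exact: mulmx_sum_row.
exists (toR R (vec (enum_val i))); first by apply: cone_ray; exact: enum_valP.
by exists 0; [exact: cone_zero | rewrite subr0 rowK].
Qed.

Variable v : 'rV[R]_d.
Hypothesis gen : sufficiently_generic Sigma v.

(** Near a common point of the relative interiors, the intersection contains small vectors in every
    direction of the common span. The dimension condition thus bounds the common span from above,
    and a dimension count shows that the two spans fill N_R. *)
Lemma generic_full s t : (shift (val s) v `&` val t !=set0)%classic ->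
  forall w, exists a b : ray -> R,
    w = \sum_(r in rays s) a r *: toR R (vec r) + \sum_(r in rays t) b r *: toR R (vec r).
Proof.
move=> /(gen (valP s) (valP t))[[y [[x0 [sx0 [e1 e10 x0e]] x0y] [ty [e2 e20 ye]]]] dimQ].
set cap := (ray_mx s :&: ray_mx t)%MS.
pose B := row_base cap.
(* A scale at which a basis of the common span stays inside both neighbourhoods of the chosen
   point. *)
have [eps eps0 epsP] : exists2 eps : R, 0 < eps & forall p : 'I_(\rank cap) * 'I_d,
    eps < Num.min e1 e2 / (1 + `|B p.1 p.2|).
  by apply: small_pos => p; rewrite divr_gt0 ?lt_min ?e10 // ltr_pwDl.
have Bsmall i j : `|eps * B i j| < Num.min e1 e2.
  have := epsP (i, j); rewrite ltr_pdivlMr ?ltr_pwDl // mulrDr mulr1 normrM (gtr0_norm eps0) /=.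
  lra.
have rowB i : (eps *: row i B <= cap)%MS.
  by apply: scalemx_sub; rewrite -(eq_row_base cap) row_sub.
have entryE (z : 'rV[R]_d) i j : (z + eps *: row i B) 0 j - z 0 j = eps * B i j.
  by rewrite mxE addrC addKr mxE [row _ _ _ _]mxE.
have Qd : forall i, differences (shift (val s) v `&` val t)%classic (row i (eps *: B)).
  move=> i; exists (y + eps *: row i B).
    split.
      exists (x0 + eps *: row i B); last by rewrite -x0y addrAC.
      apply: x0e.
        rewrite addrC addKr; apply: lin_span_differences.
        by apply: submx_trans (rowB i) _; exact: capmxSl.
      move=> j; have := Bsmall i j; rewrite lt_min => /andP[h _].
      by rewrite entryE.
    apply: ye.
      rewrite addrC addKr; apply: lin_span_differences.
      by apply: submx_trans (rowB i) _; exact: capmxSr.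
    move=> j; have := Bsmall i j; rewrite lt_min => /andP[_ h].
    by rewrite entryE.
  exists y; first by split=> //; exists x0.
  by rewrite addrC addKr; apply/rowP => j; rewrite !mxE.
have capd : (\rank cap < d.+1)%N by rewrite ltnS rank_leq_col.
have le : (\rank cap <= set_dim (shift (val s) v `&` val t)%classic)%N.
  apply: (leq_bigmax_cond (Ordinal capd)); apply/asboolP; exists (eps *: B); split=> //.
  rewrite /row_free (eqmx_scale B (lt0r_neq0 eps0)); exact: row_base_free.
move=> w; have : (w <= ray_mx s + ray_mx t)%MS.
  apply: submx_full; rewrite /row_full eqn_leq rank_leq_col /=.
  have := mxrank_sum_cap (ray_mx s) (ray_mx t); rewrite -/cap.
  have := ray_mx_free s; have := ray_mx_free t; rewrite /row_free => /eqP -> /eqP ->.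
  move: le; move: dimQ; rewrite !set_dimE; lia.
move=> /sub_addsmxP[[u1 u2] /= ->].
have /sub_ray_mx[a ->] := submxMl u1 (ray_mx s).
by have /sub_ray_mx[b ->] := submxMl u2 (ray_mx t); exists a, b.
Qed.

End GenericDims.

Section FiniteIndex.
Variables (R : realType) (d : nat).

(** Some d of the rows form a matrix C of nonzero determinant, and the adjugate puts [\det C] times
    every vector in H. Residues modulo [\det C] then represent all classes. *)
Lemma full_rank_index (H : set 'rV[int]_d) n (G : 'M[int]_(n, d)) :
  H 0 -> (forall a b, H a -> H b -> H (a + b)) -> (forall a, H a -> H (- a)) ->
  (forall i, H (row i G)) -> row_full (map_mx intr G : 'M[R]_(n, d)) ->
  finite_index H.
Proof.
move=> H0 HD HN HG fG.
have HMn a k : H a -> H (a *+ k).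
  by move=> Ha; elim: k => [|k IH]; rewrite ?mulr0n // mulrS; exact: HD.
have HMz a (c : int) : H a -> H (a *~ c).
  by move=> Ha; case: c => k; rewrite /intmul; [|apply: HN]; exact: HMn.
pose C : 'M[int]_d := rowsub (fullrankfun fG) G.
have dC : \det C != 0.
  have : (map_mx intr C : 'M[R]_d) \in unitmx.
    rewrite map_mxsub; exact: fullrowsub_unit.
  by rewrite unitmxE det_map_mx unitfE intr_eq0.
have HC a : H (a *m C).
  rewrite mulmx_sum_row; apply: (big_ind H) => // i _.
  rewrite -[a 0 i]intz scaler_int; apply: HMz.
  by rewrite row_rowsub.
have Hdet a : H (a *~ \det C).
  by rewrite -scaler_int intz -mul_mx_scalar -mul_adj_mx mulmxA.
pose N := `|\det C|%N.
have N0 : (0 < N)%N by rewrite absz_gt0.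
exists [seq \row_j ((f : {ffun 'I_d -> 'I_N}) j)%:Z | f <- enum {: {ffun 'I_d -> 'I_N}}] => x.
pose md j : int := modz (x 0 j) (\det C).
have md0 j : 0 <= md j by exact: modz_ge0.
have lt j : (absz (md j) < N)%N.
  by rewrite -ltz_nat gez0_abs // abszE; exact: ltz_mod.
exists (\row_j (absz (md j))%:Z).
  apply/mapP; exists [ffun j => Ordinal (lt j)]; first by rewrite mem_enum.
  by apply/rowP => j; rewrite !mxE ffunE.
have -> : x - \row_j (absz (md j))%:Z = (\row_j divz (x 0 j) (\det C)) *~ \det C.
  apply/rowP => j; rewrite -scaler_int !mxE gez0_abs // intz.
  by rewrite {1}(divz_eq (x 0 j) (\det C)) addrK mulrC.
exact: Hdet.
Qed.

End FiniteIndex.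

Section StrongUnimodular.
Variables (R : realType) (d : nat) (Sigma : {fset set 'rV[R]_d}) (F : fan_data Sigma).
Local Notation ray := (ray F).
Local Notation vec := (@vec R d Sigma F).
Local Notation rays := (@rays R d Sigma F).
Local Notation du := (@du R d Sigma F).
Hypothesis su : strongly_unimodular Sigma.

Lemma cone_latticeP (s : Sigma) n : cone_lattice (val s) n ->
  n = \sum_(r in rays s) vec r *~ ev (du s r) n.
Proof.
move=> [k [c [y [ys e]]]].
have [b eb] : exists b : ray -> R, toR R n = \sum_(r in rays s) b r *: toR R (vec r).
  apply/sub_ray_mx; rewrite e; apply: summx_sub => i _; apply: scalemx_sub.
  exact: cone_sub_ray_mx.
apply: (@toR_inj R); rewrite (big_morph _ (@toRD R d) (@toR0 R d)) {1}eb.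
apply/eq_bigr => r rs; have := congr1 (dot (toR R (du s r))) eb.
rewrite crd_sum // rs dot_toR => <-.
by apply/rowP => j; rewrite -[in RHS]scaler_int !mxE rmorphM intz.
Qed.

Lemma lin_spanP (s : Sigma) x : lin_span (val s) x <->
  exists b : ray -> R, x = \sum_(r in rays s) b r *: toR R (vec r).
Proof.
split=> [[k [c [y [ys ->]]]]|[b ->]].
  apply/sub_ray_mx; apply: summx_sub => i _; apply: scalemx_sub.
  exact: cone_sub_ray_mx.
exists #|rays s|, (fun i => b (enum_val i)), (fun i => toR R (vec (enum_val i))).
by split=> [i|]; [apply: cone_ray; exact: enum_valP | rewrite big_enum_val].
Qed.

(* The index of N_s + N_t in N is finite, hence equal to 1. *)
Lemma lattice_sum (s t : Sigma) :
  (forall w, exists a b : ray -> R,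
    w = \sum_(r in rays s) a r *: toR R (vec r) + \sum_(r in rays t) b r *: toR R (vec r)) ->
  forall n, exists a b : ray -> int,
    n = \sum_(r in rays s) vec r *~ a r + \sum_(r in rays t) vec r *~ b r.
Proof.
move=> full n.
have [_ /(_ _ _ (valP s) (valP t))] := su.
set H := [set a + b | a in _ & b in _]%classic => -[HT|nf].
  have : H n by rewrite HT.
  move=> [a /cone_latticeP ea [b /cone_latticeP eb <-]].
  by exists (fun r => ev (du s r) a), (fun r => ev (du t r) b); rewrite {1}ea {1}eb.
exfalso; apply: nf.
have lat0 q : cone_lattice (val q) 0.
  by exists 0%N, (fun=> 0), (fun=> 0); split=> [[]//|]; rewrite big_ord0 toR0.
have latD (q : Sigma) a b : cone_lattice (val q) a -> cone_lattice (val q) b -> cone_lattice (val q) (a + b).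
  move=> /lin_spanP[f ef] /lin_spanP[g eg]; apply/lin_spanP; exists (fun r => f r + g r).
  by rewrite toRD ef eg -big_split; apply/eq_bigr => r _; rewrite scalerDl.
have latN (q : Sigma) a : cone_lattice (val q) a -> cone_lattice (val q) (- a).
  move=> /lin_spanP[f ef]; apply/lin_spanP; exists (fun r => - f r).
  by rewrite toRN ef -sumrN; apply/eq_bigr => r _; rewrite scaleNr.
have latr (q : Sigma) r : r \in rays q -> cone_lattice (val q) (vec r).
  move=> rq; exists 1%N, (fun=> 1), (fun=> toR R (vec r)); split=> [_|]; first exact: cone_ray.
  by rewrite big_ord1 scale1r.
pose G : 'M[int]_(#|rays s| + #|rays t|, d) :=
  col_mx (\matrix_(i < #|rays s|) vec (enum_val i)) (\matrix_(i < #|rays t|) vec (enum_val i)).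
apply: (@full_rank_index R d H _ G).
- by exists 0 => //; exists 0; rewrite // addr0.
- move=> _ _ [a sa [b tb <-]] [a' sa' [b' tb' <-]].
  by exists (a + a'); [exact: latD|exists (b + b'); [exact: latD|rewrite addrACA]].
- move=> _ [a sa [b tb <-]].
  by exists (- a); [exact: latN|exists (- b); [exact: latN|rewrite opprD]].
- move=> i; case: (split_ordP i) => j ->.
    rewrite rowKu rowK; exists (vec (enum_val j)); first by apply: latr; exact: enum_valP.
    by exists 0; rewrite ?addr0.
  rewrite rowKd rowK; exists 0 => //; exists (vec (enum_val j)); rewrite ?add0r //.
  by apply: latr; exact: enum_valP.
- rewrite map_col_mx.
  have -> : map_mx intr (\matrix_(i < #|rays s|) vec (enum_val i)) = ray_mx F s.
    by apply/row_matrixP => i; rewrite -map_row !rowK.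
  have -> : map_mx intr (\matrix_(i < #|rays t|) vec (enum_val i)) = ray_mx F t.
    by apply/row_matrixP => i; rewrite -map_row !rowK.
  rewrite -sub1mx; apply/row_subP => i; rewrite -addsmxE.
  have [a [b ->]] := full (row i 1%:M); apply: addmx_sub_adds; apply/sub_ray_mx.
    by exists a.
  by exists b.
Qed.

End StrongUnimodular.

(** * Pairs of sets as subsets of a disjoint union *)

Section SumOfSubtypes.
Variables (T : finType) (A B : {set T}).
Local Notation X := ({r : T | r \in A} + {r : T | r \in B})%type.

Definition lpart (W : Type) (w0 : W) (l : X -> W) (r : T) : W :=
  oapp (fun y : {r : T | r \in A} => l (inl y)) w0 (insub r).
Definition rpart (W : Type) (w0 : W) (l : X -> W) (r : T) : W :=
  oapp (fun y : {r : T | r \in B} => l (inr y)) w0 (insub r).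

Lemma lpartE W w0 (l : X -> W) y : lpart w0 l (val y) = l (inl y).
Proof. by rewrite /lpart valK. Qed.

Lemma rpartE W w0 (l : X -> W) y : rpart w0 l (val y) = l (inr y).
Proof. by rewrite /rpart valK. Qed.

Lemma lpart_in W w0 (l : X -> W) r (rA : r \in A) : lpart w0 l r = l (inl (exist _ r rA)).
Proof. exact: (lpartE w0 l (exist (fun r => r \in A) r rA)). Qed.

Lemma rpart_in W w0 (l : X -> W) r (rB : r \in B) : rpart w0 l r = l (inr (exist _ r rB)).
Proof. exact: (rpartE w0 l (exist (fun r => r \in B) r rB)). Qed.

Lemma big_sum_sub (W : Type) (idx : W) (op : Monoid.com_law idx) (f : X -> W) (a b : T -> W) :
  (forall y, f (inl y) = a (val y)) -> (forall y, f (inr y) = b (val y)) ->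
  \big[op/idx]_x f x = op (\big[op/idx]_(r in A) a r) (\big[op/idx]_(r in B) b r).
Proof.
move=> fa fb; rewrite big_sumType /=; congr (op _ _).
  by rewrite (big_sub A a); apply/eq_bigr => y _.
by rewrite (big_sub B b); apply/eq_bigr => y _.
Qed.

Definition join_set (S S' : {set T}) : {set X} :=
  [set x : X | match x with inl y => val y \in S | inr y => val y \in S' end].
Definition lset (Y : {set X}) : {set T} := [set r | lpart false (fun x => x \in Y) r].
Definition rset (Y : {set X}) : {set T} := [set r | rpart false (fun x => x \in Y) r].

Lemma lset_sub (Y : {set X}) : lset Y \subset A.
Proof.
apply/subsetP => r; rewrite inE /lpart; case: insubP => [y yA <- _|//].
exact: valP.
Qed.

Lemma rset_sub (Y : {set X}) : rset Y \subset B.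
Proof.
apply/subsetP => r; rewrite inE /rpart; case: insubP => [y yA <- _|//].
exact: valP.
Qed.

Lemma join_setK (C C' : {set T}) (Y : {set X}) : [disjoint A & C] -> [disjoint B & C'] ->
  join_set (C :|: lset Y) (C' :|: rset Y) = Y.
Proof.
move=> AC BC; apply/setP => -[y|y]; rewrite !inE.
  by rewrite lpartE (disjointFr AC (valP y)).
by rewrite rpartE (disjointFr BC (valP y)).
Qed.

Lemma lset_join (C S S' : {set T}) : C \subset S -> S \subset C :|: A -> [disjoint A & C] ->
  C :|: lset (join_set S S') = S.
Proof.
move=> CS SA AC; apply/setP => r; rewrite !inE.
case: (boolP (r \in C)) => [/(subsetP CS)->//|rC] /=.
case: (boolP (r \in A)) => rA; first by rewrite lpart_in inE.
rewrite /lpart insubN //=; apply/esym/negbTE; apply: contra rA => /(subsetP SA).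
by rewrite inE (negPf rC).
Qed.

Lemma rset_join (C S S' : {set T}) : C \subset S' -> S' \subset C :|: B -> [disjoint B & C] ->
  C :|: rset (join_set S S') = S'.
Proof.
move=> CS SA AC; apply/setP => r; rewrite !inE.
case: (boolP (r \in C)) => [/(subsetP CS)->//|rC] /=.
case: (boolP (r \in B)) => rA; first by rewrite rpart_in inE.
rewrite /rpart insubN //=; apply/esym/negbTE; apply: contra rA => /(subsetP SA).
by rewrite inE (negPf rC).
Qed.

Lemma card_join (Y : {set X}) : #|Y| = (#|lset Y| + #|rset Y|)%N.
Proof.
rewrite -!sum1_card [LHS]big_mkcond /=.
rewrite (@big_sum_sub _ _ _ _ (fun r => (r \in lset Y) : nat) (fun r => (r \in rset Y) : nat)).
- congr (_ + _)%N; rewrite [RHS]big_mkcond [LHS]big_mkcond; apply/eq_bigr => r _ /=.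
    by case: (boolP (r \in lset Y)) => [/(subsetP (lset_sub Y))->//|]; case: ifP.
  by case: (boolP (r \in rset Y)) => [/(subsetP (rset_sub Y))->//|]; case: ifP.
- by move=> y; rewrite inE lpartE; case: ifP.
- by move=> y; rewrite inE rpartE; case: ifP.
Qed.

Lemma prod_join (C : comNzRingType) (a b : T -> C) (Y : {set X}) :
  \prod_(x in Y) (match x with inl y => a (val y) | inr y => b (val y) end) =
  \prod_(r in lset Y) a r * \prod_(r in rset Y) b r.
Proof.
rewrite [LHS]big_mkcond /=.
rewrite (@big_sum_sub _ _ _ _ (fun r => if r \in lset Y then a r else 1)
  (fun r => if r \in rset Y then b r else 1)).
- congr (_ * _); rewrite [RHS]big_mkcond [LHS]big_mkcond; apply/eq_bigr => r _ /=.
    by case: (boolP (r \in lset Y)) => [/(subsetP (lset_sub Y))->//|]; case: ifP.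
  by case: (boolP (r \in rset Y)) => [/(subsetP (rset_sub Y))->//|]; case: ifP.
- by move=> y; rewrite inE lpartE; case: ifP.
- by move=> y; rewrite inE rpartE; case: ifP.
Qed.

Lemma sum_split_set (W : zmodType) (C S U : {set T}) (g : T -> W) : C \subset S -> S \subset U ->
  (forall r, r \in U :\: C -> r \notin S -> g r = 0) ->
  \sum_(r in S) g r = \sum_(r in C) g r + \sum_(r in U :\: C) g r.
Proof.
move=> CS SU g0; rewrite (big_setID C) /= (setIidPr CS); congr (_ + _).
rewrite [LHS]big_mkcond [RHS]big_mkcond; apply/eq_bigr => r _; rewrite !in_setD.
case: (boolP (r \in C)) => rC //=; case: (boolP (r \in S)) => rS.
  by rewrite (subsetP SU).
by case: ifP => // rU; rewrite g0 // in_setD rC rU.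
Qed.

End SumOfSubtypes.

Lemma meeting_term (A : comNzRingType) (a b c e s : A) : s * ((a * b) * (c * e)) = (a * c) * (s * (b * e)).
Proof. ring. Qed.

Lemma prod_setU (A : comNzRingType) (I : finType) (f : I -> A) (S T : {set I}) : [disjoint S & T] ->
  \prod_(i in S :|: T) f i = \prod_(i in S) f i * \prod_(i in T) f i.
Proof.
by move=> ST; rewrite -bigU //=; apply/eq_bigl => i; rewrite in_setU.
Qed.

Lemma sign_double (A : comNzRingType) (n a b : nat) : (-1) ^+ (n + a + (n + b)) = (-1) ^+ (a + b) :> A.
Proof. by rewrite addnACA exprD addnn -muln2 exprM sqrr_sign mul1r. Qed.

Lemma signed_split (A : comNzRingType) (I : finType) (f : I -> A) (S L L' : {set I}) :
  S = L :|: L' -> [disjoint L & L'] ->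
  (-1) ^+ (#|L| + #|L'|) * (\prod_(i in L) f i * \prod_(i in L') f i) = (-1) ^+ #|S| * \prod_(i in S) f i.
Proof. by move=> -> LL; rewrite prod_setU // cardsU disjoint_setI0 // cards0 subn0. Qed.

(** * The vector configuration attached to two maximal cones *)

Section LocalDiagonal.
Variables (R : realType) (d : nat) (Sigma : {fset set 'rV[R]_d}) (F : fan_data Sigma).
Local Notation ray := (ray F).
Local Notation vec := (@vec R d Sigma F).
Local Notation rays := (@rays R d Sigma F).
Local Notation du := (@du R d Sigma F).
Local Notation crd s r x := (dot (toR R (du s r)) x).
Local Notation rv r := (toR R (vec r)).
Variable v : 'rV[R]_d.
Hypothesis su : strongly_unimodular Sigma.
Hypothesis gen : sufficiently_generic Sigma v.
Variables (k k' g : Sigma).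
Hypothesis (km : ismax F k) (km' : ismax F k').
Hypothesis (gk : rays g \subset rays k) (gk' : rays g \subset rays k').

Let A := rays k :\: rays g.
Let B := rays k' :\: rays g.
Local Notation X := ({r : ray | r \in A} + {r : ray | r \in B})%type.
Local Notation join S S' := (@join_set ray A B S S').
Local Notation lpart := (@lpart ray A B _).
Local Notation rpart := (@rpart ray A B _).
Local Notation lset := (@lset ray A B).
Local Notation rset := (@rset ray A B).

(** The quotient of N_R by the span of g, realised inside the span of the rays of k outside g. *)
Definition proj (x : 'rV[R]_d) : 'rV[R]_d := \sum_(r in A) crd k r x *: rv r.
(* Modulo the span of g, a nonnegative relation - (combination of s) + (combination of t) = w is a
   point of (s + w) :&: t.  Thus pairs (s, t) become subsets of X; w = v and w = 0 express the two
   conditions on s and t as in_pos and acyclic. *)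
Definition vx (x : X) : 'rV[R]_d := match x with inl y => - rv (val y) | inr y => rv (val y) end.
Definition Vx (x : X) := proj (vx x).
Definition ux (x : X) : 'rV[int]_d := match x with inl y => du k (val y) | inr y => du k' (val y) end.

Lemma projD x y : proj (x + y) = proj x + proj y.
Proof. by rewrite /proj -big_split; apply/eq_bigr => r _; rewrite dotDr scalerDl. Qed.

Lemma projZ (c : R) x : proj (c *: x) = c *: proj x.
Proof. by rewrite /proj scaler_sumr; apply/eq_bigr => r _; rewrite dotZr scalerA. Qed.

Lemma proj0 : proj 0 = 0.
Proof. by rewrite /proj big1 // => r _; rewrite dot0r scale0r. Qed.

Lemma projN x : proj (- x) = - proj x.
Proof. by rewrite -scaleN1r projZ scaleN1r. Qed.

Lemma proj_sum (I : Type) (r : seq I) (P : pred I) (f : I -> 'rV[R]_d) :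
  proj (\sum_(i <- r | P i) f i) = \sum_(i <- r | P i) proj (f i).
Proof. exact: (big_morph proj projD proj0). Qed.

Lemma projE x : x = proj x + \sum_(r in rays g) crd k r x *: rv r.
Proof.
rewrite [LHS](max_expand (eqP km)) (big_setID (rays g)) /= (setIidPr gk).
exact: addrC.
Qed.

Lemma proj_span (c : ray -> R) : proj (\sum_(r in rays g) c r *: rv r) = 0.
Proof.
rewrite /proj big1 // => r; rewrite in_setD => /andP[rg rk].
by rewrite crd_sum // (negPf rg) scale0r.
Qed.

Lemma proj_eq0 x : proj x = 0 -> exists c : ray -> R, x = \sum_(r in rays g) c r *: rv r.
Proof. by move=> px; exists (fun r => crd k r x); rewrite [LHS]projE px add0r. Qed.

Lemma comb_Vx (l : X -> R) :
  comb Vx l = proj (\sum_(r in B) rpart 0 l r *: rv r - \sum_(r in A) lpart 0 l r *: rv r).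
Proof.
rewrite projD projN !proj_sum /comb.
rewrite (@big_sum_sub _ A B _ _ _ _ (fun r => - proj (lpart 0 l r *: rv r))
   (fun r => proj (rpart 0 l r *: rv r))).
- by rewrite /= sumrN addrC.
- by move=> y; rewrite lpartE projZ /Vx /= projN scalerN.
- by move=> y; rewrite rpartE projZ.
Qed.

(** The relation holds modulo the span of g, with an error whose coefficients have both signs. The
    rays of g belong to both S and [S'], so the positive part of the error is added on the left and
    the negative part on the right. *)
Lemma lift_relation (S S' : {set ray}) (l : X -> R) w :
  rays g \subset S -> S \subset rays k -> rays g \subset S' -> S' \subset rays k' ->
  nonneg l -> supp l (join S S') -> comb Vx l = proj w ->
  exists a b : ray -> R, [/\ forall r, 0 <= a r, forall r, 0 <= b r,
    forall r, r \in A -> a r = lpart 0 l r, forall r, r \in B -> b r = rpart 0 l r &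
    \sum_(r in S) a r *: rv r + w = \sum_(r in S') b r *: rv r].
Proof.
move=> gS Sk gS' Sk' l0 ls e.
have [|c ec] := @proj_eq0 (\sum_(r in B) rpart 0 l r *: rv r - \sum_(r in A) lpart 0 l r *: rv r - w).
  by rewrite projD projN -comb_Vx e subrr.
pose a r := if r \in rays g then Num.max 0 (c r) else lpart 0 l r.
pose b r := if r \in rays g then Num.max 0 (- c r) else rpart 0 l r.
have lA0 r : 0 <= lpart 0 l r by rewrite /lpart; case: insubP => //= y _ _; exact: l0.
have lB0 r : 0 <= rpart 0 l r by rewrite /rpart; case: insubP => //= y _ _; exact: l0.
have aA r : r \in A -> a r = lpart 0 l r by rewrite in_setD /a => /andP[/negPf-> _].
have bB r : r \in B -> b r = rpart 0 l r by rewrite in_setD /b => /andP[/negPf-> _].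
exists a, b; split=> //.
- by move=> r; rewrite /a; case: ifP; rewrite // le_max lexx.
- by move=> r; rewrite /b; case: ifP; rewrite // le_max lexx.
rewrite (sum_split_set gS Sk) => [|r rA rS]; last first.
  by rewrite aA // (lpart_in _ _ rA) ls ?scale0r // inE.
rewrite (sum_split_set gS' Sk') => [|r rB rS]; last first.
  by rewrite bB // (rpart_in _ _ rB) ls ?scale0r // inE.
rewrite (eq_bigr (fun r => lpart 0 l r *: rv r) (P := mem A)) => [|r rA]; last by rewrite aA.
rewrite [X in _ = _ + X](eq_bigr (fun r => rpart 0 l r *: rv r)) => [|r rB]; last by rewrite bB.
have eg : \sum_(r in rays g) a r *: rv r - \sum_(r in rays g) b r *: rv r =
    \sum_(r in rays g) c r *: rv r.
  rewrite -sumrB; apply/eq_bigr => r rg; rewrite -scalerBl /a /b rg; congr (_ *: _).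
  have [h|h] := lerP 0 (c r).
    by rewrite (max_l (x := 0) (y := - c r)) ?oppr_le0 // subr0.
  by rewrite (max_r (x := 0) (y := - c r)) ?oppr_ge0 ?ltW // sub0r opprK.
have -> : \sum_(r in rays g) a r *: rv r = \sum_(r in rays g) c r *: rv r + \sum_(r in rays g) b r *: rv r.
  by rewrite -eg subrK.
rewrite -ec -!addrA [RHS]addrC -[RHS]addr0 -!addrA; congr (_ + _).
by rewrite addr0 addrA -opprD (addrC (\sum_(r in rays g) b r *: rv r)) addrA addNr add0r.
Qed.

Lemma push_relation (S S' : {set ray}) (a b : ray -> R) w :
  rays g \subset S -> S \subset rays k -> rays g \subset S' -> S' \subset rays k' ->
  \sum_(r in S) a r *: rv r + w = \sum_(r in S') b r *: rv r ->
  exists l : X -> R, [/\ (forall r, r \in S -> 0 <= a r) -> (forall r, r \in S' -> 0 <= b r) -> nonneg l,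
    supp l (join S S'), comb Vx l = proj w,
    forall r, r \in A -> r \in S -> lpart 0 l r = a r &
    forall r, r \in B -> r \in S' -> rpart 0 l r = b r].
Proof.
move=> gS Sk gS' Sk' e.
pose a' r := if r \in S then a r else 0.
pose b' r := if r \in S' then b r else 0.
pose l (x : X) := match x with inl y => a' (val y) | inr y => b' (val y) end.
have la r : r \in A -> lpart 0 l r = a' r by move=> rA; rewrite lpart_in.
have lb r : r \in B -> rpart 0 l r = b' r by move=> rB; rewrite rpart_in.
exists l; split.
- by move=> a0 b0 [y|y]; rewrite /l /a' /b'; case: ifP => // ?; [apply: a0|apply: b0].
- by move=> [y|y]; rewrite inE /l /a' /b' => /negPf ->.
2: by move=> r /la-> rS; rewrite /a' rS.
2: by move=> r /lb-> rS; rewrite /b' rS.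
rewrite comb_Vx (eq_bigr (fun r => b' r *: rv r)) => [|r rB]; last by rewrite lb.
rewrite [X in _ - X](eq_bigr (fun r => a' r *: rv r)) => [|r rA]; last by rewrite la.
have ea : \sum_(r in S) a r *: rv r = \sum_(r in rays g) a' r *: rv r + \sum_(r in A) a' r *: rv r.
  rewrite -(sum_split_set gS Sk) => [|r _ /negPf rS]; last by rewrite /a' rS scale0r.
  by apply/eq_bigr => r rS; rewrite /a' rS.
have eb : \sum_(r in S') b r *: rv r = \sum_(r in rays g) b' r *: rv r + \sum_(r in B) b' r *: rv r.
  rewrite -(sum_split_set gS' Sk') => [|r _ /negPf rS]; last by rewrite /b' rS scale0r.
  by apply/eq_bigr => r rS; rewrite /b' rS.
move: (congr1 proj e); rewrite ea eb !projD !proj_span !add0r projN => <-.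
by rewrite addrAC subrr add0r.
Qed.

Lemma in_pos_meet (s t : Sigma) :
  rays g \subset rays s -> rays s \subset rays k -> rays g \subset rays t -> rays t \subset rays k' ->
  in_pos Vx (proj v) (join (rays s) (rays t)) <-> (shift (val s) v `&` val t !=set0)%classic.
Proof.
move=> gs sk gt tk; split=> [[l [l0 ls lv]]|[_ [[x sx <-] tx]]].
  have [a [b [a0 b0 _ _ e]]] := lift_relation gs sk gt tk l0 ls lv.
  exists (\sum_(r in rays t) b r *: rv r); split.
    by exists (\sum_(r in rays s) a r *: rv r) => //; apply/(coneP F); exists a.
  by apply/(coneP F); exists b.
have /(coneP F)[a [a0 ea]] := sx; have /(coneP F)[b [b0 eb]] := tx.
rewrite ea in eb; have [l [ln ls lv _ _]] := push_relation gs sk gt tk eb.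
by exists l; split=> //; exact: ln.
Qed.

Lemma crd_face (s : Sigma) x r : r \in rays s -> val g x -> rays g \subset rays s -> r \notin rays g ->
  crd s r x = 0.
Proof. by move=> rs /(coneP F)[c [_ ->]] gs /negPf rg; rewrite crd_sum // rg. Qed.

Lemma acyclic_meet (s t : Sigma) :
  rays g \subset rays s -> rays s \subset rays k -> rays g \subset rays t -> rays t \subset rays k' ->
  acyclic Vx (join (rays s) (rays t)) <-> (val s `&` val t = val g)%classic.
Proof.
move=> gs sk gt tk; split=> [ac|e l l0 ls lv].
  apply/seteqP; split=> x; last by move=> gx; split; [exact: ((rays_subP F g s).1 gs)|exact: ((rays_subP F g t).1 gt)].
  move=> [/(coneP F)[a [a0 ea]] /(coneP F)[b [b0 eb]]].
  have [|l [ln ls lv la _]] := @push_relation (rays s) (rays t) a b 0 gs sk gt tk.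
    by rewrite addr0 -ea.
  rewrite proj0 in lv; have l0 := ac l (ln a0 b0) ls lv.
  apply/(coneP F); exists a; split=> [r rg|]; first exact: (a0 r (subsetP gs r rg)).
  rewrite ea (big_setID (rays g)) /= (setIidPr gs) [X in _ + X]big1 ?addr0 // => r.
  rewrite in_setD => /andP[rg rs]; have rA : r \in A by rewrite in_setD rg (subsetP sk).
  by rewrite -(la r rA rs) (lpart_in _ _ rA) l0 scale0r.
have [|a [b [a0 b0 aA bB ab]]] := @lift_relation (rays s) (rays t) l 0 gs sk gt tk l0 ls.
  by rewrite lv proj0.
rewrite addr0 in ab; pose x := \sum_(r in rays s) a r *: rv r.
have gx : val g x.
  by rewrite -e; split; apply/(coneP F); [exists a|exists b].
case=> [[r rA]|[r rB]].
  have := rA; rewrite in_setD => /andP[rg rk].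
  have := crd_face rk gx gk rg; rewrite crd_sum //; case: ifP => rs.
    by rewrite aA // (lpart_in _ _ rA).
  by move=> _; apply: ls; rewrite inE /= rs.
have := rB; rewrite in_setD => /andP[rg rk].
have := crd_face rk gx gk' rg; rewrite /x ab crd_sum //; case: ifP => rs.
  by rewrite bB // (rpart_in _ _ rB).
by move=> _; apply: ls; rewrite inE /= rs.
Qed.

Lemma faces_of_set (Y : {set X}) : exists s t : Sigma,
  [/\ rays g \subset rays s, rays s \subset rays k, rays g \subset rays t, rays t \subset rays k' &
      join (rays s) (rays t) = Y].
Proof.
have sA : rays g :|: lset Y \subset rays k.
  by rewrite subUset gk (subset_trans (lset_sub Y)) // subsetDl.
have sB : rays g :|: rset Y \subset rays k'.
  by rewrite subUset gk' (subset_trans (rset_sub Y)) // subsetDl.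
have [s es] := face_rays sA; have [t et] := face_rays sB.
exists s, t; rewrite es et sA sB !subsetUl; split=> //.
by apply: join_setK; rewrite disjoint_sym disjoints_subset /A /B; apply/subsetP => r rg;
  rewrite in_setC in_setD rg.
Qed.

(** If the positive hull of Y contains v, the corresponding cones meet after translation, and
    [generic_full] writes every vector through their rays. *)
Lemma generic_point_Vx : generic_point Vx (proj v).
Proof.
move=> Y; have [s [t [gs sk gt tk <-]]] := faces_of_set Y.
move=> /(in_pos_meet gs sk gt tk)/(generic_full F gen) full x.
have [a [b e]] := full (vx x).
have [|l [_ ls lv _ _]] := @push_relation (rays s) (rays t) (fun r => - a r) b (vx x) gs sk gt tk.
  rewrite {}e (eq_bigr (fun r => - (a r *: rv r))) ?sumrN ?addKr // => r _.
  by rewrite scaleNr.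
by exists l.
Qed.

Lemma dot_row_inj s (p q : 'rV[R]_d) : ismax F s ->
  (forall r, r \in rays s -> dot p (rv r) = dot q (rv r)) -> p = q.
Proof.
move=> /eqP sm e; apply/rowP => j; rewrite -(dot_delta p) -(dot_delta q).
rewrite (max_expand sm (delta_mx 0 j)) !dot_sumr; apply/eq_bigr => r rs.
by rewrite !dotZr e.
Qed.

Lemma zcomb_ux (l : X -> int) :
  zcomb ux l = \sum_(r in A) du k r *~ lpart 0 l r + \sum_(r in B) du k' r *~ rpart 0 l r.
Proof.
rewrite /zcomb (@big_sum_sub _ A B _ _ _ _ (fun r => du k r *~ lpart 0 l r)
   (fun r => du k' r *~ rpart 0 l r)) //= => y; [by rewrite lpartE|by rewrite rpartE].
Qed.

Lemma pairing_dot (pi : 'cV[R]_d) : exists p : 'rV[R]_d, (forall r, r \in rays g -> dot p (rv r) = 0) /\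
  forall x, pairing Vx pi x = dot p (vx x).
Proof.
have piE y : (y *m pi) 0 0 = dot pi^T y by rewrite dotC /dot trmxK.
pose p := \sum_(r in A) dot pi^T (rv r) *: toR R (du k r).
have pE y : dot p y = (proj y *m pi) 0 0.
  rewrite piE dot_sumr dot_suml; apply/eq_bigr => r _.
  by rewrite dotZr dotC dotZr mulrC [dot y _]dotC.
exists p; split=> [r rg|x]; last by rewrite pE.
rewrite pE; have -> : rv r = \sum_(q in rays g) (q == r)%:R *: rv q.
  rewrite (bigD1 r) //= eqxx scale1r big1 ?addr0 // => q /andP[_ /negPf ->].
  by rewrite scale0r.
by rewrite proj_span mul0mx mxE.
Qed.

(** A relation is an equality [m1 = m2] between an expansion in the dual basis of k and one in that
    of [k']. The common vector vanishes on g and takes the prescribed values on the other rays, so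
    it is the potential sought. *)
Lemma gale_Vx (l : X -> int) :
  zcomb ux l = 0 <-> exists pi, forall x, pairing Vx pi x = (l x)%:~R.
Proof.
have AD : A \subset rays k by exact: subsetDl.
have BD : B \subset rays k' by exact: subsetDl.
pose m1 := \sum_(r in A) du k r *~ (- lpart 0 l r).
pose m2 := \sum_(r in B) du k' r *~ rpart 0 l r.
have zE : zcomb ux l = m2 - m1.
  rewrite zcomb_ux addrC; congr (_ + _); rewrite /m1 -sumrN; apply/eq_bigr => r _.
  by rewrite mulrNz opprK.
split=> [|[pi piE]].
  rewrite zE => /eqP; rewrite subr_eq0 => /eqP e.
  have g0 r : r \in rays g -> dot (toR R m2) (rv r) = 0.
    move=> rg; rewrite e dot_toR ev_sum_du // ?(subsetP gk) // in_setD rg //.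
  exists (toR R m2)^T => x.
  have -> : pairing Vx (toR R m2)^T x = dot (toR R m2) (vx x).
    rewrite [in RHS](projE (vx x)) dotDr [X in _ = _ + X]dot_sumr.
    rewrite [X in _ = _ + X]big1 => [|r rg]; last by rewrite dotZr g0 // mulr0.
    by rewrite addr0 /pairing dotC.
  case: x => -[r rI] /=.
    rewrite dotC dotNl dotC e dot_toR ev_sum_du ?(subsetP AD) // rI (lpart_in _ _ rI).
    by rewrite -mulrNz opprK.
  by rewrite dot_toR ev_sum_du ?(subsetP BD) // rI (rpart_in _ _ rI).
have [p [p0 pE]] := pairing_dot pi.
have e1 : toR R m1 = p.
  apply: (dot_row_inj km) => r rk; rewrite dot_toR ev_sum_du //; case: ifPn => [rA|].
    have := piE (inl (exist _ r rA)); rewrite pE /= dotC dotNl dotC => e.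
    by rewrite (lpart_in _ _ rA) mulrNz -e opprK.
  by rewrite in_setD rk andbT negbK => /p0 ->.
have e2 : toR R m2 = p.
  apply: (dot_row_inj km') => r rk; rewrite dot_toR ev_sum_du //; case: ifPn => [rB|].
    by have := piE (inr (exist _ r rB)); rewrite pE /= (rpart_in _ _ rB) => ->.
  by rewrite in_setD rk andbT negbK => /p0 ->.
by rewrite zE (@toR_inj R d m2 m1) ?subrr // e1 e2.
Qed.

Lemma toR_sum (I : Type) (rs : seq I) (P : pred I) (f : I -> 'rV[int]_d) :
  toR R (\sum_(i <- rs | P i) f i) = \sum_(i <- rs | P i) toR R (f i).
Proof. exact: (big_morph (@toR R d) (@toRD R d) (@toR0 R d)). Qed.

Lemma toRMz (m : 'rV[int]_d) (c : int) : toR R (m *~ c) = c%:~R *: toR R m.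
Proof. by apply/rowP => j; rewrite !mxE -scaler_int !mxE intz intrM. Qed.

(** The potential that matches l on Y is integral on the rays of two cones whose lattices generate
    N, hence on every ray; subtracting it from l gives [l']. *)
Lemma unimod_Vx (Y : {set X}) (l : X -> int) : chamber_basis Vx (proj v) Y ->
  exists l' : X -> int, (forall b, b \in Y -> l' b = 0) /\
    exists pi, forall x, pairing Vx pi x = (l x - l' x)%:~R.
Proof.
move=> [iY pY]; have [pi piE] := potential (fun x => (l x)%:~R) iY.
have [p [p0 pE]] := pairing_dot pi.
have [s [t [gs sk gt tk eY]]] := faces_of_set Y.
have ints r : exists z : int, dot p (rv r) = z%:~R.
  have := pY; rewrite -eY => /(in_pos_meet gs sk gt tk)/(generic_full F gen) full.
  have [a [b ->]] := lattice_sum su full (vec r).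
  have sint (C : {set ray}) (c : ray -> int) : (forall q, q \in C -> exists z : int, dot p (rv q) = z%:~R) ->
      exists z : int, dot p (toR R (\sum_(q in C) vec q *~ c q)) = z%:~R.
    move=> h; rewrite toR_sum dot_sumr.
    elim/big_ind: _ => [|x y [z1 ->] [z2 ->]|q qC]; first by exists 0.
      by exists (z1 + z2); rewrite intrD.
    by have [z e] := h q qC; exists (c q * z); rewrite toRMz dotZr e intrM.
  rewrite toRD dotDr; have [|z1 ->] := sint (rays s) a; last have [|z2 ->] := sint (rays t) b.
  - move=> q qs; case: (boolP (q \in rays g)) => qg; first by exists 0; rewrite p0.
    have qA : q \in A by rewrite in_setD qg (subsetP sk).
    exists (- l (inl (exist _ q qA))); have := piE (inl (exist _ q qA)).
    rewrite pE /= -eY inE /= => /(_ qs); rewrite dotC dotNl dotC => e.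
    by rewrite mulrNz -e opprK.
  - move=> q qs; case: (boolP (q \in rays g)) => qg; first by exists 0; rewrite p0.
    have qB : q \in B by rewrite in_setD qg (subsetP tk).
    exists (l (inr (exist _ q qB))); have := piE (inr (exist _ q qB)).
    by rewrite pE /= -eY inE /= => /(_ qs).
  by exists (z1 + z2); rewrite intrD.
have /choice[z zP] (x : X) : exists z : int, pairing Vx pi x = z%:~R.
  case: x => -[r ri]; rewrite pE /=; have [z e] := ints r; last by exists z.
  by exists (- z); rewrite dotC dotNl dotC e mulrNz.
exists (fun x => l x - z x); split=> [b bY|].
  apply/eqP; rewrite subr_eq0 -(@eqr_int R) -zP; exact/eqP/esym/piE.
by exists pi => x; rewrite zP; congr (_%:~R); rewrite opprB addrC subrK.
Qed.

Definition local_chambers : RT d := @chamber_sum _ _ _ Vx (proj v) _ _ (@chi d) ux.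

Lemma local_chambers_eq0 : k <> k' -> local_chambers = 0.
Proof.
move=> kk'; have [r0 r0k r0k'] : exists2 r, r \in rays k & r \notin rays k'.
  by apply/subsetPn; apply: contra_notN kk'; exact: max_sub.
have rA : r0 \in A by rewrite in_setD r0k andbT; apply: contra r0k' => /(subsetP gk').
have := @chamber_sum_eq0 _ _ _ Vx (proj v) _ _ (@chi d) ux (@act d).
move=> /(_ (@eq_act d)) h.
have {}h := h (@actD d) (@act_addr d) (@act1 d) (@actM d) (@act_chi d).
have {}h : (1 - chi (ux (inl (exist _ r0 rA)))) * local_chambers = 0.
  apply: h.
  - by move=> a a0; apply/malgP => m; rewrite -act_delta0 a0 mcoeff0.
  - exact: chiD.
  - exact: chi0.
  - exact: generic_point_Vx.
  - exact: gale_Vx.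
  - exact: unimod_Vx.
  - exact: du_neq0.
  (* A nonnegative relation gives a common point of k and [k']; its coordinate along [r0] is 0
     because [r0] is not a ray of [k']. *)
  move=> l l0 lv.
  have ls : supp l (join (rays k) (rays k')).
    by move=> [[r ri]|[r ri]]; rewrite inE /=; have := ri; rewrite in_setD => /andP[_ ->].
  have e : comb Vx l = proj 0 by rewrite lv proj0.
  have [a [b [a0 b0 aA bB]]] := lift_relation gk (subxx _) gk' (subxx _) l0 ls e.
  rewrite addr0 => ab; have [w we] := capS F k k'.
  have /(coneP F)[c [_ ec]] : val w (\sum_(r in rays k) a r *: rv r).
    rewrite we; split; apply/(coneP F); first by exists a.
    by exists b.
  have := congr1 (dot (toR R (du k r0))) ec; have wk := rays_cap F we.
  rewrite !crd_sum // ?r0k ?wk ?subsetIl // in_setI (negPf r0k') andbF aA //.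
  by rewrite (lpart_in _ _ rA).
apply: (@regular_inj _ (1 - chi (du k r0))); first exact/regular_chi/du_neq0.
by rewrite mulr0.
Qed.

Lemma disjoint_gA : [disjoint A & rays g].
Proof. by rewrite disjoint_sym disjoints_subset; apply/subsetP => r rg; rewrite in_setC in_setD rg. Qed.

Lemma disjoint_gB : [disjoint B & rays g].
Proof. by rewrite disjoint_sym disjoints_subset; apply/subsetP => r rg; rewrite in_setC in_setD rg. Qed.

Lemma join_faces (s t : Sigma) (Y : {set X}) :
  rays g \subset rays s -> rays s \subset rays k -> rays g \subset rays t -> rays t \subset rays k' ->
  join (rays s) (rays t) = Y -> rays s = rays g :|: lset Y /\ rays t = rays g :|: rset Y.
Proof.
move=> gs sk gt tk <-; split; apply/esym.
  apply: lset_join => //; last exact: disjoint_gA.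
  by apply/subsetP => r rs; rewrite in_setU in_setD (subsetP sk) //; case: (r \in rays g).
apply: rset_join => //; last exact: disjoint_gB.
by apply/subsetP => r rs; rewrite in_setU in_setD (subsetP tk) //; case: (r \in rays g).
Qed.

(** The rays of g lie in both cones of a pair: they give the factors [loc F g k] and [loc F g k'],
    and they cancel in the sign. *)
Lemma meeting_sum :
  \sum_(p : Sigma * Sigma | [&& rays g \subset rays p.1, rays p.1 \subset rays k,
        rays g \subset rays p.2, rays p.2 \subset rays k' &
       `[< (shift (val p.1) v `&` val p.2 !=set0)%classic /\ (val p.1 `&` val p.2)%classic = val g >]])
      (-1) ^+ (#|rays p.1| + #|rays p.2|) * (loc F p.1 k * loc F p.2 k')
  = loc F g k * loc F g k' * local_chambers.
Proof.
have /choice[h hP] (Y : {set X}) : exists p : Sigma * Sigma,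
  [/\ rays g \subset rays p.1, rays p.1 \subset rays k, rays g \subset rays p.2, rays p.2 \subset rays k' &
      join (rays p.1) (rays p.2) = Y].
  by have [s [t]] := faces_of_set Y; exists (s, t).
rewrite (reindex_onto h (fun p => join (rays p.1) (rays p.2))) /=; last first.
  move=> [s t] /and5P[gs sk gt tk _]; have [] := hP (join (rays s) (rays t)).
  case: (h _) => s' t' /= gs' sk' gt' tk' e.
  have [es et] := join_faces gs' sk' gt' tk' e.
  have [es' et'] := join_faces gs sk gt tk erefl.
  have <- : s = s' := @rays_inj _ _ _ F s s' (etrans es' (esym es)).
  have <- : t = t' := @rays_inj _ _ _ F t t' (etrans et' (esym et)).
  reflexivity.
rewrite /local_chambers /chamber_sum mulr_sumr; apply: eq_big => [Y|Y /andP[/and5P[gs sk gt tk _] /eqP e]].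
  have [gs sk gt tk e] := hP Y; rewrite gs sk gt tk e eqxx andbT /=.
  have eac := acyclic_meet gs sk gt tk; have epo := in_pos_meet gs sk gt tk.
  rewrite e in eac epo.
  by apply/asboolP/asboolP => -[a b]; split; [apply/eac|apply/epo|apply/epo|apply/eac].
have [es et] := join_faces gs sk gt tk e.
rewrite /loc gk gk' sk tk; set s := (h Y).1 in gs sk es *; set t := (h Y).2 in gt tk et *.
have cs : #|rays s| = (#|rays g| + #|lset Y|)%N.
  rewrite es cardsU disjoint_setI0 ?cards0 ?subn0 // disjoint_sym.
  exact: disjointWl (lset_sub Y) disjoint_gA.
have ct : #|rays t| = (#|rays g| + #|rset Y|)%N.
  rewrite et cardsU disjoint_setI0 ?cards0 ?subn0 // disjoint_sym.
  exact: disjointWl (rset_sub Y) disjoint_gB.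
have ps : ray_prod k (rays s) = ray_prod k (rays g) * ray_prod k (lset Y).
  rewrite es; apply: prod_setU; rewrite disjoint_sym.
  exact: disjointWl (lset_sub Y) disjoint_gA.
have pt : ray_prod k' (rays t) = ray_prod k' (rays g) * ray_prod k' (rset Y).
  rewrite et; apply: prod_setU; rewrite disjoint_sym.
  exact: disjointWl (rset_sub Y) disjoint_gB.
have -> : \prod_(x in Y) (1 - chi (ux x)) = ray_prod k (lset Y) * ray_prod k' (rset Y).
  rewrite -(prod_join (fun r => 1 - chi (du k r)) (fun r => 1 - chi (du k' r))).
  by apply/eq_bigr => -[y|y].
rewrite ps pt cs ct sign_double -card_join.
exact: meeting_term.
Qed.

End LocalDiagonal.

Section Diagonal.
Variables (R : realType) (d : nat) (Sigma : {fset set 'rV[R]_d}) (F : fan_data Sigma).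
Local Notation ray := (ray F).
Local Notation vec := (@vec R d Sigma F).
Local Notation rays := (@rays R d Sigma F).
Local Notation du := (@du R d Sigma F).
Local Notation crd s r x := (dot (toR R (du s r)) x).
Local Notation rv r := (toR R (vec r)).
Variable v : 'rV[R]_d.
Hypothesis gen : sufficiently_generic Sigma v.
Variables (k g : Sigma).
Hypothesis (km : ismax F k) (gk : rays g \subset rays k).
Let A := rays k :\: rays g.
Local Notation X := ({r : ray | r \in A} + {r : ray | r \in A})%type.
Local Notation join S S' := (@join_set ray A A S S').
Local Notation V := (@Vx R d Sigma F k k g).

(** Of the two opposite copies of each ray, the one that matches the sign of the coordinate of v. *)
Let Y0 : {set X} := join [set r | crd k r v < 0] [set r | 0 < crd k r v].

Lemma Vx_inl y : V (inl y) = - rv (val y).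
Proof.
rewrite /Vx projN; congr (- _); rewrite /proj (bigD1 (val y)) /=; last exact: valP.
have yk : val y \in rays k by have := valP y; rewrite in_setD => /andP[].
rewrite crd_ray // eqxx scale1r big1 ?addr0 // => r /andP[rA /negPf ry].
by rewrite crd_ray // ?ry ?scale0r //; move: rA; rewrite in_setD => /andP[].
Qed.

Lemma Vx_inr y : V (inr y) = rv (val y).
Proof.
by have := Vx_inl y; rewrite /Vx projN => /oppr_inj.
Qed.

Lemma crd_comb (l : X -> R) r (rA : r \in A) :
  crd k r (comb V l) = l (inr (exist _ r rA)) - l (inl (exist _ r rA)).
Proof.
have rk : r \in rays k by move: rA; rewrite in_setD => /andP[].
have Ak : A \subset rays k by exact: subsetDl.
have -> : comb V l = \sum_(q in A) (rpart 0 l q - lpart 0 l q) *: rv q.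
  rewrite /comb (@big_sum_sub _ A A _ _ _ _ (fun q => - lpart 0 l q *: rv q)
     (fun q => rpart 0 l q *: rv q)) /=.
  - by rewrite -big_split; apply/eq_bigr => q _; rewrite /= -scalerDl addrC.
  - by move=> y; rewrite lpartE Vx_inl scalerN scaleNr.
  - by move=> y; rewrite rpartE Vx_inr.
by rewrite crd_sum // rA (lpart_in _ _ rA) (rpart_in _ _ rA).
Qed.

Lemma crd_proj r : r \in A -> crd k r (@proj R d Sigma F k g v) = crd k r v.
Proof.
move=> rA; have rk : r \in rays k by move: rA; rewrite in_setD => /andP[].
by rewrite crd_sum ?subsetDl // rA.
Qed.

Lemma in_pos_Y0 : in_pos V (@proj R d Sigma F k g v) Y0.
Proof.
pose l (x : X) := match x with inl y => Num.max 0 (- crd k (val y) v)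
                             | inr y => Num.max 0 (crd k (val y) v) end.
exists l; split.
- by move=> [y|y]; rewrite /l le_max lexx.
- by move=> [y|y]; rewrite !inE /= -leNgt => h; rewrite max_l ?oppr_le0.
have Ak : A \subset rays k by exact: subsetDl.
rewrite /comb (@big_sum_sub _ A A _ _ _ _ (fun q => - Num.max 0 (- crd k q v) *: rv q)
     (fun q => Num.max 0 (crd k q v) *: rv q)) /=.
- rewrite -big_split; apply/eq_bigr => q _; rewrite /= -scalerDl; congr (_ *: _).
  have [h|h] := lerP 0 (crd k q v).
    by rewrite (max_l (x := 0) (y := - _)) ?oppr_le0 // oppr0 add0r.
  by rewrite (max_r (x := 0) (y := - _)) ?oppr_ge0 ?ltW // opprK addr0.
- by move=> y; rewrite Vx_inl scalerN scaleNr.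
- by move=> y; rewrite Vx_inr.
Qed.

(** Otherwise [Y0] would contain neither copy of r and still have v in its positive hull; by
    genericity it would span r. *)
Lemma crd_neq0 r : r \in A -> crd k r v != 0.
Proof.
move=> rA; apply/eqP => z.
have [l ls e] := generic_point_Vx gen km gk gk in_pos_Y0 (inr (exist _ r rA)).
have := crd_comb l rA; rewrite e Vx_inr /= crd_ray ?eqxx; try by have := rA; rewrite in_setD => /andP[].
by rewrite !ls ?inE ?z ?ltxx // subr0 => /eqP; rewrite oner_eq0.
Qed.

(** Acyclicity forbids both copies of a ray, and a nonzero coordinate of v requires the copy of its
    own sign. *)
Lemma chambersE Y : (acyclic V Y /\ in_pos V (@proj R d Sigma F k g v) Y) <-> Y = Y0.
Proof.
split=> [[ac [l [l0 ls lv]]]|->]; last first.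
  split; last exact: in_pos_Y0.
  move=> l l0 ls lv x; have key (y : {r : ray | r \in A}) : l (inl y) = l (inr y).
    case: y => r rA; have := crd_comb l rA; rewrite lv dot0r => /eqP.
    by rewrite eq_sym subr_eq0 => /eqP ->.
  have [y yx] : exists y, l x = l (inl y) by case: x => y; exists y.
  rewrite yx; case: (boolP (inl y \in Y0)) => yY; last exact: ls.
  by rewrite key; apply: ls; move: yY; rewrite !inE /= -leNgt => /ltW.
have sign r (rA : r \in A) : crd k r v = l (inr (exist _ r rA)) - l (inl (exist _ r rA)).
  by rewrite -crd_comb lv crd_proj.
have nboth (y : {r : ray | r \in A}) : inl y \in Y -> inr y \notin Y.
  move=> yl; apply/negP => yr.
  have /(_ _ _ _ (inl y)) : forall _ _ _ x, ((x == inl y) || (x == inr y))%:R = 0 :> R := ac _.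
  rewrite eqxx => h; suff /eqP : 1 = 0 :> R by rewrite oner_eq0.
  apply: h.
  - by move=> x; exact: ler0n.
  - by move=> x xY; apply/eqP; rewrite pnatr_eq0 eqb0; apply: contra xY => /orP[]/eqP->.
  - transitivity (comb V (fun x => (x == inl y)%:R + (x == inr y)%:R)).
      by apply/eq_bigr => x _; congr (_ *: _); case: x => z; rewrite /= ?orbF ?addr0 ?add0r.
    by rewrite combD !comb_delta Vx_inl Vx_inr addNr.
apply/setP => -[[r rA]|[r rA]]; rewrite !inE /=.
  have := sign r rA; have := l0 (inr (exist _ r rA)); have := l0 (inl (exist _ r rA)).
  have := crd_neq0 rA; case: (boolP (inl _ \in Y)) => yl.
    by rewrite [l (inr _)]ls ?nboth // => nz a _ e; rewrite e sub0r oppr_lt0 lt_def a -oppr_eq0 -[- _]sub0r -e nz.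
  by rewrite [l (inl _)]ls // => _ _ a e; rewrite e subr0 ltNge a.
have := sign r rA; have := l0 (inr (exist _ r rA)); have := l0 (inl (exist _ r rA)).
have := crd_neq0 rA; case: (boolP (inr _ \in Y)) => yl.
  rewrite [l (inl _)]ls; last by apply/negP => /nboth; rewrite yl.
  by move=> nz _ a e; rewrite e subr0 lt_def a -(subr0 (l _)) -e nz.
by rewrite [l (inr _)]ls // => _ a _ e; rewrite e sub0r oppr_gt0 ltNge a.
Qed.

Lemma local_chambers_diag :
  @local_chambers R d Sigma F v k k g = (-1) ^+ #|A| * ray_prod k A.
Proof.
rewrite /local_chambers /chamber_sum (big_pred1 Y0); last first.
  by move=> Y /=; apply/asboolP/eqP => /chambersE.
have eA : A = lset (A := A) (B := A) Y0 :|: rset (A := A) (B := A) Y0.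
  apply/setP => r; rewrite in_setU; case: (boolP (r \in A)) => rA.
    rewrite !inE (lpart_in _ _ rA) (rpart_in _ _ rA) !inE /=.
    by have := crd_neq0 rA; rewrite neq_lt.
  by rewrite (contraNF (subsetP (lset_sub Y0) r) rA) (contraNF (subsetP (rset_sub Y0) r) rA).
have dA : [disjoint lset (A := A) (B := A) Y0 & rset (A := A) (B := A) Y0].
  apply/pred0P => r /=; apply/negP => /andP[]; rewrite !inE.
  case: (boolP (r \in A)) => rA; last by rewrite /lpart insubN.
  by rewrite (lpart_in _ _ rA) (rpart_in _ _ rA) !inE /= => /ltW a; rewrite ltNge a.
rewrite card_join.
have -> : \prod_(x in Y0) (1 - chi (@ux R d Sigma F k k g x)) =
    \prod_(x in Y0) (match x with inl y => 1 - chi (du k (val y)) | inr y => 1 - chi (du k (val y)) end).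
  by apply/eq_bigr => -[y|y].
rewrite (@prod_join _ A A _ (fun r => 1 - chi (du k r)) (fun r => 1 - chi (du k r))).
exact: (signed_split (fun r => 1 - chi (du k r)) eA dA).
Qed.

End Diagonal.

Section LocalIdentity.
Variables (R : realType) (d : nat) (Sigma : {fset set 'rV[R]_d}) (F : fan_data Sigma).
Local Notation rays := (@rays R d Sigma F).
Variable v : 'rV[R]_d.
Hypothesis su : strongly_unimodular Sigma.
Hypothesis gen : sufficiently_generic Sigma v.

Definition meeting (g s t : Sigma) : Prop :=
  [/\ val g `<=` val s, val g `<=` val t, shift (val s) v `&` val t !=set0 & val s `&` val t = val g]%classic.

Lemma loc_out (s k : Sigma) : ~~ (rays s \subset rays k) -> loc F s k = 0.
Proof. by rewrite /loc => /negPf->. Qed.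

Lemma diag_signs (A : comNzRingType) (d' a n : nat) (x y : A) : (n = a + d')%N ->
  (-1) ^+ (n + a) * (x * x * ((-1) ^+ d' * y)) = x * y * x.
Proof.
move=> ->; have e : (-1) ^+ (a + d' + a) * (-1) ^+ d' = 1 :> A.
  by rewrite -exprD -addnA addnn -muln2 exprM sqrr_sign.
transitivity ((-1) ^+ (a + d' + a) * (-1) ^+ d' * (x * y * x)); last by rewrite e mul1r.
by move: (_ ^+ _) (_ ^+ _) {e} => s t; ring.
Qed.

Lemma local_identity (g k k' : Sigma) : ismax F k -> ismax F k' ->
  \sum_(s : Sigma) \sum_(t : Sigma | `[< meeting g s t >])
      (-1) ^+ (#|rays s| + #|rays t| + (d + #|rays g|)) * (loc F s k * loc F t k') =
  if k == k' then ray_prod k (rays k) * loc F g k else 0.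
Proof.
move=> km km'; rewrite pair_big_dep /=.
(* If g is not a face of k, neither is any s that contains g, and both sides vanish. *)
case: (boolP (rays g \subset rays k)) => gk; last first.
  rewrite big1 => [|[s t] /= /asboolP[/(rays_subP F) gs _ _ _]].
    by rewrite (loc_out gk) mulr0 if_same.
  have sk : ~~ (rays s \subset rays k) by apply: contra gk; exact: subset_trans.
  by rewrite (loc_out sk) mul0r mulr0.
case: (boolP (rays g \subset rays k')) => gk'; last first.
  rewrite big1 => [|[s t] /= /asboolP[_ /(rays_subP F) gs _ _]].
    by case: eqP => // e; move: gk'; rewrite -e gk.
  have tk : ~~ (rays t \subset rays k') by apply: contra gk'; exact: subset_trans.
  by rewrite (loc_out tk) !mulr0.
transitivity ((-1) ^+ (d + #|rays g|) * (loc F g k * loc F g k' * local_chambers F v k k' g)).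
  rewrite -(meeting_sum v km gk gk').
  rewrite [RHS]mulr_sumr.
  rewrite [LHS]big_mkcond [RHS]big_mkcond.
  apply/eq_bigr => -[s t] _.
  rewrite [(s, t).1]/= [(s, t).2]/=.
  case: (boolP (rays s \subset rays k)) => sk; last first.
    by rewrite andbF (loc_out sk) mul0r mulr0 if_same.
  case: (boolP (rays t \subset rays k')) => tk; last first.
    by rewrite !andbF (loc_out tk) !mulr0 if_same.
  rewrite /= mulrA -exprD addnC; congr (if _ then _ else _).
  apply/asboolP/and3P => [[/(rays_subP F) gs /(rays_subP F) gt a b]|[/(rays_subP F) gs /(rays_subP F) gt /asboolP[a b]]].
    by split=> //; apply/asboolP.
  by split.
case: eqP => [e|/(local_chambers_eq0 su gen km km' gk gk')->]; last by rewrite !mulr0.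
subst k'; rewrite (local_chambers_diag gen km gk) (ray_prodU _ gk) /loc gk.
have dE : d = (#|rays g| + #|rays k :\: rays g|)%N.
  by rewrite -[LHS](eqP km) -(cardsID (rays g) (rays k)) (setIidPr gk).
exact: (diag_signs _ _ dE).
Qed.

End LocalIdentity.

(** * Localization of Grothendieck weights *)

Section ShiftInduction.
Variables (R : realType) (d : nat) (Sigma : {fset set 'rV[R]_d}) (F : fan_data Sigma).
Local Notation ray := (ray F).
Local Notation vec := (@vec R d Sigma F).
Local Notation rays := (@rays R d Sigma F).
Local Notation du := (@du R d Sigma F).
Implicit Types (h : ray -> int) (S : {set ray}) (r : ray) (s k : Sigma) (u w : 'rV[int]_d).

Definition bump r h : ray -> int := fun q => h q + (q == r)%:Z.
Definition tilt u h : ray -> int := fun q => h q + ev u (vec q).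

Variables (A : comNzRingType) (z : 'rV[int]_d -> A).
Hypothesis zD : forall u w, z (u + w) = z u * z w.
Hypothesis z0 : z 0 = 1.
Hypothesis z_regular : forall w (a : A), w != 0 -> (1 - z w) * a = 0 -> a = 0.
(** Read [val_at S h a] as: the weight, extended linearly to classes of sheaves, takes the value a
    on F(S, h). Then [val_up] and [val_down] are the exact sequence, and [val_base] is the case of a
    twisted orbit closure. *)
Variables (cof g : Sigma -> A) (D : A) (val_at : {set ray} -> (ray -> int) -> A -> Prop).
Hypothesis denom_cof : forall k, ismax F k -> D = cof k * \prod_(r in rays k) (1 - z (du k r)).
Hypothesis val_fun : forall S h a b, val_at S h a -> val_at S h b -> a = b.
Hypothesis val_up : forall S h r a b, r \notin S ->
  val_at S h a -> val_at (r |: S) h b -> val_at S (bump r h) (a - b).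
Hypothesis val_down : forall S h r a b, r \notin S ->
  val_at S (bump r h) a -> val_at (r |: S) h b -> val_at S h (a + b).
Hypothesis val_out : forall S h, (forall s, ~~ (S \subset rays s)) -> val_at S h 0.
Hypothesis val_base : forall s u, val_at (rays s) (fun r => ev u (vec r)) (z u * g s).

Definition hvec k h : 'rV[int]_d := \sum_(r in rays k) du k r *~ h r.
(** The value on F(S, h) that localization predicts, multiplied by D. *)
Definition local_val S h : A :=
  \sum_(k | ismax F k && (S \subset rays k))
     cof k * \prod_(r in S) (1 - z (du k r)) * (z (hvec k h) * g k).

Lemma hvec_bump k r h : hvec k (bump r h) = if r \in rays k then hvec k h + du k r else hvec k h.
Proof.
rewrite /hvec /bump; under eq_bigr do rewrite mulrzDr.
rewrite big_split /=; case: ifPn => rk.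
  congr (_ + _); rewrite (bigD1 r) //= eqxx mulr1z big1 ?addr0 // => q /andP[_ /negPf->].
  by rewrite mulr0z.
rewrite [X in _ + X]big1 ?addr0 // => q qk; case: eqP => [e|]; last by rewrite mulr0z.
by rewrite -e qk in rk.
Qed.

Lemma hvec_tilt k u h : ismax F k -> hvec k (tilt u h) = hvec k h + u.
Proof.
move=> km; rewrite [in RHS](expand_max u km) /hvec -big_split.
by apply/eq_bigr => r _; rewrite /= mulrzDr.
Qed.

Lemma local_val_step S h r : r \notin S ->
  local_val S h = local_val S (bump r h) + local_val (r |: S) h.
Proof.
move=> rS; rewrite /local_val.
rewrite [LHS]big_mkcond [X in _ = X + _]big_mkcond [X in _ = _ + X]big_mkcond -big_split.
apply/eq_bigr => k _ /=; case: (ismax F k) => /=; last by rewrite addr0.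
rewrite subUset sub1set; case: (boolP (S \subset rays k)) => Sk; last by rewrite andbF addr0.
rewrite hvec_bump andbT; case: ifPn => rk; last by rewrite addr0.
rewrite zD big_setU1 //=.
by move: (cof k) (\prod_(_ in _) _) (z (hvec k h)) (z (du k r)) (g k) => a b c e f; ring.
Qed.

Lemma local_val_tilt S h u : local_val S (tilt u h) = z u * local_val S h.
Proof.
rewrite /local_val mulr_sumr; apply/eq_bigr => k /andP[km _].
rewrite hvec_tilt // zD.
by move: (cof k) (\prod_(_ in _) _) (z (hvec k h)) (z u) (g k) => a b c e f; ring.
Qed.

Lemma local_val_max k : ismax F k -> local_val (rays k) (fun=> 0) = D * g k.
Proof.
move=> km; rewrite /local_val (big_pred1 k) => [|k' /=]; last first.
  apply/andP/eqP => [[_ /(max_sub km)]//|->]; by split.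
have -> : hvec k (fun=> 0) = 0 by rewrite /hvec big1.
by rewrite z0 mul1r -denom_cof.
Qed.

Lemma tilt_bump u r h : tilt u (bump r h) = bump r (tilt u h).
Proof. by apply/funext => q; rewrite /tilt /bump addrAC. Qed.

Lemma tilt0 u : tilt u (fun=> 0) = fun r => ev u (vec r).
Proof. by apply/funext => q; rewrite /tilt add0r. Qed.

(* e is the defect of the localization formula for F(S, h); it does not change when h varies outside
   S, as long as the formula holds for the sets S + r. *)
Definition val_rel S h (a e : A) :=
  (forall u, val_at S (tilt u h) (z u * a)) /\ D * a - local_val S h = e.

(** Going from h to [h'] by unit steps at rays outside S, each step is an exact sequence whose third
    sheaf has no defect. The induction is on the total distance between h and [h']. *)
Lemma val_rel_path S (h h' : ray -> int) a e :
  (forall r h1, r \notin S -> exists b, val_rel (r |: S) h1 b 0) ->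
  (forall r, r \in S -> h r = h' r) -> val_rel S h a e -> exists b, val_rel S h' b e.
Proof.
move=> next; have [n] := ubnP (\sum_r `|h r - h' r|)%N.
elim: n h a => // n IH h a; rewrite ltnS => le hS ra.
have [eh|/existsNP[r /eqP nr]] := pselect (forall r, h r = h' r).
  by exists a; rewrite -(funext eh).
have rS : r \notin S by apply: contra nr => /hS ->.
have less (h1 : ray -> int) : (forall q, q != r -> h1 q = h q) -> (`|h1 r - h' r| < `|h r - h' r|)%N ->
    (\sum_q `|h1 q - h' q| < n)%N.
  move=> h1q h1r; apply: leq_trans le; rewrite (bigD1 r) //= [X in (_ < X)%N](bigD1 r) //=.
  rewrite (eq_bigr (fun q => `|h q - h' q|%N)) => [|q qr]; last by rewrite h1q.
  by rewrite ltn_add2r.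
have keep (h1 : ray -> int) : (forall q, q != r -> h1 q = h q) -> forall q, q \in S -> h1 q = h' q.
  move=> h1q q qS; rewrite h1q ?hS //; by apply: contraNneq rS => <-.
have [lt|ge] := ltP (h r) (h' r).
  have [b [vb eb]] := next r h rS; case: ra => va ea.
  apply: (IH (bump r h) (a - b)).
  - apply: less => [q /negPf qr|]; rewrite /bump ?qr ?addr0 ?eqxx //; lia.
  - by apply: keep => q /negPf qr; rewrite /bump qr addr0.
  split=> [u|].
    by rewrite tilt_bump mulrBr; apply: val_up.
  rewrite -ea (local_val_step h rS).
  rewrite mulrBr (subr0_eq eb); move: (D * a) (local_val _ _) (local_val _ _) => x y t; ring.
have [h0 eh0] : exists h0, bump r h0 = h.
  by exists (fun q => h q - (q == r)%:Z); apply/funext => q; rewrite /bump subrK.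
have h0r : h0 r = h r - 1 by rewrite -eh0 /bump eqxx addrK.
have h0q q : q != r -> h0 q = h q by rewrite -eh0 /bump => /negPf->; rewrite addr0.
have [b [vb eb]] := next r h0 rS; case: ra => va ea.
apply: (IH h0 (a + b)).
- apply: less => //; rewrite h0r; move/eqP: nr; lia.
- exact: keep.
split=> [u|].
  by rewrite mulrDr; apply: (val_down rS) => //; rewrite -tilt_bump eh0.
rewrite -ea (local_val_step h0 rS) eh0 mulrDr (subr0_eq eb).
by move: (D * a) (local_val _ _) (local_val _ _) => x y t; ring.
Qed.

Lemma val_rel_base s u : val_rel (rays s) (fun r => ev u (vec r)) (z u * g s)
  (z u * (D * g s - local_val (rays s) (fun=> 0))).
Proof.
split=> [w|]; last first.
  rewrite -tilt0 local_val_tilt.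
  by move: (z u) (g s) (local_val _ _) => x y t; ring.
rewrite mulrA -zD -[X in val_at _ X](_ : (fun r => ev (w + u) (vec r)) = _); first exact: val_base.
by apply/funext => r; rewrite /tilt evDl addrC.
Qed.

(** If S is the set of rays of a non-maximal cone, some nonzero w vanishes on it. Steps outside S
    lead from h = 0 to the values of w and keep the defect; but the end is a twist by w, whose
    defect is [z w] times the original. Since 1 - z w is regular, the defect is 0. *)
Lemma val_rel_step S h : (forall r h1, r \notin S -> exists b, val_rel (r |: S) h1 b 0) ->
  exists b, val_rel S h b 0.
Proof.
move=> next; have [[s eS]|no] := pselect (exists s, S \subset rays s); last first.
  exists 0; split=> [u|].
    by rewrite mulr0; apply: val_out => s; apply/negP => Ss; apply: no; exists s.
  rewrite mulr0 sub0r /local_val big_pred0 ?oppr0 // => k.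
  by apply/negP => /andP[_ Sk]; apply: no; exists k.
have {s eS}[s eS] := face_rays eS; subst S.
pose e0 := D * g s - local_val (rays s) (fun=> 0).
have e00 : e0 = 0.
  have [sm|sm] := boolP (ismax F s); first by rewrite /e0 local_val_max // subrr.
  have [w w0 ws] := nonmax sm; apply: (z_regular w0).
  have [|b [vb eb]] := val_rel_path (h' := fun r => ev w (vec r)) next _ (val_rel_base s 0).
    by move=> r rs; rewrite ev0l ws.
  have [vw ew] := val_rel_base s w.
  have {vb vw}e : z 0 * b = z 0 * (z w * g s) by apply: val_fun (vb 0) (vw 0).
  rewrite !z0 !mul1r in e eb; rewrite {}e {}ew -/e0 in eb.
  by rewrite mulrBl mul1r eb subrr.
(* This character agrees with h on the rays of s, so F(S, h) is reached from a twisted orbit closure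
   by steps outside S. *)
pose u := hvec s h.
have [|b] := val_rel_path (h' := h) next _ (val_rel_base s u).
  by move=> r rs; rewrite ev_suml (bigD1 r) //= evMzl du_vec // eqxx mul1r big1 ?addr0 // =>
    q /andP[qs /negPf qr]; rewrite evMzl du_vec // qr mul0r.
by rewrite -/e0 e00 mulr0; exists b.
Qed.

Lemma val_rel_exists S h : exists b, val_rel S h b 0.
Proof.
have [n] := ubnP #|~: S|; elim: n S h => // n IH S h; rewrite ltnS => le.
apply: val_rel_step => r h1 rS; apply: IH; apply: leq_trans le.
by apply: proper_card; rewrite setCU properE subsetIr /=; apply/subsetPn; exists r;
  rewrite !inE ?eqxx.
Qed.

Lemma shift_formula s : D * g s =
  \sum_(k | ismax F k && (rays s \subset rays k))
    cof k * \prod_(r in rays s) (1 - z (du k r)) * g k.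
Proof.
have [b [vb eb]] := val_rel_exists (rays s) (fun=> 0).
have [vw _] := val_rel_base s 0.
have e0 : (fun r => ev 0 (vec r)) = (fun=> 0) by apply/funext => r; rewrite ev0l.
rewrite e0 in vw; have := val_fun (vb 0) (vw 0); rewrite !z0 !mul1r => <-.
rewrite (subr0_eq eb); apply/eq_bigr => k _.
have -> : hvec k (fun=> 0) = 0 by rewrite /hvec big1.
by rewrite z0 mul1r.
Qed.

End ShiftInduction.

(** * Sheaves with weight spaces of dimension at most one *)

Section IndicatorSheaves.
Variables (R : realType) (K : fieldType) (d : nat).
Local Notation cone := (set 'rV[R]_d).
Local Notation M := ('rV[int]_d).

(** If the middle space is 0, so is the product, which is then the matrix of ones only when an outer
    space is 0 too. *)
Lemma const1_mul (a b c : bool) : (a -> c -> b) ->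
  (const_mx 1 : 'M[K]_(a, b)) *m (const_mx 1 : 'M_(b, c)) = const_mx 1.
Proof.
move=> abc; apply/matrixP => i j.
have a1 : a by case: (a) i => // -[].
have c1 : c by case: (c) j => // -[].
have b1 := abc a1 c1; move: b1 i j; clear; case: b => // _ i j.
by rewrite !mxE big_ord1 !mxE mulr1.
Qed.

Lemma const1_id (a : bool) : (const_mx 1 : 'M[K]_(a, a)) = 1%:M.
Proof.
apply/matrixP => i j; rewrite !mxE; case: a i j => [|[]//] i j.
by rewrite !ord1.
Qed.

Lemma bool_row0 (a : bool) (x : 'rV[K]_a) : ~~ a -> x = 0.
Proof. by case: a x => // x _; apply/rowP => -[]. Qed.

Lemma const1_mul0 (a b c : bool) : ~~ (a && c) ->
  (const_mx 1 : 'M[K]_(a, b)) *m (const_mx 1 : 'M_(b, c)) = 0.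
Proof.
case: a => [|_]; last by apply/matrixP => -[].
by case: c => // _; apply/matrixP => i [].
Qed.

Lemma const1_gen (a b : bool) (y : 'rV[K]_b) : a ->
  y = (\sum_j y 0 j) *: ((const_mx 1 : 'rV_a) *m (const_mx 1 : 'M_(a, b))).
Proof.
move=> a1; rewrite (@const1_mul true a b) //; apply/rowP => j; case: b y j => [|y []//] y j.
by rewrite !mxE big_ord1 mulr1 !ord1.
Qed.

Lemma const1_rank (a b : bool) : \rank (const_mx 1 : 'M[K]_(a, b)) = (a && b) :> nat.
Proof.
case: a b => -[] /=.
- by rewrite (const1_id true) mxrank1.
- by apply/eqP; rewrite -leqn0 rank_leq_col.
- by apply/eqP; rewrite -leqn0 rank_leq_row.
- by apply/eqP; rewrite -leqn0 rank_leq_row.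
Qed.

Definition isheaf (P : cone -> M -> bool) : tsheaf R K d :=
  @TSheaf R K d (fun kappa m => P kappa m : nat) (fun kappa tau m m' => const_mx 1).

Variable Sigma : {fset cone}.

(** The last condition makes [P'] a subsheaf: a restriction that does not vanish in P stays in
    [P']. *)
Lemma isheaf_exact (P' P P'' : cone -> M -> bool) :
  (forall kappa m, kappa \in Sigma -> P kappa m = P' kappa m || P'' kappa m) ->
  (forall kappa m, kappa \in Sigma -> ~~ (P' kappa m && P'' kappa m)) ->
  (forall kappa tau m m', kappa \in Sigma -> tau \in Sigma -> (tau `<=` kappa)%classic ->
     dual_monoid tau (m' - m) -> P' kappa m -> P tau m' -> P' tau m') ->
  short_exact Sigma (isheaf P') (isheaf P) (isheaf P'').
Proof.
move=> PU PI c1.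
exists (fun kappa m => const_mx 1), (fun kappa m => const_mx 1); split.
- move=> kappa tau m m' kS tS tk dm /=; rewrite !const1_mul //.
    by move=> p' _; rewrite PU // p'.
  by move=> p' p; apply: (c1 kappa tau m m').
- move=> kappa tau m m' kS tS tk dm /=; rewrite !const1_mul //.
    move=> p p''; move: p; rewrite PU // => /orP[p'|//].
    have pt : P tau m' by rewrite PU // p'' orbT.
    by have := PI tau m' tS; rewrite (c1 kappa tau m m') // p''.
  by move=> _ p''; rewrite PU // p'' orbT.
- move=> kappa m kS /=; have := PU kappa m kS; have pi := PI kappa m kS.
  have le : ((const_mx 1 : 'M[K]_(P' kappa m, P kappa m)) <= kermx (const_mx 1 : 'M[K]_(P kappa m, P'' kappa m)))%MS.
    by apply/sub_kermxP/const1_mul0.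
  rewrite -(mxrank_leqif_eq le) /row_free /row_full mxrank_ker !const1_rank.
  by move: pi {le}; case: (P' kappa m) (P'' kappa m) (P kappa m) => -[] [].
Qed.

(** In order, the conditions give functoriality of the restrictions, lifting of sections to the
    larger open set, annihilation of sections that restrict to 0, and modules that are zero or
    cyclic. *)
Lemma isheaf_coherent (P : cone -> M -> bool) :
  (forall kappa tau rho m m' m'', kappa \in Sigma -> tau \in Sigma -> rho \in Sigma ->
     (tau `<=` kappa)%classic -> (rho `<=` tau)%classic ->
     dual_monoid tau (m' - m) -> dual_monoid rho (m'' - m') ->
     P kappa m -> P rho m'' -> P tau m') ->
  (forall kappa tau m, kappa \in Sigma -> tau \in Sigma -> (tau `<=` kappa)%classic ->
     P tau m -> exists u, [/\ dual_monoid kappa u, perp tau u & P kappa (m + u)]) ->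
  (forall kappa tau m, kappa \in Sigma -> tau \in Sigma -> (tau `<=` kappa)%classic ->
     P kappa m -> ~~ P tau m -> exists u, [/\ dual_monoid kappa u, perp tau u & ~~ P kappa (m + u)]) ->
  (forall kappa, kappa \in Sigma -> (forall m, ~~ P kappa m) \/
     exists2 w, P kappa w & forall m, P kappa m -> dual_monoid kappa (m - w)) ->
  coherent Sigma (isheaf P).
Proof.
move=> h2 h3 h4 h5.
have d0 (s : cone) : dual_monoid s (0 : M).
  by move=> x _; rewrite toR0 dotC dot0r.
have p0 (s : cone) : perp s (0 : M).
  by move=> x _; rewrite toR0 dotC dot0r.
split.
  split=> [kappa m kS|kappa tau rho m m' m'' kS tS rS tk rt dt dr|kappa tau m kS tS tk] /=.
  - exact: const1_id.
  - by apply: const1_mul; exact: h2.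
  split=> [y|x].
    have [u [du pu Pu]] : exists u, [/\ dual_monoid kappa u, perp tau u & P tau m -> P kappa (m + u)].
      case: (boolP (P tau m)) => pm; last by exists 0.
      by have [u [a b c]] := h3 kappa tau m kS tS tk pm; exists u.
    exists u, (y *m const_mx 1); split=> //.
    by rewrite -mulmxA const1_mul // => /Pu.
  move=> x0; have [pt|pt] := boolP (P tau m).
    exists 0; split=> //; rewrite (_ : x = 0) ?mul0mx //.
    have : x *m (const_mx 1 : 'M_(P kappa m, P tau m)) *m (const_mx 1 : 'M_(P tau m, P kappa m)) = 0.
      by rewrite x0 mul0mx.
    by rewrite -mulmxA const1_mul // const1_id mulmx1.
  have [pk|pk] := orP (orbN (P kappa m)); last by exists 0; split=> //; rewrite (bool_row0 x pk) mul0mx.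
  have [u [du pu Pu]] := h4 kappa tau m kS tS tk pk pt; exists u; split=> //.
  exact: bool_row0.
move=> kappa kS; have [no|[w Pw wP]] := h5 kappa kS.
  exists 0, (fun=> 0), (fun=> 0) => m y; exists (fun=> 0); first by move=> [].
  by rewrite big_ord0; apply: bool_row0; exact: no.
exists 1, (fun=> w), (fun=> const_mx 1) => m y.
exists (fun=> \sum_j y 0 j) => [_|].
  case: (boolP (P kappa m)) => [/wP//|pm]; rewrite big1 ?eqxx // => j _.
  by rewrite (bool_row0 y pm) mxE.
rewrite big_ord1; exact: const1_gen.
Qed.

End IndicatorSheaves.

Section RaySheaves.
Variables (R : realType) (K : fieldType) (d : nat) (Sigma : {fset set 'rV[R]_d}) (F : fan_data Sigma).
Local Notation cone := (set 'rV[R]_d).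
Local Notation M := ('rV[int]_d).
Local Notation ray := (ray F).
Local Notation vec := (@vec R d Sigma F).
Local Notation rays := (@rays R d Sigma F).
Local Notation du := (@du R d Sigma F).
Implicit Types (S : {set ray}) (h : ray -> int) (s t k : Sigma) (m u : M).
Local Notation isheaf := (@isheaf R K d).

(* The weight spaces of the structure sheaf of the intersection of the divisors of S, twisted by
   the divisor with multiplicity - h r along the ray r; this is the
   sheaf F(S, h) of the header. *)
Definition ray_ind S h (kappa : cone) m : bool :=
  `[< [/\ forall r, r \in S -> kappa (toR R (vec r)), forall r, r \in S -> ev m (vec r) = h r &
          forall r, kappa (toR R (vec r)) -> h r <= ev m (vec r)] >].

Lemma ray_indP S h s m : reflect
  [/\ S \subset rays s, forall r, r \in S -> ev m (vec r) = h r & forall r, r \in rays s -> h r <= ev m (vec r)]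
  (ray_ind S h (val s) m).
Proof.
have sE r : r \in rays s <-> val s (toR R (vec r)).
  by rewrite (in_rays s r); split=> [/asboolP//|?]; apply/asboolP.
apply: (iffP (asboolP _)) => -[a b c]; split=> //.
- by apply/subsetP => r /a/sE.
- by move=> r /sE; exact: c.
- by move=> r /(subsetP a)/sE.
- by move=> r /sE; exact: c.
Qed.

Lemma ray_ind_mono S h s t m m' : rays t \subset rays s -> S \subset rays t ->
  dual_monoid (val t) (m' - m) ->
  ray_ind S h (val s) m -> (forall r, r \in S -> ev m' (vec r) <= h r) -> ray_ind S h (val t) m'.
Proof.
move=> /subsetP ts St /dual_monoidE dm /ray_indP[_ b c] up.
have mono r : r \in rays t -> ev m (vec r) <= ev m' (vec r).
  by move=> /dm; rewrite evDl evNl subr_ge0.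
apply/ray_indP; split=> // [r rS|r rt].
  by apply/eqP; rewrite eq_le up // -{1}(b r rS) mono // (subsetP St).
exact: le_trans (c r (ts _ rt)) (mono r rt).
Qed.

Lemma cone_var (Q : cone -> Prop) : (forall s : Sigma, Q (val s)) -> forall kappa, kappa \in Sigma -> Q kappa.
Proof. by move=> h kappa kS; exact: (h [` kS]%fset). Qed.

(** Agreement with [ray_ind] is asked on the cones of the fan only, so that twisted orbit closures
    are covered as well. *)
Lemma isheaf_ray_coherent S h (P : cone -> M -> bool) :
  (forall s m, P (val s) m = ray_ind S h (val s) m) -> coherent Sigma (isheaf P).
Proof.
move=> eP; apply: isheaf_coherent.
- move=> kappa tau rho m m' m'' kS tS rS; move: kappa kS tau tS rho rS.
  apply: cone_var => s; apply: cone_var => t; apply: cone_var => q; rewrite !eP.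
  move=> /(rays_subP F) ts /(rays_subP F) qt dm dm' sm /ray_indP[Sq eq _].
  have St := subset_trans Sq qt; apply: (ray_ind_mono ts St dm sm) => r rS.
  rewrite -(eq r rS) -subr_ge0 -evNl -evDl.
  by move/(dual_monoidE F q): dm' => /(_ r (subsetP Sq r rS)).
- move=> kappa tau m kS tS; move: kappa kS tau tS.
  apply: cone_var => s; apply: cone_var => t /(rays_subP F) ts.
  (* The multiplicity [c r] is large enough for u to lift m above h on the rays of s outside t. *)
  rewrite eP => /ray_indP[St eS ge]; pose c r : int := `|h r - ev m (vec r)|%N.
  pose u := \sum_(r in rays s :\: rays t) du s r *~ c r.
  have uE r : r \in rays s -> ev u (vec r) = if r \in rays t then 0 else c r.
    by move=> rs; rewrite ev_sum_du ?subsetDl // in_setD rs andbT; case: ifP => [/negPf->|/negbFE->].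
  exists u; split.
  + by apply/(dual_monoidE F) => r rs; rewrite uE //; case: ifP.
  + by apply/(perpE F) => r rt; rewrite uE ?rt // (subsetP ts).
  + rewrite eP; apply/ray_indP; split=> [|r rS|r rs]; first exact: subset_trans ts.
      by rewrite evDl uE ?(subsetP (subset_trans St ts)) // (subsetP St) // addr0 eS.
    rewrite evDl uE //; case: ifP => [rt|_]; first by rewrite addr0 ge.
    by rewrite /c; lia.
- move=> kappa tau m kS tS; move: kappa kS tau tS.
  apply: cone_var => s; apply: cone_var => t /(rays_subP F) ts; rewrite !eP => /ray_indP[Ss eS ge] nt.
  have [q qS qt] : exists2 q, q \in S & q \notin rays t.
    apply/subsetPn; apply: contra nt => St; apply/ray_indP; split=> // r rt.
    by apply: ge; exact: (subsetP ts).
  have qs := subsetP Ss q qS.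
  exists (du s q); split.
  + by apply/(dual_monoidE F) => r rs; rewrite du_vec.
  + apply/(perpE F) => r rt; rewrite (du_vec qs (subsetP ts r rt)).
    by case: (eqVneq q r) => [e|//]; move: qt; rewrite e rt.
  + rewrite eP; apply/negP => /ray_indP[_ /(_ q qS)]; rewrite evDl du_vec // eS // eqxx; lia.
- apply: cone_var => s; have [Ss|Ss] := boolP (S \subset rays s); last first.
    by left=> m; rewrite eP; apply/negP => /ray_indP[a]; rewrite a in Ss.
  right; exists (\sum_(r in rays s) du s r *~ h r) => [|m]; rewrite eP.
    apply/ray_indP; split=> // r rS; rewrite ev_sum_du // ?rS ?(subsetP Ss) //.
  by move=> /ray_indP[_ _ ge]; apply/(dual_monoidE F) => r rs; rewrite evDl evNl subr_ge0 ev_sum_du // rs ge.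
Qed.

(** At a ray r, a value that is at least h r is either at least h r + 1 or equal to h r; the second
    case is the quotient, supported on the divisor of r. *)
Lemma isheaf_ray_exact S h r : r \notin S ->
  short_exact Sigma (isheaf (ray_ind S (bump r h))) (isheaf (ray_ind S h)) (isheaf (ray_ind (r |: S) h)).
Proof.
move=> rS; have bS q : q \in S -> bump r h q = h q.
  by rewrite /bump => qS; case: eqP => [e|_]; [rewrite -e qS in rS|rewrite addr0].
have le_bump q : h q <= bump r h q by rewrite /bump lerDl; case: eqP.
apply: isheaf_exact.
- move=> kappa m kS; move: kappa kS; apply: cone_var => s.
  apply/idP/orP => [/ray_indP[Ss eS ge]|].
    have [/andP[rs /eqP e]|ne] := boolP ((r \in rays s) && (ev m (vec r) == h r)).
      right; apply/ray_indP; split=> // [|q]; first by rewrite subUset sub1set rs.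
      by rewrite in_setU1 => /orP[/eqP->|/eS].
    left; apply/ray_indP; split=> // q qs; first by rewrite bS // eS.
    rewrite /bump; case: eqP => [e|_]; last by rewrite addr0 ge.
    by have := ge q qs; move: ne; rewrite -e qs /=; move: (ev _ _) (h _) => x y; lia.
  case=> /ray_indP[Ss eS ge]; apply/ray_indP; split=> //.
  + by move=> q qS; rewrite eS // bS.
  + by move=> q /ge; exact: le_trans.
  + by apply: subset_trans Ss; exact: subsetUr.
  + by move=> q qS; apply: eS; rewrite in_setU1 qS orbT.
- move=> kappa m kS; move: kappa kS; apply: cone_var => s.
  apply/negP => /andP[/ray_indP[_ _ ge] /ray_indP[Ss eS _]].
  have := ge r; rewrite (subsetP Ss) ?in_setU1 ?eqxx // => /(_ isT).
  by rewrite eS ?in_setU1 ?eqxx // /bump eqxx; lia.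
- move=> kappa tau m m' kS tS; move: kappa kS tau tS.
  apply: cone_var => s; apply: cone_var => t /(rays_subP F) ts dm sm /ray_indP[St eS ge].
  apply: (ray_ind_mono ts St dm sm) => q qS; by rewrite bS // eS.
Qed.

End RaySheaves.

Section WeightLocalization.
Variables (R : realType) (K : fieldType) (d : nat) (Sigma : {fset set 'rV[R]_d}) (F : fan_data Sigma).
Local Notation cone := (set 'rV[R]_d).
Local Notation M := ('rV[int]_d).
Local Notation ray := (ray F).
Local Notation vec := (@vec R d Sigma F).
Local Notation rays := (@rays R d Sigma F).
Implicit Types (S : {set ray}) (h : ray -> int) (s t k : Sigma) (m u : M).
Local Notation isheaf := (@isheaf R K d).
Local Notation tsheaf := (tsheaf R K d).
Variable g : Sigma -> RT d.
Hypothesis gw : gweight K g.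

(** The formal sum of the a_s [O_V(s)]: evaluating the convolution at 0 on a function of [- p] pairs
    the coefficient at p with the twist by p. *)
Definition orbit_sum (a : Sigma -> RT d) : tsheaf -> int := fun G =>
  \sum_(s : Sigma) act (a s) (fun p => cls (twist (- p) (orbit_closure_sheaf K (val s))) G) 0.

(** The graph of the functional that g defines on the span of the orbit closures in K_T(X); the
    weight condition makes it single-valued ([value_fun]). *)
Definition has_value (z : tsheaf -> int) (y : RT d) := exists a : Sigma -> RT d,
  KT_zero Sigma (fun G => z G - orbit_sum a G) /\ y = \sum_s a s * g s.

Lemma orbit_sumB a b G : orbit_sum (fun s => a s - b s) G = orbit_sum a G - orbit_sum b G.
Proof. by rewrite /orbit_sum -sumrB; apply/eq_bigr => s _; rewrite actD actN. Qed.

Lemma orbit_sum_zero a : KT_zero Sigma (orbit_sum a) -> \sum_s a s * g s = 0.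
Proof.
move=> az; apply: gw; rewrite (_ : (fun G => _) = orbit_sum a) //.
apply/funext => G; apply/eq_bigr => s _; apply/eq_bigr => p _.
by rewrite sub0r opprK.
Qed.

Lemma valueB z w y y' : has_value z y -> has_value w y' -> has_value (fun G => z G - w G) (y - y').
Proof.
move=> [a [za ->]] [b [wb ->]]; exists (fun s => a s - b s); split.
  have := KT_zeroB za wb; congr KT_zero; apply/funext => G.
  by rewrite orbit_sumB; move: (z G) (w G) (orbit_sum a G) (orbit_sum b G) => *; ring.
by rewrite -sumrB; apply/eq_bigr => s _; rewrite mulrBl.
Qed.

Lemma value0 z : KT_zero Sigma z -> has_value z 0.
Proof.
move=> zz; exists (fun=> 0); split; last by rewrite big1 // => s _; rewrite mul0r.
rewrite (_ : (fun G => _) = z) //; apply/funext => G.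
by rewrite /orbit_sum big1 ?subr0 // => s _; rewrite act0.
Qed.

Lemma value_fun z y y' : has_value z y -> has_value z y' -> y = y'.
Proof.
move=> [a [za ->]] [b [zb ->]]; apply/eqP; rewrite -subr_eq0 -sumrB; apply/eqP.
rewrite -[RHS](@orbit_sum_zero (fun s => a s - b s)).
  by apply/eq_bigr => s _; rewrite mulrBl.
have := KT_zeroB zb za; congr KT_zero; apply/funext => G.
by rewrite orbit_sumB; move: (z G) (orbit_sum a G) (orbit_sum b G) => *; ring.
Qed.

Lemma value_ext z w y y' : has_value z y -> z =1 w -> y = y' -> has_value w y'.
Proof. by move=> zy /funext <- <-. Qed.

Definition val_at S h y := has_value (cls (isheaf (ray_ind S h))) y.

Lemma ray_coherent S h : coherent Sigma (isheaf (ray_ind S h)).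
Proof. exact: isheaf_ray_coherent. Qed.

Lemma ray_relation S h r : r \notin S -> has_value (fun G =>
  cls (isheaf (ray_ind S h)) G - cls (isheaf (ray_ind S (bump r h))) G - cls (isheaf (ray_ind (r |: S) h)) G) 0.
Proof.
move=> rS; apply: value0; apply: KT_zero_exact; try exact: ray_coherent.
exact: isheaf_ray_exact.
Qed.

Lemma value_up S h r a b : r \notin S ->
  val_at S h a -> val_at (r |: S) h b -> val_at S (bump r h) (a - b).
Proof.
move=> rS va vb; apply: value_ext (valueB (valueB va vb) (ray_relation h rS)) _ _; last by rewrite subr0.
by move=> G /=; move: (cls _ G) (cls _ G) (cls _ G) => *; ring.
Qed.

Lemma value_down S h r a b : r \notin S ->
  val_at S (bump r h) a -> val_at (r |: S) h b -> val_at S h (a + b).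
Proof.
move=> rS va vb; have v0 := value0 (@KT_zero0 R K d Sigma).
apply: value_ext (valueB (valueB (ray_relation h rS) (valueB v0 va)) (valueB v0 vb)) _ _.
  by move=> G /=; move: (cls _ G) (cls _ G) (cls _ G) => *; ring.
by rewrite !sub0r !opprK.
Qed.

Lemma value_out S h : (forall s, ~~ (S \subset rays s)) -> val_at S h 0.
Proof.
move=> no; have P0 kappa m : kappa \in Sigma -> ray_ind S h kappa m = false.
  move=> kS; move: kappa kS; apply: cone_var => s; apply/negP => /ray_indP[Ss].
  by have := no s; rewrite Ss.
have v0 := value0 (@KT_zero0 R K d Sigma).
(* This sheaf is 0, so three copies of it form an exact sequence, which says that its class
   vanishes. *)
have ex : short_exact Sigma (isheaf (ray_ind S h)) (isheaf (ray_ind S h)) (isheaf (ray_ind S h)).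
  apply: isheaf_exact => [kappa m kS|kappa m kS|kappa tau m m' kS tS _ _]; rewrite ?P0 //.
have c := ray_coherent S h.
apply: value_ext (valueB v0 (value0 (KT_zero_exact c c c ex))) _ _; last by rewrite subr0.
by move=> G /=; move: (cls _ G) => *; ring.
Qed.

Lemma value_twist s u : has_value (cls (twist u (orbit_closure_sheaf K (val s)))) (chi u * g s).
Proof.
exists (fun t => if t == s then chi u else 0); split; last first.
  by rewrite (bigD1 s) //= eqxx big1 ?addr0 // => t /negPf ->; rewrite mul0r.
suff e G : cls (twist u (orbit_closure_sheaf K (val s))) G -
    orbit_sum (fun t => if t == s then chi u else 0) G = 0 by rewrite (funext e); exact: KT_zero0.
rewrite /orbit_sum (bigD1 s) //= eqxx big1 ?addr0 => [|t /negPf ->]; last exact: act0.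
by rewrite act_chi sub0r opprK subrr.
Qed.

(** The twisted orbit closure has the weight spaces of F(S, h) on the fan, but it is another record,
    hence another generator of formal sums. An exact sequence with third term 0 identifies the two
    classes. *)
Lemma value_base s u : val_at (rays s) (fun r => ev u (vec r)) (chi u * g s).
Proof.
pose P (kappa : cone) m : bool :=
  `[< [/\ (val s `<=` kappa)%classic, dual_monoid kappa (m - u) & perp (val s) (m - u)] >].
have PE t m : P (val t) m = ray_ind (rays s) (fun r => ev u (vec r)) (val t) m.
  apply/asboolP/ray_indP => [[/(rays_subP F) st /(dual_monoidE F) dm /(perpE F) pm]|[st e ge]].
    split=> // r rs; first by apply/eqP; rewrite -subr_eq0 -evNl -evDl pm.
    by rewrite -subr_ge0 -evNl -evDl dm.
  split; first exact/(rays_subP F).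
    by apply/(dual_monoidE F) => r rt; rewrite evDl evNl subr_ge0 ge.
  by apply/(perpE F) => r rt; rewrite evDl evNl e // subrr.
have ez : twist u (orbit_closure_sheaf K (val s)) = isheaf P by [].
pose Z : cone -> M -> bool := fun _ _ => false.
have cZ : coherent Sigma (isheaf Z) by apply: isheaf_coherent => // kappa kS; left.
have cT : coherent Sigma (isheaf P) by exact: isheaf_ray_coherent PE.
have v0 := value0 (@KT_zero0 R K d Sigma).
have exT : short_exact Sigma (isheaf (ray_ind (rays s) (fun r => ev u (vec r)))) (isheaf P) (isheaf Z).
  apply: isheaf_exact => [kappa m kS|kappa m kS|kappa tau m m' kS tS _ _ _]; rewrite ?orbF ?andbF //.
    by move: kappa kS; apply: cone_var => t; rewrite PE.
  by move: tau tS; apply: cone_var => t; rewrite PE.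
have exZ : short_exact Sigma (isheaf Z) (isheaf Z) (isheaf Z) by apply: isheaf_exact.
have vZ := value0 (KT_zero_exact cZ cZ cZ exZ).
have vE := value0 (KT_zero_exact (ray_coherent _ _) cT cZ exT).
have vT := value_twist s u; rewrite ez in vT.
apply: value_ext (valueB (valueB vT vE) (valueB v0 vZ)) _ _; last by rewrite !subr0.
by move=> G /=; move: (cls _ G) (cls _ G) (cls _ G) => *; ring.
Qed.

Lemma weight_localization s :
  denom F * g s = \sum_(k | ismax F k) cofactor_max F k * loc F s k * g k.
Proof.
rewrite (@shift_formula _ _ _ F _ (@chi d) (@chiD d) (@chi0 d) _ (cofactor_max F) g (denom F) val_at).
- rewrite [LHS]big_mkcondr; apply/eq_bigr => k km; rewrite /loc /ray_prod.
  by case: (rays s \subset rays k); [reflexivity|rewrite mulr0 mul0r].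
- by move=> w a w0; apply: regular_chi.
- by move=> k km; rewrite (denomE km).
- by move=> S h a b; apply: value_fun.
- exact: value_up.
- exact: value_down.
- exact: value_out.
- exact: value_base.
Qed.

End WeightLocalization.

(** * Classes of vector bundles and the product formula *)

Section DiagonalPairing.
Variables (A : comNzRingType) (T : finType) (P : pred T) (Q : T -> T -> bool).
Variables (D : A) (c q lg : T -> A) (L sg : T -> T -> A).
Hypothesis DE : forall k, P k -> D = c k * q k.
Hypothesis diag : forall k k', P k -> P k' ->
  \sum_s \sum_(t | Q s t) sg s t * (L s k * L t k') = if k == k' then q k * lg k else 0.

(** By [diag] the columns of L pair diagonally, so pairing x with the column of k isolates the
    contribution of k; the factor [q k] recombines with [c k] into D. *)
Lemma pairing_left (x a : T -> A) k : (forall s, D * x s = \sum_(k | P k) c k * L s k * a k) -> P k ->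
  D * (\sum_s \sum_(t | Q s t) sg s t * (x s * L t k)) = D * (lg k * a k).
Proof.
move=> xE Pk; transitivity (\sum_(k' | P k') (c k' * a k') *
    (\sum_s \sum_(t | Q s t) sg s t * (L s k' * L t k))).
  rewrite mulr_sumr; under [RHS]eq_bigr do rewrite mulr_sumr.
  rewrite exchange_big; apply/eq_bigr => s _ /=.
  rewrite mulr_sumr; under [RHS]eq_bigr do rewrite mulr_sumr.
  rewrite exchange_big; apply/eq_bigr => t _ /=.
  transitivity (sg s t * L t k * (D * x s)); first by ring.
  by rewrite xE mulr_sumr; apply/eq_bigr => k' _; ring.
rewrite (bigD1 k) //= diag // eqxx big1 => [|k' /andP[Pk' /negPf k'k]].
  by rewrite addr0 (DE Pk); ring.
by rewrite diag // k'k mulr0.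
Qed.

(** Each of x and y is known only after multiplication by D, which therefore appears twice. *)
Lemma pairing_both (x y a b : T -> A) :
  (forall s, D * x s = \sum_(k | P k) c k * L s k * a k) ->
  (forall s, D * y s = \sum_(k | P k) c k * L s k * b k) ->
  D * (D * (\sum_s \sum_(t | Q s t) sg s t * (x s * y t))) =
  D * (\sum_(k | P k) c k * lg k * (a k * b k)).
Proof.
move=> xE yE; transitivity (\sum_(k | P k) (c k * b k) *
    (D * (\sum_s \sum_(t | Q s t) sg s t * (x s * L t k)))).
  under [RHS]eq_bigr do rewrite mulrCA.
  rewrite -[RHS]mulr_sumr; congr (D * _); rewrite mulr_sumr.
  under [RHS]eq_bigr do rewrite mulr_sumr.
  rewrite exchange_big; apply/eq_bigr => s _ /=.
  rewrite mulr_sumr; under [RHS]eq_bigr do rewrite mulr_sumr.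
  rewrite exchange_big; apply/eq_bigr => t _ /=.
  transitivity (sg s t * x s * (D * y t)); first by ring.
  by rewrite yE mulr_sumr; apply/eq_bigr => k _; ring.
rewrite mulr_sumr; apply/eq_bigr => k Pk; rewrite (pairing_left xE Pk); ring.
Qed.

End DiagonalPairing.

Lemma sign_exprz (a b c e : nat) :
  (-1) ^ (a%:Z + b%:Z - c%:Z + e%:Z) = (-1) ^+ (a + b + (c + e)) :> int.
Proof.
have u1 : (-1 : int) \is a GRing.unit by [].
have -> : a%:Z + b%:Z - c%:Z + e%:Z = (a + b + (c + e))%N%:Z - (c + c)%N%:Z by lia.
by rewrite exprzDr // -exprz_inv invrN1 -!exprnP addnn -muln2 exprM sqrr_sign mulr1.
Qed.

Lemma mulz_sign (A : comNzRingType) (x : A) n : x *~ (-1) ^+ n = (-1) ^+ n * x.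
Proof. by rewrite -signr_odd -[X in _ = X * _]signr_odd; case: odd; rewrite ?mulN1r ?mulrN1z ?mul1r. Qed.

Lemma mulrz_mul (A : comNzRingType) (x y : A) (a b : int) : (x * y) *~ (a * b) = x *~ a * (y *~ b).
Proof. by rewrite mulrzAl mulrzAr -mulrzA (mulrC b). Qed.

Lemma mulz_sum_exchange (A : comNzRingType) (J T : finType) (P : pred T) (D : A) (c : T -> A)
    (x : J -> A) (b : J -> T -> A) (n : J -> int) :
  (forall j, D * x j = \sum_(k | P k) c k * b j k) ->
  D * (\sum_j x j *~ n j) = \sum_(k | P k) c k * (\sum_j b j k *~ n j).
Proof.
move=> xE; rewrite mulr_sumr; under [RHS]eq_bigr do rewrite mulr_sumr.
rewrite [RHS]exchange_big; apply/eq_bigr => j _ /=.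
by rewrite mulrzAr xE mulrz_suml; apply/eq_bigr => k _; rewrite mulrzAr.
Qed.

Section Classes.
Variables (R : realType) (K : fieldType) (d : nat) (Sigma : {fset set 'rV[R]_d}) (F : fan_data Sigma).
Local Notation cone := (set 'rV[R]_d).
Local Notation M := ('rV[int]_d).
Local Notation ray := (ray F).
Local Notation vec := (@vec R d Sigma F).
Local Notation rays := (@rays R d Sigma F).
Local Notation du := (@du R d Sigma F).
Implicit Types (s t k : Sigma) (m u : M).
Local Notation kclass := (kclass R K d).
Local Notation vbundle := (vbundle R K d).

Lemma dual_monoidD (s : cone) m u : dual_monoid s m -> dual_monoid s u -> dual_monoid s (m + u).
Proof. by move=> dm dn x sx; rewrite toRD dotDl addr_ge0 ?dm ?dn. Qed.

Lemma vtensor_vbundle (E G : vbundle) : is_vbundle Sigma E -> is_vbundle Sigma G ->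
  is_vbundle Sigma (vtensor E G).
Proof.
move=> [e1 e2 e3 e4] [f1 f2 f3 f4]; split.
- move=> kappa tau [i i'] [j j'] kS tS tk /=; rewrite mulf_eq0 negb_or => /andP[a b].
  rewrite opprD addrACA; exact: dual_monoidD (e1 _ _ _ _ kS tS tk a) (f1 _ _ _ _ kS tS tk b).
- move=> kappa [i i'] [j j'] kS /=; rewrite e2 // f2 // -natrM mulnb.
  by [].
- move=> kappa tau rho [i i'] [l l'] kS tS rS tk rt /=.
  rewrite -(e3 _ _ _ _ _ kS tS rS tk rt) -(f3 _ _ _ _ _ kS tS rS tk rt) big_distrlr pair_bigA.
  by apply/eq_bigr => -[j j'] _ /=; rewrite mulrACA.
- move=> kappa tau kS tS tk.
  have [c [c1 c2 c3]] := e4 _ _ kS tS tk; have [c' [c1' c2' c3']] := f4 _ _ kS tS tk.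
  exists (fun j i => c j.1 i.1 * c' j.2 i.2); split.
  + move=> [j j'] [i i'] /=; rewrite mulf_eq0 negb_or => /andP[a b].
    by rewrite opprD addrACA; apply: dual_monoidD; [exact: c1|exact: c1'].
  + move=> [i i'] [l l'] /=; rewrite xpair_eqE -mulnb natrM -c2 -c2' big_distrlr pair_bigA.
    by apply/eq_bigr => -[j j'] _ /=; rewrite mulrACA.
  + move=> [i i'] [l l'] /=; rewrite xpair_eqE -mulnb natrM -c3 -c3' big_distrlr pair_bigA.
    by apply/eq_bigr => -[j j'] _ /=; rewrite mulrACA.
Qed.

Definition class_at (alpha : kclass) k : RT d :=
  \sum_(j : kidx alpha) bundle_at (kbundle alpha j) k *~ kcoef alpha j.

Lemma bundle_at_tensor (E G : vbundle) k : bundle_at (vtensor E G) k = bundle_at E k * bundle_at G k.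
Proof.
rewrite /bundle_at big_distrlr pair_bigA; apply/eq_bigr => -[i j] _; exact: chiD.
Qed.

Lemma class_at_mul alpha beta k : class_at (kmul alpha beta) k = class_at alpha k * class_at beta k.
Proof.
rewrite /class_at big_distrlr pair_bigA; apply/eq_bigr => -[i j] _ /=.
by rewrite bundle_at_tensor mulrz_mul.
Qed.

Lemma is_kclass_mul (alpha beta : kclass) : is_kclass Sigma alpha -> is_kclass Sigma beta ->
  is_kclass Sigma (kmul alpha beta).
Proof. by move=> a b [i j]; apply: vtensor_vbundle. Qed.

(** The image of the classes of bundles under restriction to the torus-fixed points, one for each
    maximal cone. *)
Definition realizable (f : Sigma -> RT d) := exists2 alpha : kclass, is_kclass Sigma alpha &
  forall k, ismax F k -> class_at alpha k = f k.

Lemma realizableM f f' : realizable f -> realizable f' -> realizable (fun k => f k * f' k).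
Proof.
move=> [a ka fa] [b kb fb]; exists (kmul a b); first exact: is_kclass_mul.
by move=> k km; rewrite class_at_mul (fa k km) (fb k km).
Qed.

Lemma realizableD f f' : realizable f -> realizable f' -> realizable (fun k => f k + f' k).
Proof.
move=> [a ka fa] [b kb fb].
exists (@KClass R K d (kidx a + kidx b)%type
  (fun j => match j with inl i => kcoef a i | inr i => kcoef b i end)
  (fun j => match j with inl i => kbundle a i | inr i => kbundle b i end)).
  by case=> i /=; [exact: ka|exact: kb].
by move=> k km; rewrite /class_at big_sumType -(fa k km) -(fb k km).
Qed.

Lemma realizable_mulz f (n : int) : realizable f -> realizable (fun k => f k *~ n).
Proof.
move=> [a ka fa]; exists (KClass (fun j => kcoef a j * n) (kbundle a)) => [|k km]; first exact: ka.
rewrite -(fa k km) /class_at mulrz_suml; apply/eq_bigr => j _; exact: mulrzA.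
Qed.

Lemma realizable_ext f f' : realizable f -> (forall k, ismax F k -> f k = f' k) -> realizable f'.
Proof. by move=> [a ka fa] ff; exists a => [//|k km]; exact: etrans (fa k km) (ff k km). Qed.

Lemma realizable0 : realizable (fun=> 0).
Proof.
exists (@KClass R K d void (of_void _) (of_void _)); first by case.
by move=> k km; rewrite /class_at big1 // => -[].
Qed.

Lemma realizable_sum (I : Type) (r : seq I) (P : pred I) (f : I -> Sigma -> RT d) :
  (forall i, P i -> realizable (f i)) -> realizable (fun k => \sum_(i <- r | P i) f i k).
Proof.
move=> fr; elim: r => [|i r IH].
  by apply: realizable_ext realizable0 _ => k _; rewrite big_nil.
case: (boolP (P i)) => Pi; last by apply: realizable_ext IH _ => k _; rewrite big_cons (negPf Pi).
by apply: realizable_ext (realizableD (fr i Pi) IH) _ => k _; rewrite big_cons Pi.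
Qed.

Lemma realizable_line (h : ray -> int) : realizable (fun k => chi (hvec k h)).
Proof.
pose wt (kappa : cone) : M := if insub kappa is Some s then hvec s h else 0.
have wtE s : wt (val s) = hvec s h by rewrite /wt valK.
have wd s t : (val t `<=` val s)%classic ->
    dual_monoid (val t) (wt (val s) - wt (val t)) /\ dual_monoid (val t) (wt (val t) - wt (val s)).
  move=> /(rays_subP F) ts.
  have e r : r \in rays t -> ev (wt (val s)) (vec r) = ev (wt (val t)) (vec r).
    move=> rt; have rs : r \in rays s by exact: (subsetP ts).
    by rewrite !wtE !ev_sum_du // rs rt.
  by split; apply/(dual_monoidE F) => r rt; rewrite evDl evNl e // subrr.
pose L : vbundle := @VBundle R K d unit (fun kappa _ => wt kappa) (fun _ _ _ _ => 1).
have sumL : \sum_(j : unit) (1 : K) * 1 = 1.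
  by rewrite (big_pred1 tt) ?mulr1 // => -[].
have vL : is_vbundle Sigma L.
  split.
  - move=> kappa tau i j kS tS tk _.
    by have [] := wd [` kS]%fset [` tS]%fset tk.
  - by move=> kappa [] [] _; rewrite eqxx.
  - by move=> *; exact: sumL.
  - move=> kappa tau kS tS tk; exists (fun _ _ => 1); split.
    + by move=> *; have [] := wd [` kS]%fset [` tS]%fset tk.
    + by move=> [] []; rewrite eqxx; exact: sumL.
    + by move=> [] []; rewrite eqxx; exact: sumL.
exists (@KClass R K d unit (fun=> 1) (fun=> L)) => [j //|k _].
by rewrite /class_at (big_pred1 tt) => [|[]//]; rewrite /bundle_at (big_pred1 tt) => [|[]//]; rewrite mulr1z -wtE.
Qed.

(** Koszul resolution: [O_V(t)] is the product of the 1 - [O(-D_r)] over the rays r of t, and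
    [bump r] applied to 0 describes O(-D_r). *)
Lemma realizable_loc t : realizable (fun k => loc F t k).
Proof.
pose f (r : ray) (k : Sigma) : RT d := 1 - chi (hvec k (bump r (fun=> 0))).
have fE r k : f r k = if r \in rays k then 1 - chi (du k r) else 0.
  rewrite /f hvec_bump (_ : hvec k (fun=> 0) = 0); last by rewrite /hvec big1.
  by case: ifP => _; rewrite ?add0r // chi0 subrr.
have r1 : realizable (fun=> 1).
  apply: realizable_ext (realizable_line (fun=> 0)) _ => k _.
  by rewrite (_ : hvec k (fun=> 0) = 0) ?chi0 // /hvec big1.
have rf r : realizable (f r).
  have rn := realizable_mulz (-1) (realizable_line (bump r (fun=> 0))).
  by apply: realizable_ext (realizableD r1 rn) _ => k _; rewrite mulrN1z.
have rp : realizable (fun k => \prod_(r in rays t) f r k).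
  elim: (index_enum _) => [|r rs IH]; first by apply: realizable_ext r1 _ => k _; rewrite big_nil.
  case: (boolP (r \in rays t)) => rt; last by apply: realizable_ext IH _ => k _; rewrite big_cons (negPf rt).
  by apply: realizable_ext (realizableM (rf r) IH) _ => k _; rewrite big_cons rt.
apply: realizable_ext rp _ => k _; rewrite /loc /ray_prod.
case: ifPn => [/subsetP tk|/subsetPn[r rt rk]].
  by apply/eq_bigr => r /tk rk; rewrite fE rk.
by rewrite (bigD1 r) //= fE (negPf rk) mul0r.
Qed.

Lemma realizable_const (a : RT d) : realizable (fun=> a).
Proof.
have rs := realizable_sum (msupp a) (P := xpredT)
  (f := fun p k => chi (hvec k (fun r => ev p (vec r))) *~ a@_p)
  (fun p _ => realizable_mulz a@_p (realizable_line (fun r => ev p (vec r)))).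
apply: realizable_ext rs _ => k km; rewrite [RHS]monRTE; apply/eq_bigr => p _.
by rewrite /hvec -expand_max.
Qed.

Hypothesis compl : complete Sigma.

Lemma class_localization (alpha : kclass) s : is_kclass Sigma alpha ->
  denom F * weight_of alpha s =
  \sum_(k | ismax F k) cofactor_max F k * loc F s k * class_at alpha k.
Proof.
move=> ka; apply: mulz_sum_exchange => j; exact: localization.
Qed.

Variable v : 'rV[R]_d.
Hypothesis su : strongly_unimodular Sigma.
Hypothesis gen : sufficiently_generic Sigma v.

Local Notation sign_at g s t := ((-1) ^+ (#|rays s| + #|rays t| + (d + #|rays g|))).

(* The class is \sum_(s, t) +- g(s) [O_V(t)], over the pairs of the product formula for the zero
   cone. *)
Lemma weight_class (g : Sigma -> RT d) : gweight K g ->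
  exists2 alpha : kclass, is_kclass Sigma alpha & weight_of alpha = g :> (Sigma -> RT d).
Proof.
move=> gw; have [o o0] : exists o : Sigma, rays o = set0.
  have [kappa kS _] := compl 0; exact: (@face_rays _ _ _ F [` kS]%fset _ (sub0set _)).
have lo k : loc F o k = 1 by rewrite /loc o0 sub0set /ray_prod big_set0.
have gl := weight_localization F gw.
pose f k := \sum_(s : Sigma) \sum_(t : Sigma | `[< meeting v o s t >]) sign_at o s t * (g s * loc F t k).
have [alpha ka fa] : realizable f.
  apply: realizable_sum => s _; apply: realizable_sum => t _.
  exact: realizableM (realizable_const _) (realizableM (realizable_const _) (realizable_loc t)).
exists alpha; first exact: ka.
apply/funext => s; apply: (regular_inj (@denom_regular _ _ _ F)).
rewrite (class_localization _ ka) gl; apply/eq_bigr => k km; congr (_ * _).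
(* It remains to see that the class restricts to g k at k. The local identity for the zero cone,
   where [loc F o k] is 1, reproduces g. *)
rewrite (fa k km); apply: (regular_inj (@denom_regular _ _ _ F)).
have := @pairing_left _ _ (ismax F) (fun s t => `[< meeting v o s t >]) (denom F) (cofactor_max F)
  (fun k => ray_prod k (rays k)) (fun k => loc F o k) (fun s k => loc F s k) (fun s t => sign_at o s t)
  (@denomE _ _ _ F) _ g g k gl km.
rewrite lo mul1r; apply => k1 k2; exact: local_identity.
Qed.

(** After multiplication by D twice, both sides are sums over maximal cones, where a product of
    classes restricts to the product of the restrictions. *)
Lemma class_product (alpha beta : kclass) (g : Sigma) : is_kclass Sigma alpha -> is_kclass Sigma beta ->
  weight_of (kmul alpha beta) g =
  \sum_(s : Sigma) \sum_(t : Sigma | `[< meeting v g s t >])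
    sign_at g s t * (weight_of alpha s * weight_of beta t).
Proof.
move=> ka kb; apply: (regular_inj (@denom_regular _ _ _ F)); apply: (regular_inj (@denom_regular _ _ _ F)).
rewrite (class_localization _ (is_kclass_mul ka kb)).
have := @pairing_both _ _ (ismax F) (fun s t => `[< meeting v g s t >]) (denom F) (cofactor_max F)
  (fun k => ray_prod k (rays k)) (fun k => loc F g k) (fun s k => loc F s k) (fun s t => sign_at g s t)
  (@denomE _ _ _ F) _ (weight_of alpha) (weight_of beta) (class_at alpha) (class_at beta).
move=> -> => [|k1 k2|s|s].
- apply: congr1; apply: eq_bigr => k _; apply: congr1; exact: class_at_mul.
- exact: local_identity.
- exact: class_localization.
- exact: class_localization.
Qed.

End Classes.

Local Open Scope classical_set_scope.
Local Open Scope ring_scope.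

Theorem theorem3p9 (R : realType) (k : fieldType) (d : nat)
    (Sigma : {fset set 'rV[R]_d}) (v : 'rV[R]_d) (g1 g2 : Sigma -> RT d)
    (gamma : Sigma) :
  fan Sigma -> complete Sigma -> strongly_unimodular Sigma ->
  sufficiently_generic Sigma v ->
  gweight k g1 -> gweight k g2 ->
  wmul k g1 g2 gamma =
    \sum_(sigma : Sigma) \sum_(tau : Sigma |
        `[< [/\ val gamma `<=` val sigma, val gamma `<=` val tau,
                shift (val sigma) v `&` val tau !=set0 &
                val sigma `&` val tau = val gamma] >])
      (g1 sigma * g2 tau) *~
        (-1) ^ ((set_dim (val sigma))%:Z + (set_dim (val tau))%:Z - d%:Z
                + (set_dim (val gamma))%:Z).
Proof.
move=> fS cS su gen w1 w2; have [F] := fan_data_exists fS su.1.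
have [alpha ka ea] := weight_class F cS su gen w1.
have [beta kb eb] := weight_class F cS su gen w2.
(* The product is defined through some choice of representing classes, and [class_product] applies
   to whichever are chosen. The classes found above show that the choice is not the default
   value. *)
have [a [b [ka' kb' ea' eb' ->]]] : exists a b : kclass R k d, [/\ is_kclass Sigma a, is_kclass Sigma b,
    weight_of a = g1, weight_of b = g2 & wmul k g1 g2 = weight_of (kmul a b)].
  apply: (@xgetPex _ (fun=> 0) [set g | exists a b : kclass R k d, [/\ is_kclass Sigma a,
    is_kclass Sigma b, weight_of a = g1, weight_of b = g2 & g = weight_of (kmul a b)]]%classic).
  by exists (weight_of (kmul alpha beta)), alpha, beta.
rewrite (class_product F cS su gen gamma ka' kb') ea' eb'.
apply/eq_bigr => s _; apply/eq_bigr => t _.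
by rewrite !(set_dimE F) sign_exprz mulz_sign.
Qed.
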